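(* Let $\mathbf B=(B_i)_{0\le i\le p}$ be a collection of HTL normal forms, and let the quiver $\mathsf Q$, $\alpha\in(\mathbb Z_{\ge0})^{\mathsf Q_0}$ and $\lambda\in\mathbb C^{\mathsf Q_0}$ be the associated data defined in the context. Then there exist $\lambda'\in\mathbb C^{\mathsf Q_0}$ and an injection $$\Phi:\mathfrak M(\mathbf B)\hookrightarrow\mathfrak M^{\rm reg}_{\lambda'}(\mathsf Q,\alpha)$$ such that $$\Phi(\mathfrak M(\mathbf B))=\Bigl\{x\in\mathfrak M^{\rm reg}_{\lambda'}(\mathsf Q,\alpha)\ \Big|\ \det\bigl(x_{\rho^{[0,j]}_{[i,j']}}\bigr)_{1\le j\le m_0,\,1\le j'\le m_i}\ne0\ \text{ for all } i\in I_{\rm irr}\setminus\{0\}\Bigr\}.$$ In particular, if $I_{\rm irr}=\{0\}$, then $\lambda'=\lambda$ and $\Phi$ is bijective.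
   Context: **Truncated orbits.** $\mathfrak g_k^*=\{\sum_{j=1}^kA_jz^{-j}: A_j\in M(n,\mathbb C)\}=M(n,z^{-k}\mathbb C[[z]]/\mathbb C[[z]])$, on which $G_k=\mathrm{GL}(n,\mathbb C[[z]]/z^k\mathbb C[[z]])$ acts by conjugation modulo $\mathbb C[[z]]$; $\mathcal O_B=\{gBg^{-1}: g\in G_k\}$. **HTL normal forms.** Let $n\ge1$, $p\ge0$, $k_0,\dots,k_p\ge1$. For $i=0,\dots,p$, $$B_i=\mathrm{diag}\bigl(q_{[i,1]}(z^{-1})I_{n_{[i,1]}}+R_{[i,1]}z^{-1},\dots,q_{[i,m_i]}(z^{-1})I_{n_{[i,m_i]}}+R_{[i,m_i]}z^{-1}\bigr)\in\mathfrak g_{k_i}^*$$ is $n\times n$ with $q_{[i,j]}(s)\in s^2\mathbb C[s]$ (degree $\le k_i$), $q_{[i,j]}\ne q_{[i,j']}$ for $j\neq j'$, $n_{[i,j]}\ge1$, $R_{[i,j]}\in M(n_{[i,j]},\mathbb C)$ (an unramified Hukuhara--Turrittin--Levelt, HTL, normal form). **Moduli space.** $\mathfrak M(\mathbf B)$ is the moduli space of stable meromorphic connections on the trivial rank $n$ bundle over $\mathbb P^1$ whose principal part at the $i$-th singular point lies in $\mathcal O_{B_i}$. Equivalently $$\mathfrak M(\mathbf B)=\Bigl\{\bigl(\textstyle\sum_{j=1}^{k_i}A_{i,j}z^{-j}\bigr)_{0\le i\le p}\in\prod_{i=0}^p\mathcal O_{B_i}\ \Big|\ (A_{i,j})_{i,j}\text{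 irreducible},\ \sum_{i=0}^pA_{i,1}=0\Bigr\}\Big/\mathrm{GL}(n,\mathbb C)$$ (simultaneous conjugation), where irreducible means that the only subspaces of $\mathbb C^n$ invariant under all $A_{i,j}$ are $\{0\}$ and $\mathbb C^n$. **The quiver.** Choose $\xi^{[i,j]}_1,\dots,\xi^{[i,j]}_{e_{[i,j]}}\in\mathbb C$ with $\prod_{k=1}^{e_{[i,j]}}(R_{[i,j]}-\xi^{[i,j]}_k)=0$. Set $I_{\rm irr}=\{i: m_i>1\}\cup\{0\}$, $I_{\rm reg}=\{0,\dots,p\}\setminus I_{\rm irr}$, $d_i(j,j')=\deg(q_{[i,j]}-q_{[i,j']})-2$ for $j\ne j'$. $\mathsf Q$ has vertices $[i,j]$ ($i\in I_{\rm irr}$, $1\le j\le m_i$) and $[i,j,k]$ ($0\le i\le p$, $1\le j\le m_i$, $1\le k\le e_{[i,j]}-1$), and arrows: - $\rho^{[0,j]}_{[i,j']}:[0,j]\to[i,j']$ for $1\le j\le m_0$, $i\in I_{\rm irr}\setminus\{0\}$, $1\le j'\le m_i$; - $\rho^{[k]}_{[i,j],[i,j']}:[i,j]\to[i,j']$ for $i\in I_{\rm irr}$, $1\le j<j'\le m_i$, $1\le k\le d_i(j,j')$; - $\rho_{[i,j,1]}:[i,j,1]\to[i,j]$ for $i\in I_{\rm irr}$, $1\le j\le m_i$; - $\rho^{[i,1,1]}_{[0,j]}:[i,1,1]\to[0,j]$ for $i\in I_{\rm reg}$, $1\le j\le m_0$; - $\rho_{[i,j,k]}:[i,j,k]\to[i,j,k-1]$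 for all $i,j$ and $2\le k\le e_{[i,j]}-1$ (arrows out of $[i,j,1]$ only if $e_{[i,j]}\ge2$). Set $\alpha_{[i,j]}=n_{[i,j]}$, $\alpha_{[i,j,k]}=\mathrm{rank}\prod_{l=1}^k(R_{[i,j]}-\xi^{[i,j]}_l)$; $\lambda_{[i,j]}=-\xi^{[i,j]}_1$ for $i\in I_{\rm irr}\setminus\{0\}$, $\lambda_{[0,j]}=-\xi^{[0,j]}_1-\sum_{i\in I_{\rm reg}}\xi^{[i,1]}_1$, $\lambda_{[i,j,k]}=\xi^{[i,j]}_k-\xi^{[i,j]}_{k+1}$. **Quiver varieties.** The double $\overline{\mathsf Q}$ adds a reverse arrow $\rho^*$ for each arrow $\rho$ of $\mathsf Q$. $\mathrm{Rep}(\overline{\mathsf Q},\alpha)=\bigoplus_{\rho\in\overline{\mathsf Q}_1}\mathrm{Hom}(\mathbb C^{\alpha_{s(\rho)}},\mathbb C^{\alpha_{t(\rho)}})$, acted on by $\mathbf G(\alpha)=\prod_a\mathrm{GL}(\alpha_a,\mathbb C)$ via $(g\cdot x)_\rho=g_{t(\rho)}x_\rho g_{s(\rho)}^{-1}$. Moment map: $\mu_\alpha(x)_a=\sum_{\rho\in\mathsf Q_1,t(\rho)=a}x_\rho x_{\rho^*}-\sum_{\rho\in\mathsf Q_1,s(\rho)=a}x_{\rho^*}x_\rho$. For $\nu\in\mathbb C^{\mathsf Q_0}$, $\mu_\alpha^{-1}(\nu)$ is the fibre over $(\nu_aI_{\alpha_a})_a$, $\mu_\alpha^{-1}(\nu)^{\rm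 irr}$ its subset of irreducible representations (no subrepresentations except $0$ and itself), and $\mathfrak M^{\rm reg}_\nu(\mathsf Q,\alpha)=\mu_\alpha^{-1}(\nu)^{\rm irr}/\mathbf G(\alpha)$. The block matrix $(x_{\rho^{[0,j]}_{[i,j']}})_{j,j'}$ is regarded as a square matrix $\bigoplus_j\mathbb C^{\alpha_{[0,j]}}\to\bigoplus_{j'}\mathbb C^{\alpha_{[i,j']}}$ of size $n$; non-vanishing of its determinant is $\mathbf G(\alpha)$-invariant. *)

(* Defs.v *)
From HB Require Import structures.
From mathcomp Require Import all_boot all_algebra.
From mathcomp Require Import qpoly complex.
From mathcomp Require Import boolp classical_sets functions reals.

Set Implicit Arguments.
Unset Strict Implicit.
Unset Printing Implicit Defensive.

Import GRing.Theory.
Local Open Scope ring_scope.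
Local Open Scope classical_set_scope.

(* Throughout, matrices act on column vectors from the left, and an orbit space
   X / G is the set of G-orbits in X, an orbit being a classical subset. *)

Section TruncatedOrbits.
Variables (F : fieldType) (n k : nat).

(* sum_(1 <= l <= k) A_l z^-l is the family A with A_l stored at index l - 1. *)
Definition ppart := 'I_k -> 'M[F]_n.

(* F[z]/(z^k) = F[[z]]/(z^k); the library quotient {poly %/ 'X^k} is the
   intended ring only for 0 < k. *)
Definition tpoly := {poly %/ ('X^k : {poly F})}.

(* Multiplication by z^k, an isomorphism of F[[z]]/(z^k)-modules from
   M(n, z^-k F[[z]] / F[[z]]) onto M(n, F[[z]]/(z^k)). *)
Definition clear_pole (A : ppart) : 'M[tpoly]_n :=
  \matrix_(a, b) in_qpoly ('X^k : {poly F})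
     (\sum_(l < k) A l a b *: 'X^(k - l.+1)).

Definition torbit (B : ppart) : set ppart :=
  [set A | exists2 g : 'M[tpoly]_n,
     g \in unitmx & clear_pole A = g *m clear_pole B *m invmx g].

End TruncatedOrbits.

(* An unramified Hukuhara-Turrittin-Levelt normal form, with diagonal blocks
   q_j(z^-1) I + R_j z^-1 of size bsize j, where q_j = bpoly j, R_j = bres j. *)
Record htl (F : fieldType) (n k : nat) := Htl {
  nblk : nat;
  bsize : 'I_nblk -> nat;
  bpoly : 'I_nblk -> {poly F};
  bres : forall j, 'M[F]_(bsize j);
  bsize_gt0 : forall j, (0 < bsize j)%N;
  bsize_sum : (\sum_(j < nblk) bsize j)%N = n;
  bpoly_ord : forall j, 'X^2 %| bpoly j;
  bpoly_deg : forall j, (size (bpoly j) <= k.+1)%N;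
  bpoly_inj : injective bpoly
}.
Arguments nblk {F n k}.
Arguments bsize {F n k}.
Arguments bpoly {F n k}.
Arguments bres {F n k}.
Arguments bsize_sum {F n k}.

Definition htl_ppart (F : fieldType) (n k : nat) (B : htl F n k) : ppart F n k :=
  fun l => castmx (bsize_sum B, bsize_sum B)
    (\mxdiag_(j < nblk B)
       (((bpoly B j)`_l.+1)%:M + (if l == 0%N :> nat then bres B j else 0))).

Section Connections.
Variables (F : fieldType) (n p : nat) (k : 'I_p.+1 -> nat).

Definition pparts := forall i : 'I_p.+1, ppart F n (k i).

Definition pparts_irr (A : pparts) : Prop :=
  forall U : {vspace 'cV[F]_n},
    (forall (i : 'I_p.+1) (l : 'I_(k i)) (v : 'cV[F]_n),
       v \in U -> A i l *m v \in U) ->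
    U = 0%VS \/ U = fullv.

(* [l == 0] is the coefficient of z^-1; it occurs exactly once as 0 < k i. *)
Definition residue (A : pparts) (i : 'I_p.+1) : 'M[F]_n :=
  \sum_(l < k i | l == 0%N :> nat) A i l.

Definition gl_orbit (A : pparts) : set pparts :=
  [set A' | exists2 g : 'M[F]_n,
     g \in unitmx & A' = fun i l => g *m A i l *m invmx g].

Definition moduli (B : forall i, htl F n (k i)) : set (set pparts) :=
  gl_orbit @` [set A | [/\ forall i, torbit (htl_ppart (B i)) (A i),
                           pparts_irr A &
                           \sum_(i < p.+1) residue A i = 0]].

End Connections.

Record quiver := Quiver {
  vert : finType;
  arrow : finType;
  src : arrow -> vert;
  tgt : arrow -> vert
}.
Arguments src {q}.
Arguments tgt {q}.

(* [inl r] is the arrow r itself and [inr r] its reverse. *)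
Definition double (Q : quiver) : quiver :=
  @Quiver (vert Q) (arrow Q + arrow Q)%type
    (fun r => match r with inl r => src r | inr r => tgt r end)
    (fun r => match r with inl r => tgt r | inr r => src r end).

Definition rep (F : fieldType) (Q : quiver) (alpha : vert Q -> nat) :=
  forall r : arrow Q, 'M[F]_(alpha (tgt r), alpha (src r)).

Definition rep_irr (F : fieldType) (Q : quiver) (alpha : vert Q -> nat)
    (x : rep F alpha) : Prop :=
  forall U : (forall a, {vspace 'cV[F]_(alpha a)}),
    (forall r (v : 'cV[F]_(alpha (src r))),
       v \in U (src r) -> x r *m v \in U (tgt r)) ->
    (forall a, U a = 0%VS) \/ (forall a, U a = fullv).

Definition rep_orbit (F : fieldType) (Q : quiver) (alpha : vert Q -> nat)
    (x : rep F alpha) : set (rep F alpha) :=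
  [set y | exists2 g : (forall a, 'M[F]_(alpha a)),
     (forall a, g a \in unitmx) &
     y = fun r => g (tgt r) *m x r *m invmx (g (src r))].

Section QuiverVariety.
Variables (F : fieldType) (Q : quiver) (alpha : vert Q -> nat).

Definition drep := @rep F (double Q) alpha.

(* In the summands [tgt r = a] (resp. [src r = a]), so that [conform_mx 0] is
   a mere cast to 'M_(alpha a). *)
Definition moment (x : drep) (a : vert Q) : 'M[F]_(alpha a) :=
  \sum_(r : arrow Q | tgt r == a)
     conform_mx (0 : 'M_(alpha a))
       ((x (inl r) : 'M_(alpha (tgt r), alpha (src r)))
        *m (x (inr r) : 'M_(alpha (src r), alpha (tgt r))))
  - \sum_(r : arrow Q | src r == a)
     conform_mx (0 : 'M_(alpha a))
       ((x (inr r) : 'M_(alpha (src r), alpha (tgt r)))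
        *m (x (inl r) : 'M_(alpha (tgt r), alpha (src r)))).

Definition quiver_variety (nu : vert Q -> F) : set (set drep) :=
  @rep_orbit F (double Q) alpha @`
    [set x : drep | (forall a, moment x a = (nu a)%:M) /\ rep_irr x].

End QuiverVariety.
Arguments quiver_variety {F Q} alpha nu.

Section HtlQuiver.
Variables (F : fieldType) (n p : nat) (k : 'I_p.+1 -> nat).
Variable B : forall i, htl F n (k i).

Definition Iirr : {set 'I_p.+1} :=
  [set i | (1 < nblk (B i))%N || (i == ord0)]%SET.

Fact ord0_irr : ord0 \in Iirr.
Proof. by rewrite inE eqxx orbT. Qed.

Definition irr_mult (i : 'I_p.+1) (j j' : 'I_(nblk (B i))) : nat :=
  ((size (bpoly (B i) j - bpoly (B i) j')%R).-1 - 2)%N.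

(* [xi i j] lists xi^[i,j]_1, ..., xi^[i,j]_e, hence e_[i,j] = size (xi i j)
   and xi^[i,j]_k is the entry of index k - 1. *)
Variable xi : forall i, 'I_(nblk (B i)) -> seq F.
Arguments xi : clear implicits.

Definition xi_annihilates : Prop :=
  forall i j, \prod_(c <- xi i j) (bres (B i) j - c%:M) = 0.

Definition leg (i : 'I_p.+1) (j : 'I_(nblk (B i))) : nat := (size (xi i j)).-1.

(* The index l of [Vleg i j l] is that of the vertex [i,j,l+1]. *)
Inductive hvert :=
| Vbase (i : 'I_p.+1) (_ : i \in Iirr) (j : 'I_(nblk (B i)))
| Vleg (i : 'I_p.+1) (j : 'I_(nblk (B i))) (l : 'I_(leg j)).

(* - [Across]: [0,j] -> [i,j'] for i in Iirr, i != 0;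
   - [Airr]: [i,j] -> [i,j'] for i in Iirr and j < j', with multiplicity;
   - [Aend]: [i,j,1] -> [i,j] for i in Iirr, when e_[i,j] >= 2;
   - [Areg]: [i,1,1] -> [0,j] for i not in Iirr, when e_[i,1] >= 2; then
     nblk (B i) = 1, so that j1 is the only block index at i;
   - [Aleg]: [i,j,l+2] -> [i,j,l+1]. *)
Inductive harrow :=
| Across (j : 'I_(nblk (B ord0))) (i : 'I_p.+1) (_ : i \in Iirr)
    (_ : i != ord0) (j' : 'I_(nblk (B i)))
| Airr (i : 'I_p.+1) (_ : i \in Iirr) (j j' : 'I_(nblk (B i))) (_ : (j < j')%N)
    (_ : 'I_(irr_mult j j'))
| Aend (i : 'I_p.+1) (_ : i \in Iirr) (j : 'I_(nblk (B i))) (_ : (0 < leg j)%N)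
| Areg (i : 'I_p.+1) (_ : i \notin Iirr) (j1 : 'I_(nblk (B i)))
    (_ : (0 < leg j1)%N) (j : 'I_(nblk (B ord0)))
| Aleg (i : 'I_p.+1) (j : 'I_(nblk (B i))) (l : 'I_(leg j))
    (_ : (l.+1 < leg j)%N).

Definition hsrc (r : harrow) : hvert :=
  match r with
  | Across j _ _ _ _ => Vbase ord0_irr j
  | Airr _ hi j _ _ _ => Vbase hi j
  | Aend _ _ _ h => Vleg (Ordinal h)
  | Areg _ _ _ h _ => Vleg (Ordinal h)
  | Aleg _ _ _ h => Vleg (Ordinal h)
  end.

Definition htgt (r : harrow) : hvert :=
  match r with
  | Across _ _ hi _ j' => Vbase hi j'
  | Airr _ hi _ j' _ _ => Vbase hi j'
  | Aend _ hi j _ => Vbase hi j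
  | Areg _ _ _ _ j => Vbase ord0_irr j
  | Aleg _ _ l _ => Vleg l
  end.

Definition hvert_code : finType :=
  ({i : {i | i \in Iirr} & 'I_(nblk (B (sval i)))} +
   {i : 'I_p.+1 & {j : 'I_(nblk (B i)) & 'I_(leg j)}})%type.

Definition hvert_encode (a : hvert) : hvert_code :=
  match a with
  | Vbase i hi j =>
      inl (existT (fun i : {i | i \in Iirr} => 'I_(nblk (B (sval i))))
             (exist _ i hi) j)
  | Vleg i j l =>
      inr (existT (fun i => {j : 'I_(nblk (B i)) & 'I_(leg j)}) i
             (existT (fun j => 'I_(leg j)) j l))
  end.

Definition hvert_decode (c : hvert_code) : hvert :=
  match c with
  | inl (existT (exist i hi) j) => @Vbase i hi j
  | inr (existT i (existT j l)) => @Vleg i j l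
  end.

Fact hvert_encodeK : cancel hvert_encode hvert_decode.
Proof. by case. Qed.

HB.instance Definition _ := Finite.copy hvert (can_type hvert_encodeK).

Definition across_code : Type :=
  {i : {i | i \in Iirr} & ({_ : unit | sval i != ord0} *
     ('I_(nblk (B ord0)) * 'I_(nblk (B (sval i)))))%type}.

Definition airr_code : Type :=
  {i : {i | i \in Iirr} &
    {jj : {jj : 'I_(nblk (B (sval i))) * 'I_(nblk (B (sval i)))
            | (jj.1 < jj.2)%N} &
      'I_(irr_mult (sval jj).1 (sval jj).2)}}.

Definition aend_code : Type :=
  {i : {i | i \in Iirr} & {j : 'I_(nblk (B (sval i))) | (0 < leg j)%N}}.

Definition areg_code : Type :=
  {i : {i | i \notin Iirr} &
    ({j : 'I_(nblk (B (sval i))) | (0 < leg j)%N} * 'I_(nblk (B ord0)))%type}.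

Definition aleg_code : Type :=
  {i : 'I_p.+1 &
    {j : 'I_(nblk (B i)) & {l : 'I_(leg j) | (l.+1 < leg j)%N}}}.

HB.instance Definition _ := Finite.on across_code.
HB.instance Definition _ := Finite.on airr_code.
HB.instance Definition _ := Finite.on aend_code.
HB.instance Definition _ := Finite.on areg_code.
HB.instance Definition _ := Finite.on aleg_code.

Definition harrow_code : Type :=
  (across_code + airr_code + aend_code + areg_code + aleg_code)%type.

Definition harrow_encode (r : harrow) : harrow_code :=
  match r with
  | @Across j i hi h0 j' =>
      inl (inl (inl (inl (existT _ (exist _ i hi) (exist _ tt h0, (j, j'))))))
  | @Airr i hi j j' h c =>
      inl (inl (inl (inr (existT _ (exist _ i hi)
                            (existT _ (exist _ (j, j') h) c)))))
  | @Aend i hi j h => inl (inl (inr (existT _ (exist _ i hi) (exist _ j h))))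
  | @Areg i hi j1 h j =>
      inl (inr (existT _ (exist _ i hi) (exist _ j1 h, j)))
  | @Aleg i j l h => inr (existT _ i (existT _ j (exist _ l h)))
  end.

Definition harrow_decode (c : harrow_code) : harrow :=
  match c with
  | inl (inl (inl (inl (existT (exist i hi) (exist _ h0, (j, j')))))) =>
      @Across j i hi h0 j'
  | inl (inl (inl (inr (existT (exist i hi) (existT (exist (j, j') h) c))))) =>
      @Airr i hi j j' h c
  | inl (inl (inr (existT (exist i hi) (exist j h)))) => @Aend i hi j h
  | inl (inr (existT (exist i hi) (exist j1 h, j))) => @Areg i hi j1 h j
  | inr (existT i (existT j (exist l h))) => @Aleg i j l h
  end.

Fact harrow_encodeK : cancel harrow_encode harrow_decode.
Proof. by case. Qed.

HB.instance Definition _ := Finite.copy harrow (can_type harrow_encodeK).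

Definition hquiver : quiver := @Quiver hvert harrow hsrc htgt.

Definition halpha (a : vert hquiver) : nat :=
  match a with
  | Vbase i _ j => bsize (B i) j
  | Vleg i j l =>
      \rank (\prod_(c <- take l.+1 (xi i j)) (bres (B i) j - c%:M))
  end.

(* The inner sum runs over the single block index of i \notin Iirr. *)
Definition hlambda (a : vert hquiver) : F :=
  match a with
  | Vbase i _ j =>
      - (xi i j)`_0
      - (if i == ord0 then
           \sum_(i' | i' \notin Iirr) \sum_(j' < nblk (B i')) (xi i' j')`_0
         else 0)
  | Vleg i j l => (xi i j)`_l - (xi i j)`_l.+1
  end.

(* The block matrix (x_(rho^[0,j]_[i,j'])), with block row j' and block
   column j. *)
Definition cross_mx (x : drep F halpha) (i : 'I_p.+1) (hi : i \in Iirr)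
    (h0 : i != ord0) : 'M[F]_n :=
  castmx (bsize_sum (B i), bsize_sum (B ord0))
    (\mxblock_(j' < nblk (B i), j < nblk (B ord0))
       (x (inl (Across j hi h0 j'))
          : 'M[F]_(bsize (B i) j', bsize (B ord0) j))).

(* This open condition is invariant under base change, so that it may be
   tested on all representatives of an orbit. *)
Definition cross_det_neq0 (O : set (drep F halpha)) : Prop :=
  forall x, O x -> forall i (hi : i \in Iirr) (h0 : i != ord0),
    \det (cross_mx x hi h0) != 0.

End HtlQuiver.
Arguments halpha {F n p k B} xi a.
Arguments hlambda {F n p k B} xi a.

(* Main.v *)
Require Import Defs.
From mathcomp Require Import all_boot all_algebra.
From mathcomp Require Import zify ring.
From Corelib Require Import Setoid Morphisms.

(** A connection with irregular type diag(q_j) is brought to a normal form by a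
    gauge transformation g in GL_n(C[[z]]/z^k).  Splitting the blocks along a
    binary tree, according to the leading order at which the polynomials q_j
    separate, one eliminates one unipotent factor of g per node of the tree:
    a point of the orbit is, up to a constant conjugation, an explicit matrix
    Yhat(x), where x is a tuple of blocks x_l : [i,j] -> [i,j'] and
    x_l : [i,j'] -> [i,j] for l < deg(q_j - q_j') - 2, together with a residue
    whose diagonal blocks are, up to conjugation, R_j plus the diagonal blocks
    of the residue of Yhat(x).  The latter are exactly the sums of x x^* that
    enter the moment map, and the coefficients of Yhat(x) and the blocks of x
    determine each other by algebra operations, so that intertwiners and
    invariant subspaces agree on both sides.  The orbits of the R_j are encoded
    by the legs, by factoring R_j - xi_1 through its image.

    The frames of the different poles are compared with the frame at the pole 0:
    the comparison matrices X_i are the blocks x_(rho^[0,j]_[i,j']), which is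
    why they are invertible, and the residue at i is zeta - X_i Y_i.  The shift
    zeta of the parameter is needed for irreducibility: a subrepresentation of
    dimension d satisfies sum_a lambda'_a d_a = 0, and for generic zeta this
    forces its total dimension over every pole to be the same, so that it comes
    from a subspace invariant under the connection. *)

Set Implicit Arguments.
Unset Strict Implicit.
Unset Printing Implicit Defensive.

Import GRing.Theory.
Local Open Scope ring_scope.

(** * Identities in noncommutative rings *)

(** One tuple x serves both directions of a pair of blocks. After multiplication by z^K, at a node
    whose two families separate in degree m, the lower left block of x_l is the coefficient of
    degree l + 1 of the unipotent factor, and its upper right block is the coefficient of degree K -
    2 - l of the triangular remainder. The two degrees add up to K - 1, the place of the residue, so
    x_l is paired with itself there. The remainder starts in degree m + 1, which leaves l < K - m -
    2, and K - m is the degree of q_j - q_j'. The off-diagonal blocks of the residue are no data: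
    further coefficients of the unipotent factor and of the remainder absorb them. In the dimension
    argument, let d_i be the dimension of a subrepresentation over the pole i. Injectivity of X_i
    gives d_0 <= d_i. The parameter is shifted by zeta at the poles of I_irr other than 0, and at 0
    by -zeta times their number, so for generic zeta the trace identity says that those d_i add up
    to their number times d_0; all the inequalities are then equalities. *)

Inductive ncexpr :=
| NCvar of nat | NC0 | NC1
| NCadd of ncexpr & ncexpr | NCopp of ncexpr | NCmul of ncexpr & ncexpr.

Section Noncommutative.
Variables (R : pzRingType) (env : seq R).

Fixpoint nceval e : R :=
  match e with
  | NCvar i => nth 0 env i
  | NC0 => 0
  | NC1 => 1
  | NCadd a b => nceval a + nceval b
  | NCopp a => - nceval a
  | NCmul a b => nceval a * nceval b
  end.

(* A sum of signed words in the variables; [true] is the sign -1. *)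
Definition ncform := seq (bool * seq nat).

Fixpoint ncnorm e : ncform :=
  match e with
  | NCvar i => [:: (false, [:: i])]
  | NC0 => [::]
  | NC1 => [:: (false, [::])]
  | NCadd a b => ncnorm a ++ ncnorm b
  | NCopp a => [seq (~~ m.1, m.2) | m <- ncnorm a]
  | NCmul a b => [seq (m.1 (+) m'.1, m.2 ++ m'.2) | m <- ncnorm a, m' <- ncnorm b]
  end.

Definition ncword (m : bool * seq nat) : R :=
  (-1) ^+ m.1 * \prod_(i <- m.2) nth 0 env i.

Definition ncsum (l : ncform) : R := \sum_(m <- l) ncword m.

Lemma ncwordM (m m' : bool * seq nat) :
  ncword (m.1 (+) m'.1, m.2 ++ m'.2) = ncword m * ncword m'.
Proof.
rewrite /ncword /= big_cat /=.
by case: m.1; case: m'.1; rewrite /= ?expr0 ?expr1 ?mul1r ?mulN1r ?mulrN ?mulNr ?opprK.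
Qed.

Lemma ncsum_norm e : ncsum (ncnorm e) = nceval e.
Proof.
rewrite /ncsum; elim: e => /= [i|||a <- b <-|a <-|a <- b <-].
- by rewrite big_seq1 /ncword /= big_seq1 mul1r.
- by rewrite big_nil.
- by rewrite big_seq1 /ncword /= big_nil mul1r.
- by rewrite big_cat.
- rewrite big_map -sumrN; apply: eq_bigr => m _.
  by rewrite /ncword /=; case: m.1; rewrite ?expr0 ?expr1 ?mul1r ?mulN1r ?opprK.
- rewrite big_allpairs_dep mulr_suml; apply: eq_bigr => m _.
  by rewrite mulr_sumr; apply: eq_bigr => m' _; apply: ncwordM.
Qed.

(** Each round removes a word and its opposite, so the recursion is not structural in the list; the
    fuel bounds the number of rounds. *)
Fixpoint nccancel fuel (l : ncform) : bool :=
  if fuel is f.+1 then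
    if l is (s, w) :: l' then
      ((~~ s, w) \in l') && nccancel f (rem (~~ s, w) l')
    else true
  else false.

Lemma nccancelP fuel l : nccancel fuel l -> ncsum l = 0.
Proof.
elim: fuel l => // f IH [|[s w] l'] /=; first by rewrite /ncsum big_nil.
case/andP=> sin /IH; rewrite /ncsum => l0.
rewrite big_cons (perm_big _ (perm_to_rem sin)) big_cons /= l0 addr0.
by rewrite /ncword /=; case: s {sin l0}; rewrite /= expr0 expr1 mulN1r mul1r ?addrN ?addNr.
Qed.

(** Words are lists of variable indices, so the test is a closed computation, independent of the
    ring. *)
Lemma ncringP e1 e2 :
  (let l := ncnorm (NCadd e1 (NCopp e2)) in nccancel (size l).+1 l) ->
  nceval e1 = nceval e2.
Proof.
by move=> /nccancelP; rewrite ncsum_norm /= => /eqP; rewrite subr_eq0 => /eqP.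
Qed.

End Noncommutative.

Ltac nc_index x l :=
  match l with
  | x :: _ => constr:(0%N)
  | _ :: ?l' => let n := nc_index x l' in constr:(S n)
  end.
Ltac nc_mem x l :=
  match l with
  | x :: _ => constr:(true)
  | _ :: ?l' => nc_mem x l'
  | _ => constr:(false)
  end.
Ltac nc_add x l :=
  match nc_mem x l with true => l | false => constr:(x :: l) end.
Ltac nc_vars e l :=
  match e with
  | GRing.add ?a ?b => let l1 := nc_vars a l in nc_vars b l1
  | GRing.opp ?a => nc_vars a l
  | GRing.mul ?a ?b => let l1 := nc_vars a l in nc_vars b l1
  | @GRing.zero _ => l
  | @GRing.one _ => l
  | _ => nc_add e l
  end.
Ltac nc_reify e l :=
  match e with
  | GRing.add ?a ?b =>
      let x := nc_reify a l in let y := nc_reify b l in constr:(NCadd x y)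
  | GRing.opp ?a => let x := nc_reify a l in constr:(NCopp x)
  | GRing.mul ?a ?b =>
      let x := nc_reify a l in let y := nc_reify b l in constr:(NCmul x y)
  | @GRing.zero _ => constr:(NC0)
  | @GRing.one _ => constr:(NC1)
  | _ => let n := nc_index e l in constr:(NCvar n)
  end.
Ltac ncring :=
  match goal with
  | |- @eq ?T ?a ?b =>
    let l := nc_vars a (@nil T) in
    let l' := nc_vars b l in
    let x := nc_reify a l' in let y := nc_reify b l' in
    apply: (@ncringP _ l' x y); vm_compute; reflexivity
  end.

(** * Polynomials modulo a power of the variable *)

Section Truncated.
Variable A : nzRingType.
Implicit Types p q r : {poly A}.

(** Congruence modulo ['X^m]; the coefficients need not commute, but ['X] is central. *)
Definition eqm m p q := forall i, (i < m)%N -> p`_i = q`_i.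

Lemma eqm_refl m p : eqm m p p. Proof. by []. Qed.
Lemma eqm_sym m p q : eqm m p q -> eqm m q p.
Proof. by move=> e i /e. Qed.
Lemma eqm_trans m p q r : eqm m p q -> eqm m q r -> eqm m p r.
Proof. by move=> e e' i im; rewrite e ?e'. Qed.

#[global] Instance eqm_equiv m : Equivalence (eqm m).
Proof. split; [exact: eqm_refl|exact: eqm_sym|exact: eqm_trans]. Qed.

#[global] Instance eqm_add m : Proper (eqm m ==> eqm m ==> eqm m) +%R.
Proof. by move=> p p' e q q' e' i im; rewrite !coefD e ?e'. Qed.
#[global] Instance eqm_opp m : Proper (eqm m ==> eqm m) -%R.
Proof. by move=> p p' e i im; rewrite !coefN e. Qed.
#[global] Instance eqm_mul m : Proper (eqm m ==> eqm m ==> eqm m) *%R.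
Proof.
move=> p p' e q q' e' i im; rewrite !coefM; apply: eq_bigr => j _.
by rewrite e ?e' ?(leq_ltn_trans (leq_subr _ _)) // (leq_ltn_trans _ im) // -ltnS.
Qed.

Lemma eqm_le m m' p q : (m' <= m)%N -> eqm m p q -> eqm m' p q.
Proof. by move=> le e i im; apply: e; apply: leq_trans le. Qed.

Lemma eqm_subr0 m p q : eqm m (p - q) 0 <-> eqm m p q.
Proof.
by split=> e i /e; rewrite coefB coef0 => /eqP; rewrite ?subr_eq0 => /eqP // ->; rewrite subrr.
Qed.

Lemma eqmM0 m m' M p q : (M <= m + m')%N -> eqm m p 0 -> eqm m' q 0 -> eqm M (p * q) 0.
Proof.
move=> le e e' i im; rewrite coefM coef0 big1 // => j _.
have [jm|mj] := ltnP j m; first by rewrite e // coef0 mul0r.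
rewrite e' ?coef0 ?mulr0 // ltn_subLR ?(leq_trans im) //; last by rewrite -ltnS.
by rewrite (leq_trans le) // leq_add2r.
Qed.

Lemma eqmM0l m p q : eqm m p 0 -> eqm m (p * q) 0.
Proof. by move=> e; apply: (@eqmM0 m 0) => //; rewrite addn0. Qed.
Lemma eqmM0r m p q : eqm m q 0 -> eqm m (p * q) 0.
Proof. by move=> e; apply: (@eqmM0 0 m). Qed.

Lemma eqmXn m : eqm m 'X^m 0.
Proof. by move=> i im; rewrite coefXn coef0 ltn_eqF. Qed.

Lemma eqm1 p q : p`_0 = q`_0 -> eqm 1 p q.
Proof. by move=> e [|i]. Qed.

(** Neumann series: [1 - p] has no constant term, so its powers vanish modulo ['X^K] from the K-th
    on. *)
Lemma eqm_inv (K : nat) p : p`_0 = 1 ->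
  exists q, [/\ q`_0 = 1, eqm K (p * q) 1 & eqm K (q * p) 1].
Proof.
move=> p0; pose a := 1 - p.
have a0 : eqm 1 a 0 by apply/eqm_subr0; apply: eqm1; rewrite coef1 p0.
have aK : eqm K (a ^+ K) 0.
  elim: {1 2}K => [|k IH]; first by move=> ?; rewrite ltn0.
  by rewrite exprS; apply: eqmM0 a0 IH.
(* The extra term makes the sum nonempty even for [K = 0], so that its constant coefficient is
   always 1. *)
pose q := \sum_(i < K.+1) a ^+ i.
have pE : p = 1 - a by rewrite /a; ncring.
have aK1 : eqm K (a ^+ K.+1) 0 by rewrite exprS; apply: eqmM0r.
have cq : p * q = q * p.
  apply: commr_sum => i _; apply: commrX; rewrite /a.
  by apply: commrB; [apply: commr1|].
have pq : p * q = 1 - a ^+ K.+1.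
  by rewrite [in LHS]pE -opprB mulNr -subrX1 opprB.
exists q; rewrite -cq pq; split.
- rewrite /q big_ord_recl expr0 coefD coef1 coef_sum big1 ?addr0 // => i _.
  by rewrite exprS (eqmM0l _ a0) ?coef0.
- by move=> i iK; rewrite coefB aK1 ?coef0 ?subr0.
- by move=> i iK; rewrite coefB aK1 ?coef0 ?subr0.
Qed.

Lemma poly_inv (K : nat) p (c : A) : p`_0 * c = 1 -> c * p`_0 = 1 ->
  exists q, eqm K (p * q) 1 /\ eqm K (q * p) 1.
Proof.
set d := p`_0 => dc cd.
have [q [_ pq qp]] : exists q : {poly A}, [/\ q`_0 = 1,
    eqm K (c%:P * p * q) 1 & eqm K (q * (c%:P * p)) 1].
  by apply: eqm_inv; rewrite coefCM cd.
have dcP : d%:P * c%:P = 1 by rewrite -polyCM dc.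
exists (q * c%:P); split; last by rewrite -mulrA.
have -> : p * (q * c%:P) = d%:P * (c%:P * p * q) * c%:P.
  have -> : d%:P * (c%:P * p * q) * c%:P = (d%:P * c%:P) * p * (q * c%:P) by ncring.
  by rewrite dcP mul1r.
by rewrite pq mulr1 dcP.
Qed.

Lemma coefM_low m m' p q : eqm m p 0 -> eqm m' q 0 ->
  (p * q)`_(m + m') = p`_m * q`_m'.
Proof.
move=> e e'; have mm' : (m < (m + m').+1)%N by rewrite ltnS leq_addr.
rewrite coefM (bigD1 (Ordinal mm')) //=.
rewrite addKn big1 ?addr0 // => j; rewrite -val_eqE /= => jm.
have [jlt|mj] := ltnP j m; first by rewrite e // coef0 mul0r.
rewrite e' ?coef0 ?mulr0 // ltn_subLR; last by rewrite -ltnS.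
by rewrite ltn_add2r ltn_neqAle eq_sym jm.
Qed.

End Truncated.

(** * Normal forms of truncated orbits *)

Section NodeIdentities.
Variable A : nzRingType.
Implicit Types e f : A.

(** Membership in the Peirce corner e A[X] f: for a system of orthogonal idempotents, [p] is
    concentrated in one block. *)
Definition peirce e f (p : {poly A}) := e%:P * p = p /\ p * f%:P = p.

Lemma peirce_mul e f g p q : peirce e f p -> peirce f g q -> peirce e g (p * q).
Proof. by case=> a _ [_ b]; split; rewrite ?mulrA ?a // -mulrA b. Qed.
Lemma peirce_add e f p q : peirce e f p -> peirce e f q -> peirce e f (p + q).
Proof. by case=> a b [c d]; split; rewrite ?mulrDr ?mulrDl ?a ?b ?c ?d. Qed.
Lemma peirce_opp e f p : peirce e f p -> peirce e f (- p).
Proof. by case=> a b; split; rewrite ?mulrN ?mulNr ?a ?b. Qed.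
Lemma peirce_orth e f g h p q : f * g = 0 -> peirce e f p -> peirce g h q -> p * q = 0.
Proof.
move=> fg [_ a] [b _].
by rewrite -a -b -mulrA (mulrA f%:P) -polyCM fg mul0r mulr0.
Qed.
Lemma peirce_poly e f n (G : nat -> A) :
  (forall i, e * G i = G i /\ G i * f = G i) -> peirce e f (\poly_(i < n) G i).
Proof.
move=> eG; split; apply/polyP=> i; rewrite ?coefCM ?coefMC coef_poly;
by case: ifP => _; rewrite ?mulr0 ?mul0r //; case: (eG i).
Qed.
Lemma peirce_C e f a : e * a = a -> a * f = a -> peirce e f a%:P.
Proof. by move=> ea af; split; rewrite -polyCM ?ea ?af. Qed.
Lemma peirce_MXn e f p n : peirce e f p -> peirce e f (p * 'X^n).
Proof.
by case=> a b; split; rewrite ?mulrA ?a // -mulrA -commr_polyXn mulrA b.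
Qed.

Variables (e1 e2 : A).
Hypothesis e12 : e1 * e2 = 0.

(** The middle factor is block upper triangular and [1 + u] is lower unipotent with inverse [1 - u];
    the four summands on the right are the blocks of the conjugate. *)
Lemma conj_node u N p q : peirce e2 e1 u -> peirce e1 e2 N -> peirce e1 e1 p -> peirce e2 e2 q ->
  (1 + u) * (p + N + q) * (1 - u) =
  (p - N * u) + N + (u * p - q * u - u * N * u) + (q + u * N).
Proof.
move=> hu hN hp hq.
have uq : u * q = 0 by apply: peirce_orth hu hq.
have pu : p * u = 0 by apply: peirce_orth hp hu.
suff -> : (1 + u) * (p + N + q) * (1 - u) =
  (p - N * u) + N + (u * p - q * u - u * N * u) + (q + u * N) + u * q
   - p * u - u * (p * u) - (u * q) * u.
  by rewrite uq pu !mulr0 mul0r !subr0 addr0.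
by ncring.
Qed.

(* The difference of two conjugates, when the second one is a truncation of the
   first: only the coefficient of degree [K.-1] can change. *)
Lemma conj_node_diff (K m : nat) u N p q du dN dp dq (h : {poly A}) :
  (m.+1 < K)%N -> (forall r, h * r = r * h) ->
  peirce e2 e1 u -> peirce e1 e2 N -> peirce e1 e1 p -> peirce e2 e2 q ->
  peirce e2 e1 du -> peirce e1 e2 dN -> peirce e1 e1 dp -> peirce e2 e2 dq ->
  eqm 1 u 0 -> eqm m.+1 N 0 -> eqm (K - m.+1) du 0 -> eqm K.-1 dN 0 ->
  eqm K.-1 dp 0 -> eqm K.-1 dq 0 ->
  eqm m p (h * e1%:P) -> eqm m q (h * e2%:P) ->
  eqm K
   ((1 + (u + du)) * ((p + dp) + (N + dN) + (q + dq)) * (1 - (u + du)))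
   ((1 + u) * (p + N + q) * (1 - u) + dp + dN + dq
    + (du * (p - h * e1%:P) - (q - h * e2%:P) * du)).
Proof.
move=> mK hC iu iN ip iq idu idN idp idq u0 N0 du0 dN0 dp0 dq0 pe qe.
rewrite !conj_node //; try exact: peirce_add.
apply/eqm_subr0.
have K0 : (0 < K)%N by apply: leq_ltn_trans mK.
have KE : (1 + K.-1 = K)%N by rewrite add1n prednK.
(* The central [h] may be subtracted from both diagonal blocks without changing the commutator with
   [du]; what is left of them starts in degree [m]. *)
have h1 : (du * (h * e1%:P)) = h * du by rewrite mulrA -hC -mulrA; case: idu => _ ->.
have h2 : (h * e2%:P) * du = h * du by rewrite -mulrA; case: idu => ->.
have z1 : eqm K (du * N) 0 by apply: (eqmM0 _ du0 N0); rewrite subnK // ltnW.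
have z1' : eqm K (N * du) 0 by apply: (eqmM0 _ N0 du0); rewrite subnKC // ltnW.
have uu0 : eqm 1 (u + du) 0.
  rewrite -[0]addr0; apply: eqm_add => //.
  by apply: eqm_le du0; rewrite subn_gt0.
have z2 : eqm K ((u + du) * dN) 0 by apply: (eqmM0 _ uu0 dN0); rewrite KE.
have z2' : eqm K (dN * (u + du)) 0 by apply: (eqmM0 _ dN0 uu0); rewrite addnC KE.
have z3 : eqm K ((u + du) * dp) 0 by apply: (eqmM0 _ uu0 dp0); rewrite KE.
have z4 : eqm K (dq * (u + du)) 0 by apply: (eqmM0 _ dq0 uu0); rewrite addnC KE.
set X := (X in eqm K X 0).
have -> : X = - (N * du) - dN * (u + du) + (u + du) * dp
   - dq * (u + du) + (du * N) + (u + du) * dN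
   - (u * (N * du) + (du * N) * (u + du) + ((u + du) * dN) * (u + du))
   + (du * (h * e1%:P) - (h * e2%:P) * du).
  rewrite /X; ncring.
rewrite h1 h2 subrr addr0 !z1' !z1 !z2 !z2' !z3 !z4.
by rewrite ?(mulr0, mul0r, addr0, subr0, oppr0).
Qed.

End NodeIdentities.

(** * Separation trees and the explicit matrix of a tuple *)

Inductive btree (J : Type) := Leaf of J | Node of nat & btree J & btree J.
Arguments Leaf {J}.
Arguments Node {J}.

Section Tree.
Variable J : finType.

Fixpoint leaves (t : btree J) : {set J} :=
  match t with Leaf j => [set j] | Node _ a b => leaves a :|: leaves b end.

(* [Node m a b] separates two families of polynomials which agree below degree
   [m], where their coefficients first differ. *)
Fixpoint wf_tree (F : fieldType) (qh : J -> {poly F}) (t : btree J) : Prop :=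
  match t with
  | Leaf _ => True
  | Node m a b =>
    [/\ wf_tree qh a, wf_tree qh b, [disjoint leaves a & leaves b] &
      exists h : {poly F},
      [/\ forall j, j \in leaves (Node m a b) -> eqm m (qh j) h,
          forall j, j \in leaves a -> (qh j)`_m = h`_m &
          forall j, j \in leaves b -> (qh j)`_m != h`_m]]
  end.

Lemma leaves_neq0 t : exists j, j \in leaves t.
Proof.
elim: t => [j|m a [j ja] b _]; first by exists j; rewrite inE.
by exists j; rewrite inE ja.
Qed.

End Tree.

Section Local.
Variables (F : fieldType) (A : algType F) (J : finType) (E : J -> A).
Variables (K : nat) (qh : J -> {poly F}).
Hypothesis K_gt0 : (0 < K)%N.
Hypothesis E_orth : forall j j', E j * E j' = if j == j' then E j else 0.
Hypothesis qh_res : forall j, (qh j)`_K.-1 = 0.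
Hypothesis qh_sep : forall j j', j != j' -> ~ eqm K.-1 (qh j) (qh j').

Implicit Types (t a b : btree J) (x y : nat -> A) (S : {set J}).

Definition scal (f : {poly F}) : {poly A} := map_poly (in_alg A) f.

Lemma scalC f r : scal f * r = r * scal f.
Proof.
apply/polyP=> i; rewrite coefM coefMr; apply: eq_bigr => j _.
by rewrite coef_map /= mulr_algl mulr_algr.
Qed.

Definition EE S : A := \sum_(j in S) E j.

Lemma EEl S j : EE S * E j = if j \in S then E j else 0.
Proof.
rewrite mulr_suml; case: ifP => jS.
  rewrite (bigD1 j) //= E_orth eqxx big1 ?addr0 // => i /andP[_ ij].
  by rewrite E_orth (negPf ij).
rewrite big1 // => i iS; rewrite E_orth; case: eqP => // ij.
by rewrite -ij iS in jS.
Qed.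
Lemma EEr S j : E j * EE S = if j \in S then E j else 0.
Proof.
rewrite mulr_sumr; case: ifP => jS.
  rewrite (bigD1 j) //= E_orth eqxx big1 ?addr0 // => i /andP[_ ij].
  by rewrite E_orth eq_sym (negPf ij).
rewrite big1 // => i iS; rewrite E_orth; case: eqP => // ij.
by rewrite ij iS in jS.
Qed.
Lemma EE_id S : EE S * EE S = EE S.
Proof. by rewrite {2 3}/EE mulr_sumr; apply: eq_bigr => j jS; rewrite EEl jS. Qed.
Lemma EE_disj S S' : [disjoint S & S'] -> EE S * EE S' = 0.
Proof.
by move=> d; rewrite {2}/EE mulr_sumr big1 // => j jS'; rewrite EEl (disjointFl d jS').
Qed.
Lemma EEU S S' : [disjoint S & S'] -> EE (S :|: S') = EE S + EE S'.
Proof. by move=> d; rewrite /EE -bigU //=; apply: eq_bigl => j; rewrite !inE. Qed.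
Lemma EE1 j : EE [set j] = E j.
Proof. by rewrite /EE big_set1. Qed.

(** The irregular type, restricted to the blocks in [S]. *)
Definition Tdiag S : {poly A} := \sum_(j in S) scal (qh j) * (E j)%:P.

(** Stored from degree 1 on, since the factor [1 + u] is 1 in degree 0. A change of [u] in degree
    [K - m.+1] or higher affects the conjugate at most in degree [K.-1], hence the bound. *)
Definition upart x m a b : {poly A} :=
  \poly_(i < K - m.+1) (if i is l.+1 then EE (leaves b) * x l * EE (leaves a) else 0).
(** The index [K.-2 - i] makes degree [i] dual to degree [K.-1 - i] of [upart] under the residue;
    both use the same range of indices of [x]. *)
Definition npart x m a b : {poly A} :=
  \poly_(i < K.-1)
    (if (m < i)%N then EE (leaves a) * x (K.-2 - i)%N * EE (leaves b) else 0).

Fixpoint Yhat x t : {poly A} :=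
  match t with
  | Leaf j => Tdiag [set j]
  | Node m a b =>
      (1 + upart x m a b) * (Yhat x a + npart x m a b + Yhat x b)
        * (1 - upart x m a b)
  end.

Local Notation corner S := (peirce (EE S) (EE S)).
Local Notation wf := (wf_tree qh).

Lemma upart_inc x m a b : peirce (EE (leaves b)) (EE (leaves a)) (upart x m a b).
Proof.
apply: peirce_poly => -[|l]; first by rewrite mulr0 mul0r.
by rewrite !mulrA EE_id -!mulrA EE_id.
Qed.
Lemma npart_inc x m a b : peirce (EE (leaves a)) (EE (leaves b)) (npart x m a b).
Proof.
apply: peirce_poly => i; case: ifP => _; rewrite ?mulr0 ?mul0r //.
by rewrite !mulrA EE_id -!mulrA EE_id.
Qed.
Lemma upart0 x m a b : eqm 1 (upart x m a b) 0.
Proof. by move=> [|//] _; rewrite coef_poly coef0 if_same. Qed.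
Lemma npart0 x m a b : eqm m.+1 (npart x m a b) 0.
Proof. by move=> i im; rewrite coef_poly coef0 (leq_gtF (im : i <= m)%N) if_same. Qed.
Arguments upart0 : clear implicits.
Arguments npart0 : clear implicits.

Lemma Tdiag_inc S : corner S (Tdiag S).
Proof.
split; rewrite ?mulr_sumr ?mulr_suml; apply: eq_bigr => j jS.
  by rewrite mulrA -scalC -mulrA -polyCM EEl jS.
by rewrite -mulrA -polyCM EEr jS.
Qed.

Lemma EE_sub S S' : S \subset S' -> EE S' * EE S = EE S /\ EE S * EE S' = EE S.
Proof.
move=> sub; split.
  by rewrite {2 3}/EE mulr_sumr; apply: eq_bigr => j /(subsetP sub) jS; rewrite EEl jS.
by rewrite {1 3}/EE mulr_suml; apply: eq_bigr => j /(subsetP sub) jS; rewrite EEr jS.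
Qed.

Lemma peirce_sub S1 S2 S p : S1 \subset S -> S2 \subset S ->
  peirce (EE S1) (EE S2) p -> corner S p.
Proof.
move=> /EE_sub[s1 _] /EE_sub[_ s2] [pl pr]; split.
  by rewrite -pl mulrA -polyCM s1.
by rewrite -pr -mulrA -polyCM s2.
Qed.

Lemma Yhat_inc x t : wf t -> corner (leaves t) (Yhat x t).
Proof.
elim: t => [j _|m a IHa b IHb /= [wa wb d _]]; first exact: Tdiag_inc.
have hu := upart_inc x m a b; have hN := npart_inc x m a b.
have ha := IHa wa; have hb := IHb wb.
have e12 := EE_disj d.
have e21 : EE (leaves b) * EE (leaves a) = 0 by apply: EE_disj; rewrite disjoint_sym.
rewrite (conj_node e12 hu hN ha hb).
have uaP := subsetUl (leaves a) (leaves b).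
have ubP := subsetUr (leaves a) (leaves b).
do ![apply: peirce_add | apply: peirce_opp]; do ?[exact: (peirce_sub uaP uaP ha)
  | exact: (peirce_sub ubP ubP hb) | exact: (peirce_sub uaP ubP hN)].
- exact: (peirce_sub uaP uaP (peirce_mul hN hu)).
- exact: (peirce_sub ubP uaP (peirce_mul hu ha)).
- exact: (peirce_sub ubP uaP (peirce_mul hb hu)).
- exact: (peirce_sub ubP uaP (peirce_mul (peirce_mul hu hN) hu)).
- exact: (peirce_sub ubP ubP (peirce_mul hu hN)).
Qed.

Lemma Tdiag_low S (h : {poly F}) m : (forall j, j \in S -> eqm m (qh j) h) ->
  eqm m (Tdiag S) (scal h * (EE S)%:P).
Proof.
move=> qE i im; rewrite coef_sum coefMC coef_map /= /EE mulr_sumr.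
by apply: eq_bigr => j jS; rewrite coefMC coef_map /= (qE j jS).
Qed.

Lemma Tdiag_coef S i : (Tdiag S)`_i = \sum_(j in S) (qh j)`_i *: E j.
Proof.
by rewrite coef_sum; apply: eq_bigr => j _; rewrite coefMC coef_map /= mulr_algl.
Qed.

Lemma TdiagU S S' : [disjoint S & S'] -> Tdiag (S :|: S') = Tdiag S + Tdiag S'.
Proof. by move=> d; rewrite /Tdiag -bigU //=; apply: eq_bigl => j; rewrite !inE. Qed.

(** Conjugation by [1 + u] is invisible modulo ['X^m.+1]: [u] has no constant term, and once the
    common scalar part [h] is subtracted, the diagonal blocks start in degree [m]. *)
Lemma Yhat_low x t (h : {poly F}) m : wf t ->
  (forall j, j \in leaves t -> eqm m (qh j) h) ->
  eqm m.+1 (Yhat x t) (Tdiag (leaves t)).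
Proof.
elim: t m h => [j|n a IHa b IHb] m h //= [wa wb d [h' [qlow qa qb]]] qE.
have mn : (m <= n)%N.
  (* A node cannot separate in a degree where all its polynomials agree with [h]. *)
  rewrite leqNgt; apply/negP => nm.
  have [ja jaP] := leaves_neq0 a; have [jb jbP] := leaves_neq0 b.
  have := qb _ jbP; rewrite -(qa _ jaP) => /eqP; apply.
  by rewrite !qE ?inE ?jaP ?jbP ?orbT.
have aE : forall j, j \in leaves a -> eqm m (qh j) h by move=> j ja; apply: qE; rewrite inE ja.
have bE : forall j, j \in leaves b -> eqm m (qh j) h by move=> j jb; apply: qE; rewrite inE jb orbT.
have hu := upart_inc x n a b; have hN := npart_inc x n a b.
have ha := Yhat_inc x wa; have hb := Yhat_inc x wb.
have e12 := EE_disj d.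
rewrite (conj_node e12 hu hN ha hb) TdiagU //.
have N0 : eqm m.+1 (npart x n a b) 0 by refine (eqm_le _ (npart0 x n a b)).
have Ya := IHa _ _ wa aE; have Yb := IHb _ _ wb bE.
have ua : eqm m.+1 (upart x n a b * (Tdiag (leaves a) - scal h * (EE (leaves a))%:P)) 0.
  by apply: (eqmM0 _ (upart0 _ _ _ _) (m' := m)) => //; apply/eqm_subr0; apply: Tdiag_low.
have ub : eqm m.+1 ((Tdiag (leaves b) - scal h * (EE (leaves b))%:P) * upart x n a b) 0.
  apply: (eqmM0 (m:=m) _ _ (upart0 _ _ _ _)); rewrite ?addn1 //.
  by apply/eqm_subr0; apply: Tdiag_low.
have h1 : upart x n a b * (scal h * (EE (leaves a))%:P) = scal h * upart x n a b.
  by rewrite mulrA -scalC -mulrA; case: hu => _ ->.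
have h2 : (scal h * (EE (leaves b))%:P) * upart x n a b = scal h * upart x n a b.
  by rewrite -mulrA; case: hu => ->.
rewrite mulrBr h1 in ua; rewrite mulrBl h2 in ub.
move/eqm_subr0: ua => ua; move/eqm_subr0: ub => ub.
rewrite N0 Ya Yb ua ub.
by rewrite mulr0 !mul0r addr0 !subr0 subrr addr0 addr0.
Qed.

(** Only the block of [x] on the leaves of [t] matters, so tuples found for two subtrees can be
    glued. *)
Lemma Yhat_ext x y t : wf t ->
  (forall l, EE (leaves t) * x l * EE (leaves t) = EE (leaves t) * y l * EE (leaves t)) ->
  Yhat x t = Yhat y t.
Proof.
elim: t => [j|m a IHa b IHb] //= [wa wb d _] xy.
have sub S S' : S \subset leaves a :|: leaves b -> S' \subset leaves a :|: leaves b ->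
    forall l, EE S * x l * EE S' = EE S * y l * EE S'.
  move=> /EE_sub[_ s] /EE_sub[s' _] l.
  set L := leaves a :|: leaves b in s s' xy *.
  have key z : EE S * z * EE S' = EE S * (EE L * z * EE L) * EE S'.
    by rewrite !mulrA s -!mulrA s'.
  by rewrite key xy -key.
have uaP := subsetUl (leaves a) (leaves b).
have ubP := subsetUr (leaves a) (leaves b).
rewrite (IHa wa (sub _ _ uaP uaP)) (IHb wb (sub _ _ ubP ubP)).
have -> : upart x m a b = upart y m a b.
  by apply/polyP => -[|i]; rewrite !coef_poly ?(sub _ _ ubP uaP).
suff -> : npart x m a b = npart y m a b by [].
by apply/polyP => i; rewrite !coef_poly (sub _ _ uaP ubP).
Qed.

(** Complete [p] by the complementary idempotent, invert, and cut the inverse down to the corner. *)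
Lemma peirce_inv S p : corner S p -> p`_0 = EE S ->
  exists q, [/\ corner S q, q`_0 = EE S,
    eqm K (p * q) (EE S)%:P & eqm K (q * p) (EE S)%:P].
Proof.
case=> pl pr p0; set e := (EE S)%:P in pl pr *.
have ee : e * e = e by rewrite -polyCM EE_id.
have [q [q0 pq qp]] : exists q : {poly A}, [/\ q`_0 = 1, eqm K ((p + (1 - e)) * q) 1
    & eqm K (q * (p + (1 - e))) 1].
  by apply: eqm_inv; rewrite coefD coefB coef1 coefC /= p0 addrCA subrr addr0.
exists (e * q * e); split.
- by split; rewrite -/e ?mulrA ?ee // -!mulrA ee.
- by rewrite coefMC coefCM q0 mulr1 EE_id.
- have -> : p * (e * q * e) = e * ((p + (1 - e)) * q) * e.
    have -> : e * ((p + (1 - e)) * q) * e = (e * p) * q * e + (e - e * e) * q * e by ncring.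
    by rewrite pl ee subrr !mul0r addr0 !mulrA pr.
  by rewrite pq mulr1 ee.
- have -> : (e * q * e) * p = e * (q * (p + (1 - e))) * e.
    have -> : e * (q * (p + (1 - e))) * e = e * q * (p * e) + e * q * (e - e * e) by ncring.
    by rewrite pr ee subrr mulr0 addr0 -mulrA pl.
  by rewrite qp mulr1 ee.
Qed.

(** The orbit of the irregular type under gauge transformations with constant coefficient 1, [EE S]
    being the unit of the corner. *)
Definition orb S (P : {poly A}) :=
  corner S P /\ exists g : {poly A}, [/\ corner S g, g`_0 = EE S & eqm K (P * g) (g * Tdiag S)].

(** Polynomials from both sides of the node agree below [m], but distinct ones must already differ
    below [K.-1]. *)
Lemma wf_node_lt m a b : wf (Node m a b) -> (m.+1 < K)%N.
Proof.
case=> _ _ d [h [qE qa qb]].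
have [ja jaP] := leaves_neq0 a; have [jb jbP] := leaves_neq0 b.
rewrite ltnNge; apply/negP => Km; apply: (qh_sep (j := ja) (j' := jb)).
  by apply/eqP => jab; move: (disjointFr d jaP); rewrite jab jbP.
have Km' : (K.-1 <= m)%N by case: K Km.
apply: (@eqm_trans _ _ _ h).
  by refine (eqm_le Km' _); apply: qE; rewrite inE jaP.
by apply: eqm_sym; refine (eqm_le Km' _); apply: qE; rewrite inE jbP orbT.
Qed.

Lemma peirce_coef (e f : A) p i : peirce e f p -> e * p`_i = p`_i /\ p`_i * f = p`_i.
Proof. by case=> pl pr; split; [rewrite -{2}pl coefCM|rewrite -{2}pr coefMC]. Qed.

Lemma Yhat_node_low x t h m : wf t -> (forall j, j \in leaves t -> eqm m (qh j) h) ->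
  eqm m (Yhat x t - scal h * (EE (leaves t))%:P) 0.
Proof.
move=> wt qE; apply/eqm_subr0; apply: eqm_trans (Tdiag_low qE).
by refine (eqm_le (leqnSn m) _); apply: Yhat_low qE.
Qed.

(** Block elimination on the gauge transformation: its lower unipotent factor makes [P] block
    triangular, the diagonal blocks are orbit points for the subtrees, and [x] is read off from the
    unipotent factor and the upper block. At each node truncation only loses off-diagonal blocks in
    degree [K.-1]. *)
Lemma orb_fwd t P : wf t -> orb (leaves t) P ->
  exists x, eqm K.-1 P (Yhat x t) /\
    forall j, j \in leaves t -> E j * (P - Yhat x t)`_K.-1 * E j = 0.
Proof.
elim: t P => [j|m a IHa b IHb] P wt [hP [g [hg g0 gP]]].
  (* A single block: its type is scalar, commutes with [g], and involves no entry of [x]. *)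
  exists (fun _ => 0) => /=; rewrite /= in hP hg g0 gP.
  have [c [hc c0 gc cg]] := peirce_inv hg g0.
  have e : eqm K P (Tdiag [set j]).
    case: (hP) => _ {1}<-; rewrite -gc mulrA gP /Tdiag big_set1 -EE1.
    by rewrite (mulrA g) -(scalC _ g) -!mulrA; case: hc => -> _; rewrite gc.
  split; first by refine (eqm_le (leq_pred K) e).
  by move=> j' _; rewrite coefB e ?subrr ?mulr0 ?mul0r // prednK.
have mK := wf_node_lt wt.
case: wt => wa wb d [h [qE qa qb]].
rewrite /= in hP hg g0 gP.
have d' : [disjoint leaves b & leaves a] by rewrite disjoint_sym.
have e12 := EE_disj d; have e21 := EE_disj d'.
rewrite EEU // in hP hg g0.
set E1 := EE (leaves a) in e12 e21 hP hg g0; set E2 := EE (leaves b) in e12 e21 hP hg g0.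
set e1 : {poly A} := E1%:P; set e2 : {poly A} := E2%:P.
have ee1 : e1 * e1 = e1 by rewrite -polyCM EE_id.
have ee2 : e2 * e2 = e2 by rewrite -polyCM EE_id.
have ee12 : e1 * e2 = 0 by rewrite -polyCM e12.
have ee21 : e2 * e1 = 0 by rewrite -polyCM e21.
have T1i : peirce E1 E1 (Tdiag (leaves a)) by apply: Tdiag_inc.
have T2i : peirce E2 E2 (Tdiag (leaves b)) by apply: Tdiag_inc.
rewrite TdiagU // in gP.
set T1 := Tdiag (leaves a) in T1i gP; set T2 := Tdiag (leaves b) in T2i gP.
have incM (p : {poly A}) (e f : A) (ee : e * e = e) (ff : f * f = f) : peirce e f (e%:P * p * f%:P).
  by split; rewrite ?mulrA -?polyCM ?ee // -!mulrA -polyCM ff.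
have ee1' : E1 * E1 = E1 by apply: EE_id.
have ee2' : E2 * E2 = E2 by apply: EE_id.
pose g11 := e1 * g * e1.
have hg11 : peirce E1 E1 g11 by apply: incM.
have [c1 [hc1 c10 gc1 cg1]] : exists q, [/\ peirce E1 E1 q, q`_0 = E1,
    eqm K (g11 * q) e1 & eqm K (q * g11) e1].
  by apply: peirce_inv => //; rewrite coefMC coefCM g0 mulrDr e12 addr0 !ee1'.
(* Block LU factorization: this choice removes the lower left block of [(1 - u) * g]. *)
pose u := (e2 * g * e1) * c1.
have hu : peirce E2 E1 u by apply: peirce_mul hc1; apply: incM.
have u0 : u`_0 = 0.
  by rewrite /u coefM big_ord1 !coefMC coefCM g0 mulrDr e21 add0r ee2' e21 mul0r.
have uu : u * u = 0 by exact: (peirce_orth e12 hu hu).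
have e1u : e1 * u = 0 by case: hu => <- _; rewrite mulrA ee12 mul0r.
have ue2 : u * e2 = 0 by case: hu => _ <-; rewrite -mulrA ee12 mulr0.
have e2u : e2 * u = u by case: hu.
have ue1 : u * e1 = u by case: hu.
pose X := (1 - u) * P * (1 + u).
pose g' := (1 - u) * g.
have XP : (1 + u) * X * (1 - u) = P.
  have -> : (1 + u) * X * (1 - u) = P - P * (u * u) - (u * u) * P + (u * u) * P * (u * u).
    by rewrite /X; ncring.
  by rewrite uu !(mulr0, mul0r) !subr0 addr0.
have Xg : eqm K (X * g') (g' * (T1 + T2)).
  have -> : X * g' = (1 - u) * (P * g) - (1 - u) * P * (u * u) * g by rewrite /X /g'; ncring.
  by rewrite uu mulr0 mul0r subr0 gP mulrA.
have Pl : (e1 + e2) * P = P by case: hP; rewrite polyCD.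
have Pr : P * (e1 + e2) = P by case: hP; rewrite polyCD.
have gl : (e1 + e2) * g = g by case: hg; rewrite polyCD.
have gr : g * (e1 + e2) = g by case: hg; rewrite polyCD.
have se_u : (e1 + e2) * u = u by rewrite mulrDl e1u e2u add0r.
have u_se : u * (e1 + e2) = u by rewrite mulrDr ue1 ue2 addr0.
have Xl : (e1 + e2) * X = X.
  have -> : (e1 + e2) * X = ((e1 + e2) * P - ((e1 + e2) * u) * P) * (1 + u) by rewrite /X; ncring.
  by rewrite Pl se_u /X; ncring.
have Xr : X * (e1 + e2) = X.
  have -> : X * (e1 + e2) = (1 - u) * (P * (e1 + e2) + P * (u * (e1 + e2))) by rewrite /X; ncring.
  by rewrite Pr u_se /X; ncring.
have g'l : (e1 + e2) * g' = g'.
  have -> : (e1 + e2) * g' = (e1 + e2) * g - ((e1 + e2) * u) * g by rewrite /g'; ncring.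
  by rewrite gl se_u /g'; ncring.
have g'11 : e1 * g' * e1 = g11.
  have -> : e1 * g' * e1 = g11 - (e1 * u) * g * e1 by rewrite /g' /g11; ncring.
  by rewrite e1u !mul0r subr0.
have g'21 : eqm K (e2 * g' * e1) 0.
  have -> : e2 * g' * e1 = e2 * g * e1 - (e2 * u) * g * e1 by rewrite /g'; ncring.
  have -> : e2 * u * g * e1 = (e2 * g * e1) * (c1 * g11).
    rewrite e2u /u /g11; case: hc1 => _ {1}<-; rewrite -/e1; ncring.
  rewrite cg1; have -> : e2 * g * e1 - e2 * g * e1 * e1 = e2 * g * (e1 - e1 * e1) by ncring.
  by rewrite ee1 subrr mulr0.
pose g12 := e1 * g' * e2; pose g22 := e2 * g' * e2.
have hg12 : peirce E1 E2 g12 by apply: incM.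
have hg22 : peirce E2 E2 g22 by apply: incM.
have g'e1 : eqm K (g' * e1) g11.
  have -> : g' * e1 = e1 * g' * e1 + e2 * g' * e1 by rewrite -{1}g'l; ncring.
  by rewrite g'11 g'21 addr0.
have g'e2 : g' * e2 = g12 + g22 by rewrite -{1}g'l /g12 /g22; ncring.
have Te1 : (T1 + T2) * e1 = T1.
  by rewrite mulrDl; case: T1i => _ ->; case: T2i => _ <-; rewrite -mulrA ee21 mulr0 addr0.
have Te2 : (T1 + T2) * e2 = T2.
  by rewrite mulrDl; case: T2i => _ ->; case: T1i => _ <-; rewrite -mulrA ee12 mulr0 add0r.
have T1l : e1 * T1 = T1 by case: T1i.
have T2l : e2 * T2 = T2 by case: T2i.
have col1 : eqm K (X * g11) (g11 * T1).
  rewrite -{1}g'e1 mulrA Xg -mulrA Te1.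
  by rewrite -[in X in eqm _ X _]T1l mulrA g'e1.
have col2 : eqm K (X * (g12 + g22)) ((g12 + g22) * T2).
  rewrite -g'e2 mulrA Xg -mulrA Te2.
  by rewrite -[in X in eqm _ X _]T2l mulrA.
pose X11 := e1 * X * e1; pose X12 := e1 * X * e2; pose X21 := e2 * X * e1; pose X22 := e2 * X * e2.
have XE : X = X11 + X12 + X21 + X22.
  by rewrite -{1}Xl -{1}Xr /X11 /X12 /X21 /X22; ncring.
have g11l : e1 * g11 = g11 by case: hg11.
have e2g11 : e2 * g11 = 0 by rewrite /g11 !mulrA ee21 !mul0r.
(* The first block column of [g'] is [g11], invertible in its corner, and [col1] says that [X] maps
   it into the first block. *)
have X21_0 : eqm K X21 0.
  have <- : X21 * e1 = X21 by case: (incM X _ _ ee2' ee1').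
  rewrite -gc1 mulrA.
  have -> : X21 * g11 = e2 * (X * g11) by rewrite /X21 -{2}g11l; ncring.
  by rewrite col1 mulrA e2g11 !mul0r.
have o1 : orb (leaves a) X11.
  split; first exact: incM.
  exists g11; split=> //.
    by rewrite coefMC coefCM g0 mulrDr e12 addr0 !ee1'.
  have -> : X11 * g11 = e1 * (X * g11) by rewrite /X11 -{2}g11l; ncring.
  by rewrite col1 mulrA g11l.
have X2g : eqm K (X22 * g22) (g22 * T2).
  have z1 : e2 * g12 = 0 by rewrite /g12 !mulrA ee21 !mul0r.
  have z2 : e2 * g22 = g22 by case: hg22.
  have z3 : e1 * g22 = 0 by rewrite /g22 !mulrA ee12 !mul0r.
  have : eqm K (e2 * (X * (g12 + g22))) (e2 * ((g12 + g22) * T2)) by rewrite col2.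
  rewrite [e2 * ((g12 + g22) * T2)]mulrA [e2 * (g12 + g22)]mulrDr z1 z2 add0r => {1}<-.
  have -> : e2 * (X * (g12 + g22)) = X21 * g12 + X22 * g22.
    rewrite -{1}Xr /X21 /X22.
    have -> : e2 * (X * (e1 + e2) * (g12 + g22)) = e2 * X * e1 * g12 + e2 * X * e2 * g22
      + e2 * X * (e2 * g12) + e2 * X * (e1 * g22) by ncring.
    by rewrite z1 z3 !mulr0 !addr0.
  by rewrite X21_0 mul0r add0r.
have g220 : g22`_0 = E2.
  rewrite coefMC coefCM coefM big_ord1 coefB coef1 u0 subr0 mul1r g0.
  by rewrite mulrDr e21 add0r !ee2'.
have X1g : eqm K (X12 * g22) (g12 * T2 - X11 * g12).
  have z1 : e2 * g12 = 0 by rewrite /g12 !mulrA ee21 !mul0r.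
  have z2 : e1 * g12 = g12 by case: hg12.
  have z3 : e1 * g22 = 0 by rewrite /g22 !mulrA ee12 !mul0r.
  have : eqm K (e1 * (X * (g12 + g22))) (e1 * ((g12 + g22) * T2)) by rewrite col2.
  rewrite [e1 * ((g12 + g22) * T2)]mulrA [e1 * (g12 + g22)]mulrDr z3 z2 addr0 => <-.
  have -> : e1 * (X * (g12 + g22)) = X11 * g12 + X12 * g22.
    rewrite -{1}Xr /X11 /X12.
    have -> : e1 * (X * (e1 + e2) * (g12 + g22)) = e1 * X * e1 * g12 + e1 * X * e2 * g22
      + e1 * X * (e2 * g12) + e1 * X * (e1 * g22) by ncring.
    by rewrite z1 z3 !mulr0 !addr0.
  by rewrite addrC addrA addNr add0r.
have o2 : orb (leaves b) X22.
  by split; [exact: incM|exists g22; split].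
have [x1 [x1P x1E]] := IHa _ wa o1.
have [x2 [x2P x2E]] := IHb _ wb o2.
have aE : forall j, j \in leaves a -> eqm m (qh j) h by move=> j ja; apply: qE; rewrite inE ja.
have bE : forall j, j \in leaves b -> eqm m (qh j) h by move=> j jb; apply: qE; rewrite inE jb orbT.
have mK1 : (m < K.-1)%N by case: K mK.
have X11low : eqm m (X11 - scal h * e1) 0.
  apply/eqm_subr0; apply: (@eqm_trans _ _ _ (Yhat x1 a)).
    by refine (eqm_le (ltnW mK1) x1P).
  by apply/eqm_subr0; apply: Yhat_node_low.
have [c2 [hc2 c20 gc2 cg2]] := peirce_inv hg22 g220.
have {}gc2 : eqm K (g22 * c2) e2 by exact: gc2.
(* Up to the invertible [g22], [X12] is a commutator of [g12], which has no constant term, with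
   diagonal blocks that agree with [h] below degree [m]. *)
have X12low : eqm m.+1 X12 0.
  have mK' := ltnW mK.
  have <- : X12 * e2 = X12 by case: (incM X _ _ ee1' ee2').
  have g12_0 : eqm 1 g12 0.
    move=> [|//] _; rewrite coefMC coefCM coefM big_ord1 coefB coef1 u0 subr0 mul1r g0.
    by rewrite mulrDr e12 ee1' addr0 e12 coef0.
  have T2low : eqm m (T2 - scal h * e2) 0 by apply/eqm_subr0; apply: Tdiag_low.
  apply: (@eqm_trans _ _ _ ((g12 * T2 - X11 * g12) * c2)).
    refine (eqm_le mK' _); rewrite -gc2 mulrA X1g; exact: eqm_refl.
  apply: eqmM0l.
  have -> : g12 * T2 - X11 * g12 = g12 * (T2 - scal h * e2) - (X11 - scal h * e1) * g12.
    have -> : g12 * (T2 - scal h * e2) - (X11 - scal h * e1) * g12 =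
       g12 * T2 - X11 * g12 + (scal h * (e1 * g12) - g12 * scal h * e2) by ncring.
    by rewrite -scalC -mulrA; case: hg12 => -> ->; rewrite subrr addr0.
  have z1 : eqm m.+1 (g12 * (T2 - scal h * e2)) 0 by apply: (eqmM0 _ g12_0 T2low).
  have z2 : eqm m.+1 ((X11 - scal h * e1) * g12) 0.
    by apply: (eqmM0 _ X11low g12_0); rewrite addn1.
  by rewrite z1 z2 subr0.
have hX12 : peirce E1 E2 X12 by apply: incM.
(* Diagonal blocks come from the subtrees, the off-diagonal ones from the degrees in which [upart]
   and [npart] store them. *)
pose x l := E1 * x1 l * E1 + E2 * x2 l * E2 + u`_l.+1 + X12`_(K.-2 - l).
have uc i := peirce_coef i hu; have Nc i := peirce_coef i hX12.
have xE e f : forall l, e * x l * f = e * E1 * x1 l * (E1 * f) + e * E2 * x2 l * (E2 * f)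
     + (e * E2) * u`_l.+1 * (E1 * f) + (e * E1) * X12`_(K.-2 - l) * (E2 * f).
  move=> l; rewrite /x; set v := X12`_(K.-2 - l); set w := u`_l.+1.
  have -> : e * E1 * x1 l * (E1 * f) + e * E2 * x2 l * (E2 * f) + e * E2 * w * (E1 * f)
      + e * E1 * v * (E2 * f)
    = e * (E1 * x1 l * E1 + E2 * x2 l * E2 + E2 * w * E1 + E1 * v * E2) * f by ncring.
  have -> : E2 * w * E1 = w by rewrite /w (proj1 (uc _)) (proj2 (uc _)).
  by have -> : E1 * v * E2 = v by rewrite /v (proj1 (Nc _)) (proj2 (Nc _)).
have x11 : Yhat x a = Yhat x1 a.
  by apply: Yhat_ext => // l; rewrite -/E1 xE ee1' e12 e21 !(mulr0, mul0r) !addr0.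
have x22 : Yhat x b = Yhat x2 b.
  by apply: Yhat_ext => // l; rewrite -/E2 xE ee2' e12 e21 !(mulr0, mul0r) !addr0 add0r.
have x21 l : E2 * x l * E1 = u`_l.+1.
  rewrite xE ee1' ee2' ?e12 ?e21 !(mulr0, mul0r) !addr0 !add0r.
  by rewrite (proj1 (uc _)) (proj2 (uc _)).
have x12 l : E1 * x l * E2 = X12`_(K.-2 - l).
  rewrite xE ee1' ee2' ?e12 ?e21 !(mulr0, mul0r) !addr0 !add0r.
  by rewrite (proj1 (Nc _)) (proj2 (Nc _)).
exists x.
have hU := upart_inc x m a b; have hN := npart_inc x m a b.
have ha := Yhat_inc x wa; have hb := Yhat_inc x wb.
pose du := u - upart x m a b; pose dN := X12 - npart x m a b.
pose dp := X11 - Yhat x a; pose dq := X22 - Yhat x b.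
have hdu : peirce E2 E1 du by apply: peirce_add => //; apply: peirce_opp.
have hdN : peirce E1 E2 dN by apply: peirce_add => //; apply: peirce_opp.
have hdp : peirce E1 E1 dp by apply: peirce_add; [apply: incM|apply: peirce_opp].
have hdq : peirce E2 E2 dq by apply: peirce_add; [apply: incM|apply: peirce_opp].
have du0 : eqm (K - m.+1) du 0.
  by apply/eqm_subr0 => -[|i] im; rewrite coef_poly im ?u0 // x21.
have dN0 : eqm K.-1 dN 0.
  apply/eqm_subr0 => i im; rewrite coef_poly im; case: ltnP => mi.
    rewrite x12; congr (_`_ _).
    by rewrite subKn //; move: im; clear; case: K => [|[|k]].
  by rewrite X12low ?coef0.
have dp0 : eqm K.-1 dp 0 by apply/eqm_subr0; rewrite x11.
have dq0 : eqm K.-1 dq 0 by apply/eqm_subr0; rewrite x22.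
have lowa : eqm m (Yhat x a - scal h * e1) 0 by apply: Yhat_node_low.
have lowb : eqm m (Yhat x b - scal h * e2) 0 by apply: Yhat_node_low.
have lowa' := proj1 (eqm_subr0 _ _ _) lowa; have lowb' := proj1 (eqm_subr0 _ _ _) lowb.
have := conj_node_diff e12 mK (scalC h) hU hN ha hb hdu hdN hdp hdq
   (upart0 x m a b) (npart0 x m a b) du0 dN0 dp0 dq0 lowa' lowb'.
rewrite /du /dN /dp /dq ![_ + (_ - _)]addrC !subrK -/du -/dN -/dp -/dq => PE.
have {}PE : eqm K P (Yhat x (Node m a b) + dp + dN + dq +
     (du * (Yhat x a - scal h * e1) - (Yhat x b - scal h * e2) * du)).
  have XPE : eqm K P ((1 + u) * (X11 + X12 + X22) * (1 - u)).
    have -> : P = (1 + u) * X * (1 - u) by rewrite XP.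
    rewrite [in X in eqm _ X _]XE X21_0 addr0; exact: eqm_refl.
  refine (eqm_trans XPE (eqm_trans PE _)) => i _; congr (_`_ i).
  have -> : Yhat x (Node m a b) = (1 + upart x m a b) * (Yhat x a + npart x m a b + Yhat x b)
    * (1 - upart x m a b) by [].
  by rewrite -/e1 -/e2; set Z := _ - _ * du; rewrite (addrC Z) (addrC dq) (addrC dN) (addrC dp).
(* The effect of truncating [u]: it lies in the lower left block and starts in degree [K.-1], so no
   diagonal block sees it. *)
set last := (_ - _ * du) in PE.
have hlast : peirce E2 E1 last.
  apply: peirce_add; [|apply: peirce_opp].
    apply: peirce_mul hdu _; apply: peirce_add => //; apply: peirce_opp.
    by split; rewrite -/e1 ?mulrA -?scalC -?mulrA ee1.
  apply: peirce_mul hdu; apply: peirce_add => //; apply: peirce_opp.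
  by split; rewrite -/e2 ?mulrA -?scalC -?mulrA ee2.
have last0 : eqm K.-1 last 0.
  have z1 : eqm K.-1 (du * (Yhat x a - scal h * e1)) 0.
    by apply: (eqmM0 _ du0 lowa); move: mK mK1; clear; case: K => // k; rewrite subSS /= => *; rewrite subnK // ltnW.
  have z2 : eqm K.-1 ((Yhat x b - scal h * e2) * du) 0.
    by apply: (eqmM0 _ lowb du0); move: mK mK1; clear; case: K => // k; rewrite subSS /= => *; rewrite subnKC // ltnW.
  by rewrite /last z1 z2 subr0.
split.
  apply: eqm_trans (eqm_le (leq_pred K) PE) _.
  by rewrite dp0 dN0 dq0 last0 !addr0.
have KK : (K.-1 < K)%N by rewrite prednK.
move=> j jab; rewrite coefB PE //.
have cD (p1 p2 p3 p4 p5 : {poly A}) i :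
  (p1 + p2 + p3 + p4 + p5)`_i = p1`_i + p2`_i + p3`_i + p4`_i + p5`_i by rewrite !coefD.
rewrite cD; set y := (Yhat x (Node m a b))`_K.-1.
set c1' := dp`_K.-1; set c2' := dN`_K.-1; set c3' := dq`_K.-1; set c4' := last`_K.-1.
have -> : E j * (y + c1' + c2' + c3' + c4' - y) * E j =
    E j * c1' * E j + E j * c2' * E j + E j * c3' * E j + E j * c4' * E j by ncring.
have sand e f q i : peirce e f q -> E j * e = 0 \/ f * E j = 0 -> E j * q`_i * E j = 0.
  move=> /(peirce_coef i)[ql qr] [z|z]; first by rewrite -ql mulrA z !mul0r.
  by rewrite -qr -!mulrA z !mulr0.
have jE1 : j \in leaves a \/ (E j * E1 = 0 /\ E1 * E j = 0).
  by case: (boolP (j \in leaves a)) => ja; [left|right; rewrite EEl EEr (negPf ja)].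
have jE2 : j \in leaves b \/ (E j * E2 = 0 /\ E2 * E j = 0).
  by case: (boolP (j \in leaves b)) => jb; [left|right; rewrite EEl EEr (negPf jb)].
have -> : E j * c1' * E j = 0.
  case: jE1 => [ja|[z _]]; last by apply: (sand _ _ _ _ hdp); left.
  by rewrite /c1' /dp x11 x1E.
have -> : E j * c3' * E j = 0.
  case: jE2 => [jb|[z _]]; last by apply: (sand _ _ _ _ hdq); left.
  by rewrite /c3' /dq x22 x2E.
have not2 : (E j * E1 = 0 /\ E1 * E j = 0) \/ (E j * E2 = 0 /\ E2 * E j = 0).
  by case: jE1; [case: jE2; [move=> jb ja; rewrite (disjointFr d ja) in jb|right]|left].
have -> : E j * c2' * E j = 0.
  by apply: (sand _ _ _ _ hdN); case: not2 => -[z z']; [left|right].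
have -> : E j * c4' * E j = 0.
  by apply: (sand _ _ _ _ hlast); case: not2 => -[z z']; [right|left].
by rewrite !addr0.
Qed.

Lemma eqm_sum (R : nzRingType) m (I : finType) (Q : pred I) (G H : I -> {poly R}) :
  (forall i, Q i -> eqm m (G i) (H i)) ->
  eqm m (\sum_(i | Q i) G i) (\sum_(i | Q i) H i).
Proof. by move=> GH i im; rewrite !coef_sum; apply: eq_bigr => j /GH ->. Qed.

Lemma eqm_scal m f g : eqm m f g -> eqm m (scal f) (scal g).
Proof. by move=> fg i im; rewrite !coef_map /= fg. Qed.

Lemma eqm_drop (R : nzRingType) m (p : {poly R}) :
  eqm m p 0 -> p = drop_poly m p * 'X^m.
Proof.
move=> p0; rewrite -[LHS](poly_take_drop m).
suff -> : take_poly m p = 0 by rewrite add0r.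
by apply/polyP => i; rewrite coef_take_poly coef0; case: ifP => // /p0; rewrite coef0.
Qed.

Lemma TdiagEr S j : j \in S -> (E j)%:P * Tdiag S = scal (qh j) * (E j)%:P.
Proof.
move=> jS; rewrite mulr_sumr (bigD1 j) //= big1 ?addr0 => [|i /andP[_ ij]].
  by rewrite mulrA -scalC -mulrA -polyCM E_orth eqxx.
by rewrite mulrA -scalC -mulrA -polyCM E_orth eq_sym (negPf ij) polyC0 mulr0.
Qed.

Lemma TdiagEl S j : j \in S -> Tdiag S * (E j)%:P = scal (qh j) * (E j)%:P.
Proof.
move=> jS; rewrite mulr_suml (bigD1 j) //= big1 ?addr0 => [|i /andP[_ ij]].
  by rewrite -mulrA -polyCM E_orth eqxx.
by rewrite -mulrA -polyCM E_orth (negPf ij) polyC0 mulr0.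
Qed.

(** On the block (j, j') the operator is multiplication by [qh j' - qh j], whose order is exactly
    [m]. Since [M] starts in degree [m.+1], the quotient exists and has no constant term. *)
Lemma sylvester S1 S2 h m M :
  (forall j, j \in S1 -> eqm m (qh j) h) -> (forall j, j \in S2 -> eqm m (qh j) h) ->
  (forall j, j \in S1 -> (qh j)`_m = h`_m) -> (forall j, j \in S2 -> (qh j)`_m != h`_m) ->
  peirce (EE S1) (EE S2) M -> eqm m.+1 M 0 ->
  exists v, [/\ peirce (EE S1) (EE S2) v, v`_0 = 0 &
    eqm K (v * Tdiag S2 - Tdiag S1 * v) M].
Proof.
move=> q1E q2E q1m q2m [Ml Mr] M0.
(* [f] stands for ['X^m] divided by [qh jj.2 - qh jj.1]; outside [S1] and [S2] the value 0 is a
   dummy. *)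
have exf (jj : J * J) : exists f : {poly F}, jj.1 \in S1 -> jj.2 \in S2 ->
    eqm K (f * (qh jj.2 - qh jj.1)) 'X^m.
  case: jj => j j' /=.
  have [jS|] := boolP (j \in S1); last by exists 0.
  have [jS'|] := boolP (j' \in S2); last by exists 0.
  pose g := qh j' - qh j.
  have g0 : eqm m g 0 by apply/eqm_subr0 => i im; rewrite (q2E _ jS') // (q1E _ jS).
  have gm : g`_m != 0 by rewrite /g coefB subr_eq0 (q1m _ jS) q2m.
  have [q [_ _ qP]] : exists q : {poly F}, [/\ q`_0 = 1,
      eqm K ((g`_m)^-1 *: drop_poly m g * q) 1 & eqm K (q * ((g`_m)^-1 *: drop_poly m g)) 1].
    by apply: eqm_inv; rewrite coefZ coef_drop_poly mulVf.
  exists ((g`_m)^-1 *: q) => _ _.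
  have -> : ((g`_m)^-1 *: q) * (qh j' - qh j) = (q * ((g`_m)^-1 *: drop_poly m g)) * 'X^m.
    by rewrite -/g; set c := _^-1; rewrite {1}(eqm_drop g0) mulrA -scalerAl -scalerAr.
  rewrite qP mul1r; exact: eqm_refl.
have [f fP] := fin_all_exists exf.
pose M' := drop_poly m M.
have MM' : M = M' * 'X^m by apply: eqm_drop; refine (eqm_le (leqnSn m) M0).
have M'0 : M'`_0 = 0 by rewrite coef_drop_poly M0 ?coef0.
pose B j j' := (E j)%:P * M' * (E j')%:P.
have B0 j j' : (B j j')`_0 = 0 by rewrite coefMC coefCM M'0 mulr0 mul0r.
pose v := \sum_(j in S1) \sum_(j' in S2) scal (f (j, j')) * B j j'.
have vl j (jS : j \in S1) : (EE S1)%:P * (E j)%:P = (E j)%:P by rewrite -polyCM EEl jS.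
have vr j (jS : j \in S2) : (E j)%:P * (EE S2)%:P = (E j)%:P by rewrite -polyCM EEr jS.
exists v; split.
- split; rewrite ?mulr_sumr ?mulr_suml; apply: eq_bigr => j jS;
    rewrite ?mulr_sumr ?mulr_suml; apply: eq_bigr => j' jS'.
    by rewrite mulrA -scalC -mulrA; congr (_ * _); rewrite /B !mulrA vl.
  by rewrite -mulrA; congr (_ * _); rewrite /B -(mulrA ((E j)%:P * M')) vr.
- rewrite coef_sum big1 // => j jS; rewrite coef_sum big1 // => j' jS'.
  by rewrite coefM big_ord1 B0 mulr0.
have -> : v * Tdiag S2 - Tdiag S1 * v =
    \sum_(j in S1) \sum_(j' in S2) scal (f (j, j') * (qh j' - qh j)) * B j j'.
  rewrite [v * _]mulr_suml [_ * v]mulr_sumr -sumrB; apply: eq_bigr => j jS.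
  rewrite [X in X - _]mulr_suml [X in _ - X]mulr_sumr -sumrB; apply: eq_bigr => j' jS'.
  have -> : scal (f (j, j')) * B j j' * Tdiag S2 = scal (f (j, j')) * scal (qh j') * B j j'.
    rewrite -!mulrA; congr (_ * _); rewrite /B -mulrA TdiagEr //.
    by rewrite !mulrA -[_ * scal _]scalC !mulrA.
  have -> : Tdiag S1 * (scal (f (j, j')) * B j j') = scal (f (j, j')) * scal (qh j) * B j j'.
    rewrite mulrA -scalC -!mulrA; congr (_ * _).
    by rewrite /B -!mulrA mulrA TdiagEl // !mulrA.
  by rewrite /scal rmorphM rmorphB /= -mulrBl -mulrBr.
have Xc (p : {poly A}) : 'X^m * p = p * 'X^m by rewrite commr_polyXn.
have -> : M = \sum_(j in S1) \sum_(j' in S2) scal 'X^m * B j j'.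
  rewrite {1}MM' -Xc.
  have -> : M' = (EE S1)%:P * M' * (EE S2)%:P.
    apply/polyP => i; rewrite coefMC coefCM.
    by rewrite !coef_drop_poly -{1}Mr coefMC -{1}Ml coefCM.
  rewrite /EE !raddf_sum /= !mulr_suml mulr_sumr; apply: eq_bigr => j jS.
  rewrite mulr_sumr mulr_sumr; apply: eq_bigr => j' jS'.
  by rewrite /scal map_polyXn.
apply: eqm_sum => j jS; apply: eqm_sum => j' jS'.
by rewrite (eqm_scal (fP (j, j') jS jS')).
Qed.

(** The discrepancy [C] in degree [K.-1] is distributed over the node: the diagonal and upper parts
    are added to the blocks, the lower part is produced by one more coefficient of [u]. The diagonal
    blocks then lie in the orbits of the subtrees, and [sylvester] removes the upper block. *)
Lemma orb_bwd t P x : wf t -> corner (leaves t) P -> eqm K.-1 P (Yhat x t) ->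
  (forall j, j \in leaves t -> E j * (P - Yhat x t)`_K.-1 * E j = 0) ->
  orb (leaves t) P.
Proof.
have KK : K.-1.+1 = K by rewrite prednK.
elim: t P => [j|m a IHa b IHb] P wt hP PY PE.
  split=> //; exists (E j)%:P; rewrite /= in hP PY PE *; split.
  - by apply: peirce_C; rewrite EE1 E_orth eqxx.
  - by rewrite coefC /= EE1.
  - have -> : P * (E j)%:P = P by case: hP; rewrite EE1.
    have [Tl Tr] := Tdiag_inc [set j]; have {}Tl : (E j)%:P * Tdiag [set j] = Tdiag [set j].
      by rewrite -{1}EE1.
    rewrite Tl => i; rewrite -KK ltnS leq_eqVlt => /orP[/eqP ->|/PY //].
    have := PE j; rewrite inE eqxx => /(_ isT).
    have [D1 D2] : peirce (E j) (E j) (P - Tdiag [set j]).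
      rewrite -EE1; apply: peirce_add => //; apply: peirce_opp; exact: Tdiag_inc.
    have [a1 a2] := peirce_coef K.-1 (conj D1 D2); rewrite a1 a2 coefB => /eqP.
    by rewrite subr_eq0 => /eqP.
have mK := wf_node_lt wt.
case: (wt) => wa wb d [h [qE qa qb]].
have d' : [disjoint leaves b & leaves a] by rewrite disjoint_sym.
have e12 := EE_disj d; have e21 := EE_disj d'.
have ee1 := EE_id (leaves a); have ee2 := EE_id (leaves b).
have sum12 := EEU d.
set E1 := EE (leaves a) in e12 e21 ee1 sum12.
set E2 := EE (leaves b) in e12 e21 ee2 sum12.
have hY := Yhat_inc x wt.
have hU := upart_inc x m a b; have hN := npart_inc x m a b.
have ha := Yhat_inc x wa; have hb := Yhat_inc x wb.
have aE : forall j, j \in leaves a -> eqm m (qh j) h by move=> j ja; apply: qE; rewrite inE ja.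
have bE : forall j, j \in leaves b -> eqm m (qh j) h by move=> j jb; apply: qE; rewrite inE jb orbT.
set Y := Yhat x (Node m a b) in hY PY PE.
pose C := (P - Y)`_K.-1.
have hC : (E1 + E2) * C = C /\ C * (E1 + E2) = C.
  rewrite -sum12; apply: peirce_coef; apply: peirce_add => //; exact: peirce_opp.
(* The coefficient of degree [m] of the right diagonal block minus [h]; [V] inverts it because the
   node separates in degree [m]. *)
pose D := \sum_(j in leaves b) ((qh j)`_m - h`_m) *: E j.
pose V := \sum_(j in leaves b) ((qh j)`_m - h`_m)^-1 *: E j.
have DV : D * V = E2.
  rewrite mulr_suml; apply: eq_bigr => j jb.
  rewrite mulr_sumr (bigD1 j) //= big1 ?addr0 => [|i /andP[_ ij]].
    by rewrite -scalerAl -scalerAr E_orth eqxx scalerA mulfV ?scale1r // subr_eq0 qb.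
  by rewrite -scalerAl -scalerAr E_orth eq_sym (negPf ij) !scaler0.
have E2V : E2 * V = V.
  by rewrite mulr_sumr; apply: eq_bigr => j jb; rewrite -scalerAr EEl jb.
(* Chosen so that [- D * w = E2 * C * E1]: in degree [K.-1] the correction [du] contributes
   [- D * w] only, the left block minus [h] having no coefficient of degree [m]. *)
pose w := - (V * C * E1).
pose du := w%:P * 'X^(K - m.+1).
pose dp := (E1 * C * E1)%:P * 'X^(K.-1).
pose dN := (E1 * C * E2)%:P * 'X^(K.-1).
pose dq := (E2 * C * E2)%:P * 'X^(K.-1).
have sa (f e c : A) : f * f = f -> e * e = e -> peirce f e (f * c * e)%:P.
  by move=> ff ee; apply: peirce_C; rewrite ?mulrA ?ff // -!mulrA ee.
have hdu : peirce E2 E1 du.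
  apply: peirce_MXn; apply: peirce_C; rewrite /w ?mulrN ?mulNr ?mulrA ?E2V //.
  by rewrite -!mulrA ee1.
have hdp : peirce E1 E1 dp by apply: peirce_MXn; apply: sa.
have hdN : peirce E1 E2 dN by apply: peirce_MXn; apply: sa.
have hdq : peirce E2 E2 dq by apply: peirce_MXn; apply: sa.
have X0 (c : A) k : eqm k (c%:P * 'X^k) 0 by apply: eqmM0r; apply: eqmXn.
have lowa : eqm m (Yhat x a - scal h * E1%:P) 0 by apply: Yhat_node_low.
have lowb : eqm m (Yhat x b - scal h * E2%:P) 0 by apply: Yhat_node_low.
have lowa' := proj1 (eqm_subr0 _ _ _) lowa; have lowb' := proj1 (eqm_subr0 _ _ _) lowb.
have coa : (Yhat x a - scal h * E1%:P)`_m = 0.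
  rewrite coefB (Yhat_low x wa aE (ltnSn m)) Tdiag_coef coefMC coef_map /= mulr_algl scaler_sumr.
  by apply/eqP; rewrite subr_eq0; apply/eqP; apply: eq_bigr => j ja; rewrite qa.
have cob : (Yhat x b - scal h * E2%:P)`_m = D.
  rewrite coefB (Yhat_low x wb bE (ltnSn m)) Tdiag_coef coefMC coef_map /= mulr_algl scaler_sumr.
  by rewrite -sumrB; apply: eq_bigr => j jb; rewrite scalerBl.
have PE2 := conj_node_diff e12 mK (scalC h) hU hN ha hb hdu hdN hdp hdq
   (upart0 x m a b) (npart0 x m a b) (X0 _ _) (X0 _ _) (X0 _ _) (X0 _ _) lowa' lowb'.
have PY2 : eqm K P (Y + C%:P * 'X^(K.-1)).
  move=> i; rewrite -KK ltnS leq_eqVlt => /orP[/eqP ->|ik].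
    by rewrite coefD coefCM coefXn eqxx mulr1 /C coefB addrC subrK.
  by rewrite coefD coefCM coefXn ltn_eqF // mulr0 addr0 PY.
have lastE : eqm K (du * (Yhat x a - scal h * E1%:P) - (Yhat x b - scal h * E2%:P) * du)
   ((E2 * C * E1)%:P * 'X^(K.-1)).
  have sub1 : (K - m.+1 + m)%N = K.-1 by move: mK; clear; case: K => // k mk; rewrite subSS subnK // ltnW.
  move=> i; rewrite -KK ltnS leq_eqVlt => /orP[/eqP ->|ik].
    rewrite coefB -{1}sub1 (coefM_low (X0 _ _) lowa) coa mulr0 -[X in _ - _`_X]sub1 addnC.
    rewrite (coefM_low lowb (X0 _ _)) cob /du coefCM coefXn eqxx mulr1 sub0r.
    by rewrite /w mulrN opprK !mulrA DV coefCM coefXn eqxx mulr1.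
  rewrite coefCM coefXn ltn_eqF // mulr0 coefB.
  rewrite (eqmM0 (M := K.-1) _ (X0 _ _) lowa) ?sub1 //.
  by rewrite (eqmM0 (M := K.-1) _ lowb (X0 _ _)) 1?addnC ?sub1 // coef0 subr0.
set u := upart x m a b + du in PE2.
set p := Yhat x a + dp in PE2.
set N := npart x m a b + dN in PE2.
set q := Yhat x b + dq in PE2.
have {}PE2 : eqm K P ((1 + u) * (p + N + q) * (1 - u)).
  refine (eqm_trans PY2 (eqm_sym (eqm_trans PE2 _))); rewrite lastE => i _; congr (_`_i).
  have -> : (1 + upart x m a b) * (Yhat x a + npart x m a b + Yhat x b)
    * (1 - upart x m a b) = Y by [].
  rewrite /dp /dN /dq -!addrA -!mulrDl -!polyCD; congr (_ + _%:P * _).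
  have -> : E1 * C * E1 + (E1 * C * E2 + (E2 * C * E2 + E2 * C * E1)) =
    (E1 + E2) * C * (E1 + E2) by ncring.
  by rewrite (proj1 hC) (proj2 hC).
have hu : peirce E2 E1 u by apply: peirce_add.
have hp : peirce E1 E1 p by apply: peirce_add.
have hNN : peirce E1 E2 N by apply: peirce_add.
have hq : peirce E2 E2 q by apply: peirce_add.
have pE j : j \in leaves a -> E j * (p - Yhat x a)`_K.-1 * E j = 0.
  move=> ja; rewrite /p [_ + dp]addrC addrK coefCM coefXn eqxx mulr1 !mulrA EEr ja.
  by rewrite -mulrA EEl ja PE // inE ja.
have qE' j : j \in leaves b -> E j * (q - Yhat x b)`_K.-1 * E j = 0.
  move=> jb; rewrite /q [_ + dq]addrC addrK coefCM coefXn eqxx mulr1 !mulrA EEr jb.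
  by rewrite -mulrA EEl jb PE // inE jb orbT.
have dp0 : eqm K.-1 p (Yhat x a) by rewrite /p /dp (X0 _ K.-1) addr0.
have dq0 : eqm K.-1 q (Yhat x b) by rewrite /q /dq (X0 _ K.-1) addr0.
have [_ [g1 [hg1 g10 pg1]]] := IHa p wa hp dp0 pE.
have [_ [g2 [hg2 g20 qg2]]] := IHb q wb hq dq0 qE'.
have [c1 [hc1 c10 gc1 cg1]] := peirce_inv hg1 g10.
have N0 : eqm m.+1 N 0.
  rewrite /N (npart0 x m a b); refine (eqm_trans _ (eqm_refl 0)).
  rewrite add0r; refine (eqm_le _ (X0 _ _)).
  by move: mK; clear; case: K.
have hM : peirce E1 E2 (c1 * N * g2) by apply: peirce_mul hg2; apply: peirce_mul hNN.
have M0 : eqm m.+1 (c1 * N * g2) 0 by apply: eqmM0l; apply: eqmM0r.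
have [v [hv v0 vP]] := sylvester aE bE qa qb hM M0.
(* [g1 + g2] treats the diagonal blocks and [1 + v] the upper one; the product of [g2] and [v] is
   0. *)
split=> //; exists ((1 + u) * (g1 + g2 + g1 * v)).
have u0 : u`_0 = 0.
  have KK0 : (0 < K - m.+1)%N by rewrite subn_gt0.
  by rewrite coefD (upart0 x m a b) // (X0 _ _ 0 KK0) coef0 addr0.
have subA := subsetUl (leaves a) (leaves b).
have subB := subsetUr (leaves a) (leaves b).
have hg : corner (leaves (Node m a b)) (g1 + g2 + g1 * v).
  apply: peirce_add; first apply: peirce_add.
  - exact: (peirce_sub subA subA hg1).
  - exact: (peirce_sub subB subB hg2).
  - exact: (peirce_sub subA subB (peirce_mul hg1 hv)).
split.
- rewrite mulrDl mul1r; apply: peirce_add => //; apply: peirce_mul hg.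
  exact: (peirce_sub subB subA hu).
- rewrite mulrDl mul1r coefD [(u * _)`_0]coefM big_ord1 u0 mul0r addr0.
  rewrite coefD coefD g10 g20 coefM big_ord1 v0 mulr0 addr0.
  by rewrite -sum12.
have uu : u * u = 0 by exact: (peirce_orth e12 hu hu).
rewrite PE2.
have -> : (1 + u) * (p + N + q) * (1 - u) * ((1 + u) * (g1 + g2 + g1 * v)) =
  (1 + u) * ((p + N + q) * (g1 + g2 + g1 * v))
   - (1 + u) * (p + N + q) * (u * u) * (g1 + g2 + g1 * v) by ncring.
rewrite uu mulr0 mul0r subr0 -mulrA.
have [z1 z2 z3 z4 z5] : [/\ p * g2 = 0, N * g1 = 0, q * g1 = 0, g1 * Tdiag (leaves b) = 0
   & g2 * Tdiag (leaves a) = 0].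
  split; [exact: (peirce_orth e12 hp hg2)|exact: (peirce_orth e21 hNN hg1)|exact: (peirce_orth e21 hq hg1)
   |exact: (peirce_orth e12 hg1 (Tdiag_inc _))|exact: (peirce_orth e21 hg2 (Tdiag_inc _))].
have z6 : v * Tdiag (leaves a) = 0 by exact: (peirce_orth e21 hv (Tdiag_inc _)).
rewrite TdiagU //.
have -> : (p + N + q) * (g1 + g2 + g1 * v) = p * g1 + q * g2 + (p * g1) * v + N * g2.
  have -> : (p + N + q) * (g1 + g2 + g1 * v) = p * g1 + q * g2 + (p * g1) * v + N * g2
    + p * g2 + N * g1 + (N * g1) * v + q * g1 + (q * g1) * v by ncring.
  by rewrite z1 z2 z3 mul0r !addr0.
have -> : (g1 + g2 + g1 * v) * (Tdiag (leaves a) + Tdiag (leaves b)) =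
   g1 * Tdiag (leaves a) + g2 * Tdiag (leaves b) + g1 * (v * Tdiag (leaves b)).
  set T1 := Tdiag (leaves a) in z4 z5 z6 *; set T2 := Tdiag (leaves b) in z4 z5 z6 *.
  have -> : (g1 + g2 + g1 * v) * (T1 + T2) = g1 * T1 + g2 * T2 + g1 * (v * T2)
     + g1 * T2 + g2 * T1 + g1 * (v * T1) by ncring.
  by rewrite z4 z5 z6 mulr0 !addr0.
rewrite pg1 qg2.
have Ng2 : eqm K (N * g2) (g1 * (v * Tdiag (leaves b) - Tdiag (leaves a) * v)).
  rewrite vP.
  have -> : g1 * (c1 * N * g2) = (g1 * c1) * N * g2 by ncring.
  by rewrite gc1; have -> : (EE (leaves a))%:P * N = N by case: hNN.
rewrite Ng2.
have -> : g1 * Tdiag (leaves a) + g2 * Tdiag (leaves b) + g1 * Tdiag (leaves a) * v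
    + g1 * (v * Tdiag (leaves b) - Tdiag (leaves a) * v) =
  g1 * Tdiag (leaves a) + g2 * Tdiag (leaves b) + g1 * (v * Tdiag (leaves b)) by ncring.
exact: eqm_refl.
Qed.

(** * Multiplicities, signs and the residue of the explicit matrix *)

Fixpoint mult t j j' : nat :=
  match t with
  | Leaf _ => 0%N
  | Node m a b =>
    if (j \in leaves a) && (j' \in leaves a) then mult a j j'
    else if (j \in leaves b) && (j' \in leaves b) then mult b j j'
    else (K - m.+2)%N
  end.

(* The sign of [E j' * x l * E j] in the moment map at [j]: the coefficient is 1
   when [j'] lies to the left of [j] in the tree. *)
Fixpoint side t j' j : F :=
  match t with
  | Leaf _ => 0
  | Node m a b =>
    if (j \in leaves a) && (j' \in leaves a) then side a j' j
    else if (j \in leaves b) && (j' \in leaves b) then side b j' j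
    else if j' \in leaves a then 1 else -1
  end.

(** The node where [j] and [j'] part carries the first degree in which their polynomials differ, so
    the count does not depend on the tree. *)
Lemma multE t j j' m : wf t -> j \in leaves t -> j' \in leaves t ->
  eqm m (qh j) (qh j') -> (qh j)`_m != (qh j')`_m -> mult t j j' = (K - m.+2)%N.
Proof.
move=> wt jt jt' e ne; elim: t wt jt jt' => /= [i _|n a IHa b IHb].
  by rewrite !inE => /eqP jj /eqP jj'; rewrite jj jj' eqxx in ne.
case=> wa wb d [h [qE qa qb]] jt jt'.
case: ifP => [/andP[]|]; first exact: IHa.
case: ifP => [/andP[]|]; first by move=> ? ? _; exact: IHb.
have diff i i' : i \in leaves a -> i' \in leaves b ->
    eqm n (qh i) (qh i') /\ (qh i)`_n != (qh i')`_n.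
  move=> ia ib; split; last by rewrite qa // eq_sym qb.
  by move=> l ln; rewrite !qE ?inE ?ia ?ib ?orbT.
have fin : eqm n (qh j) (qh j') /\ (qh j)`_n != (qh j')`_n -> (K - n.+2 = K - m.+2)%N.
  case=> en nen; case: (ltngtP n m) => [nm|mn|->] //.
    by rewrite (e _ nm) eqxx in nen.
  by rewrite (en _ mn) eqxx in ne.
move: jt jt'; rewrite !inE => /orP[ja|jb] /orP[ja'|jb']; rewrite ?ja ?ja' ?jb ?jb' ?andbT //= => h1 h2.
  by apply: fin; apply: diff.
apply: fin; case: (diff j' j ja' jb) => en nen; split; last by rewrite eq_sym.
exact: eqm_sym.
Qed.

Lemma side_opp t j j' : wf t -> j \in leaves t -> j' \in leaves t -> j != j' ->
  side t j' j = - side t j j' /\ (side t j j' = 1 \/ side t j j' = -1).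
Proof.
move=> wt jt jt' ne; elim: t wt jt jt' => /= [i _|n a IHa b IHb].
  by rewrite !inE => /eqP jj /eqP jj'; rewrite jj jj' eqxx in ne.
case=> wa wb d _ jt jt'.
rewrite [(j' \in leaves a) && _]andbC [(j' \in leaves b) && _]andbC.
case: ifP => [/andP[]|]; first exact: IHa.
case: ifP => [/andP[]|]; first by move=> ? ? _; exact: IHb.
move: jt jt'; rewrite !inE => /orP[ja|jb] /orP[ja'|jb'];
  rewrite ?ja ?ja' ?jb ?jb' ?andbT //= => h1 h2.
  by rewrite (disjointFl d jb'); split; [|left].
by rewrite (disjointFl d jb) opprK; split; [|right].
Qed.

Lemma upart_coef x m a b l : (upart x m a b)`_l.+1 =
  if (l < K - m.+2)%N then EE (leaves b) * x l * EE (leaves a) else 0.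
Proof. by rewrite coef_poly [(K - m.+2)%N]subnS ltn_predRL. Qed.

Lemma npart_coef x m a b l : (l < K - m.+2)%N ->
  (npart x m a b)`_(K.-2 - l) = EE (leaves a) * x l * EE (leaves b).
Proof.
move=> lw; rewrite coef_poly.
have [-> -> ->] : [/\ (K.-2 - l < K.-1)%N, (m < K.-2 - l)%N & (K.-2 - (K.-2 - l) = l)%N].
  by clear -lw; split; lia.
by [].
Qed.

(** The degrees [K.-2 - l] and [l.+1] are complementary to [K.-1], so each [x l] meets only
    itself. *)
Lemma npart_upart_res x m a b : (m.+1 < K)%N ->
  (npart x m a b * upart x m a b)`_K.-1 =
  \sum_(l < K - m.+2) EE (leaves a) * x l * EE (leaves b) * x l * EE (leaves a).
Proof.
move=> mK; have u00 : (upart x m a b)`_0 = 0 by rewrite upart0 // coef0.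
rewrite coefMr big_ord_recl /= u00 mulr0 add0r.
rewrite (big_ord_widen K.-1 (fun l => EE (leaves a) * x l * EE (leaves b) * x l * EE (leaves a))).
  rewrite [RHS]big_mkcond /=; apply: eq_bigr => l _; rewrite /bump /= add1n upart_coef.
  case: ifP => lw; last by rewrite mulr0.
  have -> : (K.-1 - l.+1 = K.-2 - l)%N by clear -mK lw; lia.
  rewrite npart_coef //; set e1 := EE (leaves a); set e2 := EE (leaves b).
  have -> : e1 * x l * e2 * (e2 * x l * e1) = e1 * x l * (e2 * e2) * x l * e1 by ncring.
  by rewrite EE_id.
by clear -mK; lia.
Qed.

Lemma upart_npart_res x m a b : (m.+1 < K)%N ->
  (upart x m a b * npart x m a b)`_K.-1 =
  \sum_(l < K - m.+2) EE (leaves b) * x l * EE (leaves a) * x l * EE (leaves b).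
Proof.
move=> mK; have u00 : (upart x m a b)`_0 = 0 by rewrite upart0 // coef0.
rewrite coefM big_ord_recl /= u00 mul0r add0r.
rewrite (big_ord_widen K.-1 (fun l => EE (leaves b) * x l * EE (leaves a) * x l * EE (leaves b))).
  rewrite [RHS]big_mkcond /=; apply: eq_bigr => l _; rewrite /bump /= add1n upart_coef.
  case: ifP => lw; last by rewrite mul0r.
  have -> : (K.-1 - l.+1 = K.-2 - l)%N by clear -mK lw; lia.
  rewrite npart_coef //; set e1 := EE (leaves a); set e2 := EE (leaves b).
  have -> : e2 * x l * e1 * (e1 * x l * e2) = e2 * x l * (e1 * e1) * x l * e2 by ncring.
  by rewrite EE_id.
by clear -mK; lia.
Qed.

(** In [conj_node] the left diagonal block loses [N * u] and the right one gains [u * N]; this is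
    the origin of the signs [side]. *)
Lemma Yhat_res x t j : wf t -> j \in leaves t ->
  E j * (Yhat x t)`_K.-1 * E j =
  \sum_(j' in leaves t) \sum_(l < mult t j j')
    side t j' j *: (E j * x l * E j' * x l * E j).
Proof.
elim: t => /= [i _|m a IHa b IHb wt].
  rewrite inE => /eqP ->; rewrite Tdiag_coef !big_set1 big_ord0 qh_res scale0r.
  by rewrite mulr0 mul0r.
have mK := wf_node_lt (wt : wf (Node m a b)).
case: (wt) => wa wb d _; rewrite in_setU => jt.
have hU := upart_inc x m a b; have hN := npart_inc x m a b.
have ha := Yhat_inc x wa; have hb := Yhat_inc x wb.
rewrite (conj_node (EE_disj d) hU hN ha hb).
set u := upart x m a b in hU *; set N := npart x m a b in hN *.
have cD (p1 p2 p3 p4 : {poly A}) i :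
  (p1 + p2 + p3 + p4)`_i = p1`_i + p2`_i + p3`_i + p4`_i by rewrite !coefD.
have sand e f q i : peirce e f q -> E j * e = 0 \/ f * E j = 0 -> E j * q`_i * E j = 0.
  move=> /(peirce_coef i)[ql qr] [z|z]; first by rewrite -ql mulrA z !mul0r.
  by rewrite -qr -!mulrA z !mulr0.
have hp21 : peirce (EE (leaves b)) (EE (leaves a)) (u * Yhat x a - Yhat x b * u - u * N * u).
  apply: peirce_add; first apply: peirce_add; do ?apply: peirce_opp.
  - exact: peirce_mul hU ha.
  - exact: peirce_mul hb hU.
  - exact: (peirce_mul (peirce_mul hU hN) hU).
have hp11 : corner (leaves a) (Yhat x a - N * u).
  by apply: peirce_add => //; apply: peirce_opp; apply: peirce_mul hN hU.
have hp22 : corner (leaves b) (Yhat x b + u * N).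
  by apply: peirce_add => //; apply: peirce_mul hU hN.
rewrite cD !mulrDr !mulrDl.
rewrite (eq_bigl _ _ (fun i => in_setU i _ _)) bigU //=.
have [ja|jNa] := boolP (j \in leaves a).
  have jb : (j \in leaves b) = false by rewrite (disjointFr d ja).
  rewrite (sand _ _ _ _ hN) ?(sand _ _ _ _ hp21) ?(sand _ _ _ _ hp22) ?EEr ?EEl ?jb; do ?by [left|right].
  rewrite !addr0 coefB npart_upart_res // mulrBr mulrBl IHa //; congr (_ + _).
    by apply: eq_bigr => j' ->.
  rewrite mulr_sumr mulr_suml -sumrN /=.
  rewrite [RHS](eq_bigr (fun j' => \sum_(l < K - m.+2) - (E j * x l * E j' * x l * E j))).
    rewrite [RHS]exchange_big /=; apply: eq_bigr => l _.
    rewrite sumrN -mulr_suml -mulr_suml -mulr_sumr -/(EE _) !mulrA EEr ja.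
    by rewrite -!mulrA EEl ja.
  move=> j' jb'; rewrite (disjointFl d jb') ?andbF /=.
  by rewrite ?jb; apply: eq_bigr => l _; rewrite scaleN1r.
have jb : j \in leaves b by move: jt; rewrite (negPf jNa).
rewrite (sand _ _ _ _ hN) ?(sand _ _ _ _ hp21) ?(sand _ _ _ _ hp11) ?EEr ?EEl ?(negPf jNa); do ?by [left|right].
rewrite !add0r coefD upart_npart_res // mulrDr mulrDl IHb // [RHS]addrC; congr (_ + _).
  by apply: eq_bigr => j' jb'; rewrite ?jb jb'.
rewrite [RHS](eq_bigr (fun j' => \sum_(l < K - m.+2) E j * x l * E j' * x l * E j)).
    rewrite [RHS]exchange_big /= mulr_sumr mulr_suml; apply: eq_bigr => l _.
    rewrite -mulr_suml -mulr_suml -mulr_sumr -/(EE _) !mulrA EEr jb.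
    by rewrite -!mulrA EEl jb.
  move=> j' ja'; rewrite (disjointFr d ja') ?andbF /= ?ja'.
by apply: eq_bigr => l _; rewrite scale1r.
Qed.

(** Induction on the cardinality: split at the least degree in which some polynomial of [S] differs
    from that of a fixed [j0], which then serves as [h]. *)
Lemma btree_exists S : S != set0 -> exists t, wf t /\ leaves t = S.
Proof.
have [k] := ubnP #|S|; elim: k S => // k IH S; rewrite ltnS => Sk /set0Pn[j0 j0S].
have [/existsP[j /andP[jS jj0]]|/existsPn all0] := boolP [exists j, (j \in S) && (j != j0)]; last first.
  exists (Leaf j0); split=> //; apply/setP => j; rewrite inE; apply/eqP/idP => [->//|jS].
  by have := all0 j; rewrite jS /= negbK => /eqP.
pose dif m := [exists j in S, (qh j)`_m != (qh j0)`_m].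
have exm : exists m, dif m.
  have [/existsP[m jm]|/existsPn no] := boolP [exists m : 'I_K.-1, (qh j)`_m != (qh j0)`_m].
    by exists m; apply/exists_inP; exists j.
  case: (qh_sep jj0) => i iK.
  by have := no (Ordinal iK); rewrite negbK => /eqP.
case: (ex_minnP exm) => m /exists_inP[j1 j1S j1m] mmin.
pose S1 := [set j in S | (qh j)`_m == (qh j0)`_m].
pose S2 := [set j in S | (qh j)`_m != (qh j0)`_m].
have US : S1 :|: S2 = S.
  by apply/setP => i; rewrite !inE -andb_orr orbN andbT.
have d12 : [disjoint S1 & S2].
  by rewrite disjoints_subset; apply/subsetP => i; rewrite !inE => /andP[-> ->].
have j01 : j0 \in S1 by rewrite inE j0S eqxx.
have j12 : j1 \in S2 by rewrite inE j1S.
have card12 : (#|S1| + #|S2|)%N = #|S| by rewrite -US cardsU disjoint_setI0 // cards0 subn0.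
have c1 : (0 < #|S1|)%N by apply/card_gt0P; exists j0.
have c2 : (0 < #|S2|)%N by apply/card_gt0P; exists j1.
have [a [wa aS]] : exists t, wf t /\ leaves t = S1.
  by apply: IH; [clear -card12 c2 Sk; lia|apply/set0Pn; exists j0].
have [b [wb bS]] : exists t, wf t /\ leaves t = S2.
  by apply: IH; [clear -card12 c1 Sk; lia|apply/set0Pn; exists j1].
exists (Node m a b); split; last by rewrite /= aS bS.
split; rewrite ?aS ?bS //; exists (qh j0); split=> i; rewrite ?aS ?bS /= ?aS ?bS ?US.
- move=> iS l lm; apply/eqP; apply: contraTT lm => ne; rewrite -leqNgt; apply: mmin.
  by apply/exists_inP; exists i.
- by rewrite inE => /andP[_ /eqP].
- by rewrite inE => /andP[].
Qed.

(** * Recovering the tuple from the irregular coefficients *)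

Section Relation.
Variable Rel : A -> A -> Prop.
Hypothesis Rel_add : forall c c' d d', Rel c c' -> Rel d d' -> Rel (c + d) (c' + d').
Hypothesis Rel_mul : forall c c' d d', Rel c c' -> Rel d d' -> Rel (c * d) (c' * d').
Hypothesis Rel_scale : forall (r : F) c c', Rel c c' -> Rel (r *: c) (r *: c').
Hypothesis Rel_1 : Rel 1 1.

Lemma Rel0 : Rel 0 0.
Proof. by rewrite -(scale0r 1); apply: Rel_scale. Qed.
Lemma Rel_opp c c' : Rel c c' -> Rel (- c) (- c').
Proof. by move=> r; rewrite -!scaleN1r; apply: Rel_scale. Qed.
Lemma Rel_sum (I : Type) (r : seq I) (Q : pred I) (G H : I -> A) :
  (forall i, Q i -> Rel (G i) (H i)) ->
  Rel (\sum_(i <- r | Q i) G i) (\sum_(i <- r | Q i) H i).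
Proof. by move=> GH; apply: (big_ind2 Rel); [exact: Rel0|move=> *; exact: Rel_add|]. Qed.

Definition Relm m (p q : {poly A}) := forall i, (i < m)%N -> Rel p`_i q`_i.

Lemma Relm_add m p p' q q' : Relm m p p' -> Relm m q q' -> Relm m (p + q) (p' + q').
Proof. by move=> r s i im; rewrite !coefD; apply: Rel_add; [exact: r|exact: s]. Qed.
Lemma Relm_opp m p p' : Relm m p p' -> Relm m (- p) (- p').
Proof. by move=> r i im; rewrite !coefN; apply: Rel_opp; exact: r. Qed.
Lemma Relm_mul m p p' q q' : Relm m p p' -> Relm m q q' -> Relm m (p * q) (p' * q').
Proof.
move=> r s i im; rewrite !coefM; apply: Rel_sum => j _; apply: Rel_mul.
  by apply: r; apply: leq_ltn_trans im; rewrite -ltnS.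
by apply: s; apply: leq_ltn_trans im; exact: leq_subr.
Qed.
Lemma Relm_C m c c' : Rel c c' -> Relm m c%:P c'%:P.
Proof. by move=> r [|i] _; rewrite !coefC //=; exact: Rel0. Qed.
Lemma Relm_scal m f : Relm m (scal f) (scal f).
Proof. by move=> i _; rewrite coef_map /=; apply: Rel_scale. Qed.

Lemma interpolate (s : seq F) (f : F -> F) : uniq s ->
  exists p : {poly F}, forall c, c \in s -> p.[c] = f c.
Proof.
elim: s => [_|c s IH /= /andP[cs us]]; first by exists 0.
have [p pE] := IH us; pose r : {poly F} := \prod_(v <- s) ('X - v%:P).
have rc : r.[c] != 0.
  by rewrite -rootE root_prod_XsubC.
exists (p + ((f c - p.[c]) / r.[c]) *: r) => v; rewrite hornerD hornerZ inE.
case/orP => [/eqP ->|vs]; first by rewrite divfK // addrC subrK.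
have /rootP -> : root r v by rewrite root_prod_XsubC.
by rewrite mulr0 addr0 pE.
Qed.

(** By interpolation a function of a diagonal element is a polynomial in it, with [EE S] as its
    zeroth power. In particular spectral idempotents inherit every relation. *)
Lemma Rel_spectral S (a : J -> F) (f : F -> F) :
  Rel (EE S) (EE S) ->
  Rel (\sum_(j in S) a j *: E j) (\sum_(j in S) a j *: E j) ->
  Rel (\sum_(j in S) f (a j) *: E j) (\sum_(j in S) f (a j) *: E j).
Proof.
move=> RS Ra.
have key (p : {poly F}) : Rel (\sum_(j in S) p.[a j] *: E j) (\sum_(j in S) p.[a j] *: E j).
  elim/poly_ind: p => [|p c IH].
    by apply: Rel_sum => j _; rewrite horner0 scale0r; exact: Rel0.
  suff -> : \sum_(j in S) (p * 'X + c%:P).[a j] *: E j =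
     (\sum_(j in S) p.[a j] *: E j) * (\sum_(j in S) a j *: E j) + c *: EE S.
    by apply: Rel_add; [exact: Rel_mul|exact: Rel_scale].
  rewrite mulr_suml scaler_sumr -big_split /=; apply: eq_bigr => j jS.
  rewrite mulr_sumr (bigD1 j) //= big1 ?addr0 => [|i /andP[_ ij]].
    by rewrite -scalerAl -scalerAr E_orth eqxx scalerA -scalerDl !hornerE.
  by rewrite -scalerAl -scalerAr E_orth eq_sym (negPf ij) !scaler0.
have [p pE] := interpolate f (undup_uniq [seq a j | j <- enum S]).
rewrite (eq_bigr (fun j => p.[a j] *: E j)) // => j jS.
by rewrite pE // mem_undup map_f // mem_enum.
Qed.

(** [Rel] will be intertwining by a matrix, or stability of a subspace. The coefficient of degree
    [m] is diagonal and yields the idempotents of the two sides; the coefficients of [upart] then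
    follow one by one from the lower left block, using only degrees below [K.-1]. *)
Lemma rel_fwd t x x' : wf t -> Rel (EE (leaves t)) (EE (leaves t)) ->
  Relm K.-1 (Yhat x t) (Yhat x' t) ->
  (forall j, j \in leaves t -> Rel (E j) (E j)) /\
  (forall j j' l, j \in leaves t -> j' \in leaves t -> (l < mult t j j')%N ->
     Rel (E j' * x l * E j) (E j' * x' l * E j)).
Proof.
elim: t => [i _ RE _|m a IHa b IHb wt RS RY].
  by split=> [j|j j' l]; rewrite /= inE => /eqP -> //; rewrite -EE1.
have mK := wf_node_lt wt.
case: (wt) => wa wb d [h [qE qa qb]].
have mK1 : (m < K.-1)%N by clear -mK; lia.
have d' : [disjoint leaves b & leaves a] by rewrite disjoint_sym.
have e12 := EE_disj d; have e21 := EE_disj d'.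
have ee1 := EE_id (leaves a); have ee2 := EE_id (leaves b).
have aE : forall j, j \in leaves a -> eqm m (qh j) h by move=> j ja; apply: qE; rewrite inE ja.
have bE : forall j, j \in leaves b -> eqm m (qh j) h by move=> j jb; apply: qE; rewrite inE jb orbT.
have RD : Rel (\sum_(j in leaves (Node m a b)) (qh j)`_m *: E j)
              (\sum_(j in leaves (Node m a b)) (qh j)`_m *: E j).
  have := RY m mK1.
  by rewrite !(Yhat_low _ wt qE (ltnSn m)) Tdiag_coef.
have split_sum (f : J -> A) : \sum_(j in leaves (Node m a b)) f j =
   \sum_(j in leaves a) f j + \sum_(j in leaves b) f j.
  by rewrite (eq_bigl _ _ (fun i => in_setU i _ _)) bigU.
pose V := \sum_(j in leaves b) (h`_m - (qh j)`_m)^-1 *: E j.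
have RV : Rel V V.
  have := Rel_spectral (fun c => if c == h`_m then 0 else (h`_m - c)^-1) RS RD.
  rewrite split_sum big1 ?add0r => [|j ja]; last by rewrite qa // eqxx scale0r.
  rewrite (eq_bigr (fun j => (h`_m - (qh j)`_m)^-1 *: E j)) // => j jb.
  by rewrite (negPf (qb j jb)).
have R1 : Rel (EE (leaves a)) (EE (leaves a)).
  have := Rel_spectral (fun c => (c == h`_m)%:R) RS RD.
  rewrite split_sum [X in _ + X]big1 ?addr0 => [|j jb]; last by rewrite (negPf (qb j jb)) scale0r.
  by rewrite (eq_bigr E) // => j ja; rewrite qa // eqxx scale1r.
have R2 : Rel (EE (leaves b)) (EE (leaves b)).
  have := Rel_spectral (fun c => (c != h`_m)%:R) RS RD.
  rewrite split_sum [X in X + _]big1 ?add0r => [|j ja]; last by rewrite qa // eqxx scale0r.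
  by rewrite (eq_bigr E) // => j jb; rewrite qb // scale1r.
set e1 := (EE (leaves a))%:P; set e2 := (EE (leaves b))%:P.
(* The lower left block is expressed through the diagonal blocks of the conjugate, which are at
   hand, and not through the matrices of the subtrees, which are known only after [upart] is. *)
have blocks y : [/\ e1 * Yhat y (Node m a b) * e1 = Yhat y a - npart y m a b * upart y m a b,
   e1 * Yhat y (Node m a b) * e2 = npart y m a b,
   e2 * Yhat y (Node m a b) * e2 = Yhat y b + upart y m a b * npart y m a b &
   e2 * Yhat y (Node m a b) * e1 = upart y m a b * (e1 * Yhat y (Node m a b) * e1)
     - (e2 * Yhat y (Node m a b) * e2) * upart y m a b
     + upart y m a b * npart y m a b * upart y m a b].
  have hU := upart_inc y m a b; have hN := npart_inc y m a b.
  have ha := Yhat_inc y wa; have hb := Yhat_inc y wb.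
  have YE : Yhat y (Node m a b) = (1 + upart y m a b) * (Yhat y a + npart y m a b + Yhat y b)
        * (1 - upart y m a b) by [].
  rewrite YE (conj_node e12 hU hN ha hb).
  set u := upart y m a b in hU *; set N := npart y m a b in hN *.
  have eb (p q r s : {poly A}) : peirce (EE (leaves a)) (EE (leaves a)) p ->
    peirce (EE (leaves a)) (EE (leaves b)) q -> peirce (EE (leaves b)) (EE (leaves a)) r ->
    peirce (EE (leaves b)) (EE (leaves b)) s ->
    [/\ e1 * (p + q + r + s) * e1 = p, e1 * (p + q + r + s) * e2 = q,
        e2 * (p + q + r + s) * e2 = s & e2 * (p + q + r + s) * e1 = r].
    case=> pl pr [ql qr] [rl rr] [sl sr].
    have z12 : e1 * e2 = 0 by rewrite -polyCM e12.
    have z21 : e2 * e1 = 0 by rewrite -polyCM e21.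
    have i1 : e1 * e1 = e1 by rewrite -polyCM ee1.
    have i2 : e2 * e2 = e2 by rewrite -polyCM ee2.
    rewrite -pl -ql -rl -sl -/e1 -/e2.
    have -> : e1 * (e1 * p + e1 * q + e2 * r + e2 * s) = e1 * p + e1 * q.
      have -> : e1 * (e1 * p + e1 * q + e2 * r + e2 * s) = (e1 * e1) * (p + q) + (e1 * e2) * (r + s) by ncring.
      by rewrite i1 z12 mul0r addr0 mulrDr.
    have -> : e2 * (e1 * p + e1 * q + e2 * r + e2 * s) = e2 * r + e2 * s.
      have -> : e2 * (e1 * p + e1 * q + e2 * r + e2 * s) = (e2 * e1) * (p + q) + (e2 * e2) * (r + s) by ncring.
      by rewrite i2 z21 mul0r add0r mulrDr.
    rewrite -/e1 in pl pr ql rr; rewrite -/e2 in qr rl sl sr.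
    rewrite pl ql rl sl.
    have [pe2 qe1 re2 se1] : [/\ p * e2 = 0, q * e1 = 0, r * e2 = 0 & s * e1 = 0].
      by split; [rewrite -pr|rewrite -qr|rewrite -rr|rewrite -sr]; rewrite -mulrA ?z12 ?z21 mulr0.
    by split; rewrite mulrDl ?pr ?qr ?rr ?sr ?pe2 ?qe1 ?re2 ?se1 ?addr0 ?add0r.
  have := eb (Yhat y a - N * u) N (u * Yhat y a - Yhat y b * u - u * N * u) (Yhat y b + u * N).
  case=> //.
  - by apply: peirce_add => //; apply: peirce_opp; apply: peirce_mul hN hU.
  - apply: peirce_add; first apply: peirce_add; do ?apply: peirce_opp.
    + exact: peirce_mul hU ha.
    + exact: peirce_mul hb hU.
    + exact: (peirce_mul (peirce_mul hU hN) hU).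
  - by apply: peirce_add => //; apply: peirce_mul hU hN.
  move=> -> -> -> ->; split=> //; ncring.
have RY11 : Relm K.-1 (e1 * Yhat x (Node m a b) * e1) (e1 * Yhat x' (Node m a b) * e1).
  by apply: Relm_mul; [apply: Relm_mul => //|]; exact: Relm_C.
have RY12 : Relm K.-1 (e1 * Yhat x (Node m a b) * e2) (e1 * Yhat x' (Node m a b) * e2).
  by apply: Relm_mul; [apply: Relm_mul => //|]; exact: Relm_C.
have RY21 : Relm K.-1 (e2 * Yhat x (Node m a b) * e1) (e2 * Yhat x' (Node m a b) * e1).
  by apply: Relm_mul; [apply: Relm_mul => //|]; exact: Relm_C.
have RY22 : Relm K.-1 (e2 * Yhat x (Node m a b) * e2) (e2 * Yhat x' (Node m a b) * e2).
  by apply: Relm_mul; [apply: Relm_mul => //|]; exact: Relm_C.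
have RN : Relm K.-1 (npart x m a b) (npart x' m a b).
  by have [_ <- _ _] := blocks x; have [_ <- _ _] := blocks x'.
(* The contribution of the coefficients of [upart] below degree [l], already known when the next one
   is solved for. *)
pose rem y l := let p := take_poly l (upart y m a b) in
   p * (e1 * Yhat y (Node m a b) * e1) - (e2 * Yhat y (Node m a b) * e2) * p
   + p * npart y m a b * p.
(* In degree [l + m] the rest [dl], of order [l], meets only the coefficients of degree [m] of the
   diagonal blocks minus [h]. The left one is 0, and [V] is minus the inverse of the right one. *)
have remE y l : (l < K - m.+1)%N ->
  V * (e2 * Yhat y (Node m a b) * e1 - rem y l)`_(l + m) = (upart y m a b)`_l.
  move=> lw; have [b1 b2 b3 b4] := blocks y.
  have hU := upart_inc y m a b.
  rewrite b4 /rem.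
  set u := upart y m a b in hU *; set p := take_poly l u; set N := npart y m a b.
  set X1 := e1 * _ * e1; set X2 := e2 * _ * e2.
  have N0 : eqm m.+1 N 0 by exact: npart0.
  pose dl := u - p.
  have dl0 : eqm l dl 0 by apply/eqm_subr0 => i il; rewrite coef_take_poly il.
  have dll : dl`_l = u`_l by rewrite coefB coef_take_poly ltnn subr0.
  have -> : u * X1 - X2 * u + u * N * u - (p * X1 - X2 * p + p * N * p) =
    dl * X1 - X2 * dl + (dl * N) * u + p * (N * dl) by rewrite /dl; ncring.
  have Ndl : eqm (l + m).+1 (N * dl) 0 by apply: (eqmM0 _ N0 dl0); clear; lia.
  have dlN : eqm (l + m).+1 (dl * N) 0 by apply: (eqmM0 _ dl0 N0); clear; lia.
  rewrite coefD (eqmM0r p Ndl) // coef0 addr0 coefD (eqmM0l u dlN) // coef0 addr0.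
  have dle1 : dl * e1 = dl.
    apply/polyP => i; rewrite coefMC !coefB !coef_take_poly; case: ifP => _.
      by rewrite subrr mul0r.
    by rewrite subr0; case: (peirce_coef i hU).
  have e2dl : e2 * dl = dl.
    apply/polyP => i; rewrite coefCM !coefB !coef_take_poly; case: ifP => _.
      by rewrite subrr mulr0.
    by rewrite subr0; case: (peirce_coef i hU).
  have -> : dl * X1 - X2 * dl = dl * (X1 - scal h * e1) - (X2 - scal h * e2) * dl.
    have -> : dl * (X1 - scal h * e1) - (X2 - scal h * e2) * dl =
      dl * X1 - X2 * dl + (scal h * (e2 * dl) - (dl * scal h) * e1) by ncring.
    by rewrite e2dl -scalC -mulrA dle1 subrr addr0.
  have lX1 : eqm m (X1 - scal h * e1) 0.
    rewrite /X1 b1; apply/eqm_subr0.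
    have z : eqm m (N * u) 0 by refine (eqm_le (leqnSn m) (eqmM0l u N0)).
    by rewrite -/N -/u z subr0; apply/eqm_subr0; exact: Yhat_node_low.
  have lX2 : eqm m (X2 - scal h * e2) 0.
    rewrite /X2 b3; apply/eqm_subr0.
    have z : eqm m (u * N) 0 by refine (eqm_le (leqnSn m) (eqmM0r u N0)).
    by rewrite -/N -/u z addr0; apply/eqm_subr0; exact: Yhat_node_low.
  have cX1 : (X1 - scal h * e1)`_m = 0.
    rewrite coefB /X1 b1 coefB (eqmM0l u N0) // coef0 subr0.
    rewrite (Yhat_low y wa aE (ltnSn m)) Tdiag_coef coefMC coef_map /= mulr_algl scaler_sumr.
    by apply/eqP; rewrite subr_eq0; apply/eqP; apply: eq_bigr => j ja; rewrite qa.
  have cX2 : (X2 - scal h * e2)`_m = \sum_(j in leaves b) ((qh j)`_m - h`_m) *: E j.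
    rewrite coefB /X2 b3 coefD (eqmM0r u N0) // coef0 addr0.
    rewrite (Yhat_low y wb bE (ltnSn m)) Tdiag_coef coefMC coef_map /= mulr_algl scaler_sumr.
    by rewrite -sumrB; apply: eq_bigr => j jb; rewrite scalerBl.
  rewrite coefB (coefM_low dl0 lX1) cX1 mulr0 sub0r addnC (coefM_low lX2 dl0) cX2 dll.
  rewrite mulrN mulrA -mulNr.
  suff -> : - (V * (\sum_(j in leaves b) ((qh j)`_m - h`_m) *: E j)) = EE (leaves b).
    by case: (peirce_coef l hU).
  rewrite -mulrN mulr_suml; apply: eq_bigr => j jb.
  rewrite mulrN mulr_sumr (bigD1 j) //= big1 ?addr0 => [|i /andP[_ ij]].
    rewrite -scalerAl -scalerAr E_orth eqxx scalerA -scaleNr -mulrN opprB mulVf ?scale1r //.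
    by rewrite subr_eq0 eq_sym qb.
  by rewrite -scalerAl -scalerAr E_orth eq_sym (negPf ij) !scaler0.
have RU l : (l <= K - m.+1)%N -> Relm l (upart x m a b) (upart x' m a b).
  elim: l => [|l IHl] lw i; first by rewrite ltn0.
  rewrite ltnS leq_eqVlt => /orP[/eqP ->|il]; last by apply: IHl => //; exact: ltnW.
  rewrite -(remE x l) // -(remE x' l) //; apply: Rel_mul => //.
  rewrite !coefB; apply: Rel_add; first by apply: RY21; clear -lw mK; lia.
  apply: Rel_opp.
  have Rp : Relm K.-1 (take_poly l (upart x m a b)) (take_poly l (upart x' m a b)).
    move=> k _; rewrite !coef_take_poly; case: ifP => kl; last exact: Rel0.
    by apply: IHl => //; exact: ltnW.
  suff : Relm K.-1 (rem x l) (rem x' l) by apply; clear -lw mK; lia.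
  rewrite /rem; apply: Relm_add; [apply: Relm_add; [|apply: Relm_opp]|];
    by do ?[exact: Rp | exact: RY11 | exact: RY22 | exact: RN | apply: Relm_mul].
have RUall k : Relm k (upart x m a b) (upart x' m a b).
  move=> i _; case: (ltnP i (K - m.+1)) => iw; first by apply: (RU _ (leqnn _)).
  by rewrite !coef_poly ltnNge iw /=; exact: Rel0.
have RYa : Relm K.-1 (Yhat x a) (Yhat x' a).
  have Ya y : Yhat y a = e1 * Yhat y (Node m a b) * e1 + npart y m a b * upart y m a b.
    by have [-> _ _ _] := blocks y; rewrite subrK.
  by rewrite !Ya; apply: Relm_add => //; apply: Relm_mul.
have RYb : Relm K.-1 (Yhat x b) (Yhat x' b).
  have Yb y : Yhat y b = e2 * Yhat y (Node m a b) * e2 - upart y m a b * npart y m a b.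
    by have [_ _ -> _] := blocks y; rewrite addrK.
  by rewrite !Yb; apply: Relm_add => //; apply: Relm_opp; apply: Relm_mul.
have [REa Rxa] := IHa wa R1 RYa; have [REb Rxb] := IHb wb R2 RYb.
have RE j : j \in leaves (Node m a b) -> Rel (E j) (E j).
  by rewrite inE => /orP[]; [exact: REa|exact: REb].
split=> // j j' l jt jt'.
have sand S S' z : j' \in S' -> j \in S -> E j' * (EE S' * z * EE S) * E j = E j' * z * E j.
  by move=> jS' jS; rewrite !mulrA EEr jS' -!mulrA EEl jS.
move: (jt) (jt'); rewrite /= !inE => /orP[ja|jb] /orP[ja'|jb'].
- by rewrite ja ja' /=; exact: Rxa.
- rewrite ja (disjointFl d jb') (disjointFr d ja) /= => lw.
  have Ru : Rel (EE (leaves b) * x l * EE (leaves a)) (EE (leaves b) * x' l * EE (leaves a)).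
    by have := RUall l.+2 l.+1 (ltnSn _); rewrite !upart_coef lw.
  rewrite -(sand _ _ (x l) jb' ja) -(sand _ _ (x' l) jb' ja).
  by apply: Rel_mul; [apply: Rel_mul => //|]; exact: RE.
- rewrite ja' (disjointFl d jb) (disjointFr d ja') /= andbF => lw.
  have Rn : Rel (EE (leaves a) * x l * EE (leaves b)) (EE (leaves a) * x' l * EE (leaves b)).
    by rewrite -!(npart_coef _ _ _ lw); apply: RN; clear -lw mK; lia.
  rewrite -(sand _ _ (x l) ja' jb) -(sand _ _ (x' l) ja' jb).
  by apply: Rel_mul; [apply: Rel_mul => //|]; exact: RE.
- rewrite jb jb' (disjointFl d jb) /=; exact: Rxb.
Qed.

Lemma rel_bwd t x x' : wf t ->
  (forall j, j \in leaves t -> Rel (E j) (E j)) ->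
  (forall j j' l, j \in leaves t -> j' \in leaves t -> (l < mult t j j')%N ->
     Rel (E j' * x l * E j) (E j' * x' l * E j)) ->
  forall k, Relm k (Yhat x t) (Yhat x' t).
Proof.
elim: t => [i _ RE _|m a IHa b IHb wt RE Rx] k.
  rewrite /= /Tdiag big_set1; apply: Relm_mul; [exact: Relm_scal|].
  by apply: Relm_C; apply: RE; rewrite inE.
case: (wt) => wa wb d _.
have subE S S' (y : A) : EE S' * y * EE S = \sum_(j' in S') \sum_(j in S) E j' * y * E j.
  by rewrite -mulrA mulr_suml; apply: eq_bigr => j' _; rewrite mulrA mulr_sumr.
have RU : Relm k (upart x m a b) (upart x' m a b).
  move=> [|l] _; rewrite ?upart_coef; first by rewrite !(upart0 _ _ _ _ 0%N isT) coef0; exact: Rel0.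
  case: ifP => lw; last exact: Rel0.
  rewrite !subE; apply: Rel_sum => j' jb'; apply: Rel_sum => j ja.
  apply: Rx; rewrite /= ?inE ?ja ?jb' ?orbT //.
  by rewrite (disjointFl d jb') (disjointFr d ja).
have RN : Relm k (npart x m a b) (npart x' m a b).
  move=> i _; rewrite !coef_poly; case: ifP => iK; last exact: Rel0.
  case: ifP => mi; last exact: Rel0.
  rewrite !subE; apply: Rel_sum => j' ja'; apply: Rel_sum => j jb.
  apply: Rx; rewrite /= ?inE ?ja' ?jb ?orbT //.
  rewrite (disjointFl d jb) (disjointFr d ja') /=.
  by clear -iK mi; lia.
have Ra : Relm k (Yhat x a) (Yhat x' a).
  apply: IHa => // [j ja|j j' l ja ja' lw]; first by apply: RE; rewrite inE ja.
  by apply: Rx; rewrite /= ?inE ?ja ?ja'.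
have Rb : Relm k (Yhat x b) (Yhat x' b).
  apply: IHb => // [j jb|j j' l jb jb' lw]; first by apply: RE; rewrite inE jb orbT.
  by apply: Rx; rewrite /= ?inE ?jb ?jb' ?orbT //= (disjointFl d jb).
have R1 : Relm k 1 1 by exact: Relm_C.
by apply: Relm_mul; [apply: Relm_mul|]; do ?[apply: Relm_add => // | apply: Relm_opp].
Qed.

End Relation.

(** * Constant conjugation and the residue of the normal form *)

Section Conjugates.
Variable t : btree J.
Hypothesis wt : wf t.
Hypothesis lt : leaves t = [set: J].
Hypothesis E1 : EE [set: J] = 1.
Variable R : A.
Local Notation T := (Tdiag [set: J]).

(** Degree [K.-1] sees only the constant coefficient of [b], so a residue term passes through
    unipotent factors. *)
Lemma mulCX_unip (c : A) (b : {poly A}) : b`_0 = 1 ->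
  eqm K (c%:P * 'X^(K.-1) * b) (c%:P * 'X^(K.-1)).
Proof.
move=> b0 i ik; rewrite -mulrA -commr_polyXn mulrA !coefMXn; case: ltnP => // ki.
have -> : (i - K.-1 = 0)%N by clear -ik ki; lia.
by rewrite coefCM b0 mulr1 coefC.
Qed.

Lemma mul_unipCX (c : A) (b : {poly A}) : b`_0 = 1 ->
  eqm K (b * (c%:P * 'X^(K.-1))) (c%:P * 'X^(K.-1)).
Proof.
move=> b0 i ik; rewrite mulrA !coefMXn; case: ltnP => // ki.
have -> : (i - K.-1 = 0)%N by clear -ik ki; lia.
by rewrite coefMC b0 mul1r coefC.
Qed.

Lemma CX0 (c : A) : eqm K.-1 (c%:P * 'X^(K.-1)) 0.
Proof. by apply: eqmM0r; exact: eqmXn. Qed.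

Lemma peirce_EE1 (p : {poly A}) : corner [set: J] p.
Proof. by split; rewrite E1 ?mul1r ?mulr1. Qed.

(** With [G] equal to [g] times a unipotent [b], undoing [g] and subtracting the residue term leaves
    a point of the unipotent orbit, to which [orb_fwd] applies. *)
Lemma conj_orb_fwd (P G : {poly A}) g gi : g * gi = 1 -> gi * g = 1 -> G`_0 = g ->
  eqm K (P * G) (G * (T + R%:P * 'X^(K.-1))) ->
  exists x, eqm K.-1 P (g%:P * Yhat x t * gi%:P) /\
    forall j, E j * (gi * P`_K.-1 * g - (Yhat x t)`_K.-1) * E j = E j * R * E j.
Proof.
move=> gg ggi G0 GP.
have ggP : g%:P * gi%:P = 1 by rewrite -polyCM gg.
have ggiP : gi%:P * g%:P = 1 by rewrite -polyCM ggi.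
pose b := gi%:P * G.
have b0 : b`_0 = 1 by rewrite coefCM G0 ggi.
pose Q := gi%:P * P * g%:P - R%:P * 'X^(K.-1).
have Qb : eqm K (Q * b) (b * T).
  have -> : Q * b = gi%:P * (P * (g%:P * gi%:P) * G) - R%:P * 'X^(K.-1) * b.
    by rewrite /Q /b; ncring.
  rewrite ggP mulr1 (mulCX_unip _ b0) GP.
  have -> : gi%:P * (G * (T + R%:P * 'X^(K.-1))) = b * T + b * (R%:P * 'X^(K.-1)).
    by rewrite /b; ncring.
  by rewrite (mul_unipCX _ b0) addrK.
have [|x [QY QE]] := orb_fwd (P := Q) wt.
  rewrite lt; split; first exact: peirce_EE1.
  by exists b; split=> //; [exact: peirce_EE1|rewrite E1].
exists x; split.
  have -> : P = g%:P * Q * gi%:P + g%:P * (R%:P * 'X^(K.-1)) * gi%:P.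
    have -> : g%:P * Q * gi%:P + g%:P * (R%:P * 'X^(K.-1)) * gi%:P =
       (g%:P * gi%:P) * P * (g%:P * gi%:P) by rewrite /Q; ncring.
    by rewrite ggP mul1r mulr1.
  by rewrite QY CX0 mulr0 mul0r addr0.
move=> j; have := QE j; rewrite lt inE => /(_ isT).
rewrite /Q coefB coefB coefMC !coefCM coefXn eqxx mulr1 => e.
move: e; set y := (Yhat x t)`_K.-1; set c := gi * P`_K.-1 * g.
have -> : E j * (c - R - y) * E j = E j * (c - y) * E j - E j * R * E j by ncring.
by move/eqP; rewrite subr_eq0 => /eqP.
Qed.

(** A block diagonal [h] commutes with the irregular type and merely conjugates [R], so the residue
    has to be matched only up to such an [h]. *)
Lemma conj_orb_bwd (P : {poly A}) g gi h hi x : g * gi = 1 -> gi * g = 1 -> hi * h = 1 ->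
  (forall j, h * E j = E j * h) ->
  eqm K.-1 P (g%:P * Yhat x t * gi%:P) ->
  (forall j, E j * (gi * P`_K.-1 * g - (Yhat x t)`_K.-1) * E j = E j * (h * R * hi) * E j) ->
  exists G : {poly A}, G`_0 = g * h /\ eqm K (P * G) (G * (T + R%:P * 'X^(K.-1))).
Proof.
move=> gg ggi hh hE PY PE.
have ggP : g%:P * gi%:P = 1 by rewrite -polyCM gg.
have ggiP : gi%:P * g%:P = 1 by rewrite -polyCM ggi.
pose C := h * R * hi.
pose Q := gi%:P * P * g%:P - C%:P * 'X^(K.-1).
have QY : eqm K.-1 Q (Yhat x t).
  rewrite /Q CX0 subr0 PY.
  have -> : gi%:P * (g%:P * Yhat x t * gi%:P) * g%:P =
     (gi%:P * g%:P) * Yhat x t * (gi%:P * g%:P) by ncring.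
  by rewrite ggiP mul1r mulr1.
have QE j : j \in leaves t -> E j * (Q - Yhat x t)`_K.-1 * E j = 0.
  move=> _; rewrite /Q coefB coefB coefMC !coefCM coefXn eqxx mulr1.
  have -> : E j * (gi * P`_K.-1 * g - C - (Yhat x t)`_K.-1) * E j =
    E j * (gi * P`_K.-1 * g - (Yhat x t)`_K.-1) * E j - E j * C * E j by ncring.
  by rewrite PE subrr.
have cQ : corner (leaves t) Q by rewrite lt; exact: peirce_EE1.
have [_ [b [_ b0 Qb]]] := orb_bwd wt cQ QY QE.
rewrite lt E1 in b0; rewrite lt in Qb.
have hT : h%:P * T = T * h%:P.
  rewrite /Tdiag mulr_sumr mulr_suml; apply: eq_bigr => j _.
  by rewrite mulrA -scalC -!mulrA -!polyCM hE.
exists (g%:P * b * h%:P); split; first by rewrite coefMC coefCM b0 mulr1.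
have -> : P * (g%:P * b * h%:P) = g%:P * ((Q + C%:P * 'X^(K.-1)) * b) * h%:P.
  rewrite /Q subrK.
  have -> : g%:P * (gi%:P * P * g%:P * b) * h%:P =
    (g%:P * gi%:P) * P * (g%:P * b * h%:P) by ncring.
  by rewrite ggP mul1r.
have -> : (Q + C%:P * 'X^(K.-1)) * b = Q * b + C%:P * 'X^(K.-1) * b by rewrite mulrDl.
rewrite Qb (mulCX_unip _ b0).
have -> : g%:P * b * h%:P * (T + R%:P * 'X^(K.-1)) =
  g%:P * b * (h%:P * T) + g%:P * (b * ((h * R)%:P * 'X^(K.-1))).
  by rewrite polyCM; ncring.
rewrite (mul_unipCX _ b0) hT.
have -> : h * R = C * h by rewrite /C -!mulrA hh mulr1.
have Xc (c : A) : c%:P * 'X^(K.-1) = 'X^(K.-1) * c%:P by rewrite commr_polyXn.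
rewrite (polyCM C h).
have -> : C%:P * h%:P * 'X^(K.-1) = C%:P * 'X^(K.-1) * h%:P by rewrite -!mulrA Xc.
have -> : g%:P * (b * T + C%:P * 'X^(K.-1)) * h%:P =
  g%:P * b * (T * h%:P) + g%:P * (C%:P * 'X^(K.-1) * h%:P) by ncring.
exact: eqm_refl.
Qed.

End Conjugates.

End Local.

(** * Legs *)

Section Pairs.
Variable F : fieldType.

(* The kernel of [M] measures the freedom in [p]: rows killed by [kermx M]
   factor through [M]. *)
Lemma ker_factor m n k (M : 'M[F]_(m, n)) (D : 'M_(m, k)) :
  kermx M *m D = 0 -> D = M *m (pinvmx M *m D).
Proof.
move=> kD; apply/eqP; rewrite -subr_eq0 mulmxA -{1}[D]mul1mx -mulmxBl.
have /submxP[W ->] : (1%:M - M *m pinvmx M <= kermx M)%MS.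
  by apply/sub_kermxP; rewrite mulmxBl mul1mx mulmxKpV ?subrr.
by rewrite -mulmxA kD mulmx0.
Qed.

Lemma free_extend m n (X Y : 'M[F]_(m, n)) : row_free X -> row_free Y ->
  exists2 q, q \in unitmx & X *m q = Y.
Proof.
move=> fX fY.
have XY : X *m (pinvmx X *m Y) = Y by rewrite mulmxA mulmxVp // mul1mx.
have [|q uq qP] := @complete_unitmx _ _ _ X (pinvmx X *m Y).
  by rewrite XY; move: fX fY; rewrite /row_free => /eqP -> /eqP.
by exists q; rewrite // -qP XY.
Qed.

(** Split the space into the images of [B] and [L]; then [A] becomes the pair of [M = A *m B] and
    [e]. A map fixing [B] is block triangular with entries [p] and [q]: [q] matches [e] with [e'] on
    the left kernel of [M], where both are free, and [p] corrects the rest, a multiple of [M]. *)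
Lemma free_pair_trans r n (A A' : 'M[F]_(r, n)) (B : 'M_(n, r)) :
  row_free A -> row_free A' -> row_full B -> A *m B = A' *m B ->
  exists2 k, k \in unitmx & k *m B = B /\ A *m k = A'.
Proof.
move=> fA fA' /row_fullP[C CB] AB.
have [s [K [fK KB kerK]]] : exists s (K : 'M[F]_(s, n)), [/\ row_free K, K *m B = 0 &
    forall p (D : 'M_(p, n)), D *m B = 0 -> exists W, D = W *m K].
  exists _, (row_base (kermx B)); split; first exact: row_base_free.
    by apply/sub_kermxP; rewrite eq_row_base.
  by move=> p D DB; apply/submxP; rewrite eq_row_base; apply/sub_kermxP.
have [L LK] : exists L, 1%:M - B *m C = L *m K.
  by apply: kerK; rewrite mulmxBl mul1mx -mulmxA CB mulmx1 subrr.
have Kinj p (X Y : 'M_(p, s)) : X *m K = Y *m K -> X = Y.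
  case/row_freeP: fK => K' KK' /(congr1 (mulmx^~ K')).
  by rewrite -!mulmxA KK' !mulmx1.
have KL : K *m L = 1%:M.
  by apply: Kinj; rewrite -mulmxA -LK mulmxBr mulmx1 mulmxA KB mul0mx subr0 mul1mx.
have CL : C *m L = 0.
  by apply: Kinj; rewrite -mulmxA -LK mulmxBr mulmx1 mulmxA CB mul1mx subrr mul0mx.
pose M := A *m B.
have dec (X : 'M_(r, n)) : X *m B = M -> X = M *m C + (X *m L) *m K.
  by move=> XB; rewrite -mulmxA -LK mulmxBr mulmx1 mulmxA XB addrC subrK.
have [e [AL AE]] : exists e, A *m L = e /\ A = M *m C + e *m K.
  by exists (A *m L); split=> //; exact: dec.
have [e' AE'] : exists e', A' = M *m C + e' *m K.
  by exists (A' *m L); apply: dec.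
have [t [Z [fZ ZM kerZ]]] : exists t (Z : 'M[F]_(t, r)), [/\ row_free Z, Z *m M = 0 &
    exists W, kermx M = W *m Z].
  exists _, (row_base (kermx M)); split; first exact: row_base_free.
    by apply/sub_kermxP; rewrite eq_row_base.
  by apply/submxP; rewrite eq_row_base.
have free_mul m1 m2 m3 (X : 'M[F]_(m1, m2)) (Y : 'M_(m2, m3)) :
    row_free X -> row_free Y -> row_free (X *m Y).
  by move=> fX fY; rewrite /row_free mxrankMfree.
have free_e (X : 'M_(r, n)) f : row_free X -> X = M *m C + f *m K -> row_free (Z *m f).
  move=> fX XE; have := free_mul _ _ _ _ _ fZ fX.
  by rewrite XE mulmxDr mulmxA ZM mul0mx add0r mulmxA /row_free mxrankMfree.
have [q uq qP] := free_extend (free_e _ _ fA AE) (free_e _ _ fA' AE').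
have [p pP] : exists p, e' - e *m q = M *m p.
  exists (pinvmx M *m (e' - e *m q)); apply: ker_factor.
  have [W ->] := kerZ.
  by rewrite -mulmxA mulmxBr mulmxA qP subrr mulmx0.
pose k := B *m C + B *m p *m K + L *m q *m K.
pose k' := B *m C - B *m p *m invmx q *m K + L *m invmx q *m K.
have kk' : k *m k' = 1%:M.
  have Ck : C *m k' = C - p *m invmx q *m K.
    by rewrite /k' mulmxDr mulmxBr !mulmxA CB CL !mul0mx addr0 !mul1mx.
  have Kk : K *m k' = invmx q *m K.
    by rewrite /k' mulmxDr mulmxBr !mulmxA KB KL !mul0mx subr0 add0r !mul1mx.
  rewrite /k !mulmxDl -!mulmxA Ck Kk mulmxBr -!mulmxA subrK mulKVmx //.
  by rewrite -LK addrC subrK.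
exists k; first by case/mulmx1_unit: kk'.
split.
  by rewrite /k !mulmxDl -!mulmxA KB CB !mulmx0 !addr0 mulmx1.
have -> : A *m k = M *m C + M *m p *m K + e *m q *m K.
  by rewrite /k !mulmxDr !mulmxA AL.
by rewrite -pP mulmxBl -addrA subrK -AE'.
Qed.

(* Gabriel's lemma for the two-vertex quiver with opposite arrows. *)
Lemma full_pair_conj r n (a a' : 'M[F]_(n, r)) (b b' : 'M_(r, n)) :
  row_full a -> row_full a' -> row_free b -> row_free b' -> b *m a = b' *m a' ->
  exists2 g, g \in unitmx & g *m a = a' /\ b' *m g = b.
Proof.
move=> fa fa' fb fb' ba.
have [h uh bh] := free_extend fb' fb.
pose a'' := invmx h *m a'.
have fa'' : row_full a''.
  case/row_fullP: fa' => c ca; apply/row_fullP; exists (c *m h).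
  by rewrite /a'' mulmxA mulmxK.
(* Once [h] has matched [b'] with [b], only the stabilizer of [b] is left to act; transposed, this
   is [free_pair_trans]. *)
have [k uk [kb ak]] : exists2 k, k \in unitmx & k *m b^T = b^T /\ a^T *m k = a''^T.
  apply: free_pair_trans; rewrite -?row_full_tr ?trmxK //.
  - by rewrite /row_free mxrank_tr; exact: fa.
  - by rewrite /row_free mxrank_tr; exact: fa''.
  - by rewrite /row_full mxrank_tr; exact: fb.
  by rewrite -!trmx_mul ba /a'' -bh -!mulmxA mulKVmx.
exists (h *m k^T); first by rewrite unitmx_mul uh unitmx_tr.
split; last by rewrite mulmxA bh -[b]trmxK -trmx_mul kb.
by rewrite -mulmxA -[a]trmxK -trmx_mul ak trmxK /a'' mulKVmx.
Qed.

(** Uniqueness of a full rank factorization: a left inverse of [a] provides the comparison matrix,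
    invertible because [b] is free. *)
Lemma full_factor_uniq r n (a a' : 'M[F]_(n, r)) (b b' : 'M_(r, n)) :
  row_full a -> row_free b -> row_free b' -> a *m b = a' *m b' ->
  exists2 g, g \in unitmx & a' *m g = a /\ b' = g *m b.
Proof.
move=> /row_fullP[c ca] fb /row_freeP[d bd] ab.
pose h := c *m a'.
have bE : b = h *m b' by rewrite /h -mulmxA -ab mulmxA ca mul1mx.
have uh : h \in unitmx.
  rewrite -row_free_unit /row_free eqn_leq rank_leq_row.
  by move: fb; rewrite /row_free => /eqP {1}<-; rewrite bE mxrankM_maxl.
have ah : a *m h = a'.
  by rewrite -[h]mulmx1 -bd (mulmxA h) -bE mulmxA ab -mulmxA bd mulmx1.
exists (invmx h); first by rewrite unitmx_inv.
by split; [rewrite -ah mulmxK|rewrite bE mulKmx].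
Qed.

End Pairs.

Section Legs.
Variables (F : fieldType) (m : nat) (R : 'M[F]_m) (xi : seq F).
Hypothesis xi_gt0 : (0 < size xi)%N.
Hypothesis xi_ann : \prod_(c <- xi) (R - c%:M) = 0.

(** Level 0 is the block that carries [R]; level [l.+1] is the vertex of index [l] of the leg. *)
Definition legdim (l : nat) : nat :=
  if l is l'.+1 then \rank (\prod_(c <- take l (xi : seq F)) (R - c%:M)) else m.

(** Acting on columns, [a] is injective and [b] surjective; the equation is the moment map condition
    along the leg. *)
Definition isleg (a : forall l, 'M[F]_(legdim l, legdim l.+1))
    (b : forall l, 'M[F]_(legdim l.+1, legdim l)) : Prop :=
  [/\ forall l, row_full (a l), forall l, row_free (b l) &
      forall l, a l.+1 *m b l.+1 - b l *m a l = (xi`_l - xi`_l.+1)%:M].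

Lemma legdim0 l : (size xi <= l)%N -> legdim l = 0%N.
Proof.
case: l => [|l] le; first by move: xi_gt0; rewrite ltnNge le.
by rewrite /= take_oversize // xi_ann mxrank0.
Qed.

Lemma legdim0_eq l (dl : legdim l = 0%N) n (M N : 'M[F]_(legdim l, n)) : M = N.
Proof.
by apply/matrixP => i; have : (i < 0)%N by rewrite -dl ltn_ord.
Qed.

Lemma legdim0_eqr l (dl : legdim l = 0%N) n (M N : 'M[F]_(n, legdim l)) : M = N.
Proof.
by apply/matrixP => j i; have : (i < 0)%N by rewrite -dl ltn_ord.
Qed.

(** With [P l] the product of the first [l] factors, level [l] is the image of [P l]: [a] is the
    inclusion of the next image and [b] the action of [R] minus the [l]-th scalar. *)
Lemma isleg_exists : exists a b, isleg a b /\ R = (xi`_0)%:M + a 0%N *m b 0%N.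
Proof.
pose P l := \prod_(c <- take l xi) (R - c%:M).
have comm c (s : seq F) : (R - c%:M) *m \prod_(c <- s) (R - c%:M) =
    (\prod_(c <- s) (R - c%:M)) *m (R - c%:M).
  have cR (A : 'M[F]_m) d : GRing.comm A d%:M by rewrite /GRing.comm -!mulmxE scalar_mxC.
  apply: commr_prod => d _.
  by apply: commrB; [apply/commr_sym; apply: commrB => //|exact: cR].
have PSr l : P l.+1 = P l *m (R - (xi`_l)%:M).
  case: (ltnP l (size xi)) => lx.
    by rewrite /P (take_nth 0 lx) -cats1 big_cat /= big_seq1.
  by rewrite /P !take_oversize ?leqW // xi_ann mul0mx.
have PS l : P l.+1 = (R - (xi`_l)%:M) *m P l by rewrite PSr comm.
(* Rank factorizations of the [P l]; at level 0 the identity is taken, so that [a 0%N *m b 0%N] acts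
   on the original space without change of basis. *)
pose C l : 'M[F]_(m, legdim l) :=
  match l return 'M[F]_(m, legdim l) with 0 => 1%:M | l'.+1 => col_base (P l'.+1) end.
pose D l : 'M[F]_(legdim l, m) :=
  match l return 'M[F]_(legdim l, m) with 0 => 1%:M | l'.+1 => row_base (P l'.+1) end.
have CD l : C l *m D l = P l.
  case: l => [|l]; first by rewrite mulmx1 /P take0 big_nil.
  by rewrite /= mulmx_base.
have fC l : row_full (C l).
  by case: l => [|l]; rewrite ?row_full_unit ?unitmx1 // col_base_full.
have fD l : row_free (D l).
  by case: l => [|l]; rewrite ?row_free_unit ?unitmx1 // row_base_free.
have C0 : C 0%N = 1%:M by [].
move: C D CD fC fD C0 => C D CD fC fD C0; clearbody P.
have Cinj l n (X Y : 'M_(_, n)) : C l *m X = C l *m Y -> X = Y.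
  by case/row_fullP: (fC l) => c cC /(congr1 (mulmx c)); rewrite !mulmxA cC !mul1mx.
pose a l := D l *m (R - (xi`_l)%:M) *m pinvmx (D l.+1).
pose b l := D l.+1 *m pinvmx (D l).
have aC l : C l *m a l = C l.+1.
  have -> : C l *m a l = P l.+1 *m pinvmx (D l.+1) by rewrite PSr -CD /a !mulmxA.
  by rewrite -CD -mulmxA mulmxVp ?mulmx1.
have bC l : C l.+1 *m b l = (R - (xi`_l)%:M) *m C l.
  by rewrite /b mulmxA CD PS -(CD l) -!mulmxA (mulmxVp (fD l)) mulmx1.
move: a b aC bC => a b aC bC.
exists a, b; split; last first.
  have := bC 0%N; rewrite -aC C0 !mul1mx mulmx1 => ->.
  by rewrite addrC subrK.
split=> l.
- case/row_fullP: (fC l.+1) => c cC; apply/row_fullP; exists (c *m C l).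
  by rewrite -mulmxA aC.
- have bD : b l *m D l = D l.+1 by apply: (@Cinj l.+1); rewrite mulmxA bC -mulmxA !CD PS.
  case/row_freeP: (fD l.+1) => w Dw; apply/row_freeP; exists (D l *m w).
  by rewrite mulmxA bD.
- apply: (@Cinj l.+1); rewrite mulmxBr !mulmxA aC !bC -mulmxA aC -mulmxBl.
  rewrite scalar_mxC raddfB /=; congr (_ *m _).
  by rewrite opprK addrACA subrr add0r addrC [RHS]raddfB.
Qed.

(** All dimensions vanish at the far end, so the isomorphism is built from there towards level 0:
    the equation of the leg makes the products [b l *m a l] conjugate, and [full_pair_conj] lifts
    this to the pairs. *)
Lemma isleg_iso a b a' b' : isleg a b -> isleg a' b' ->
  exists g : forall l, 'M[F]_(legdim l), [/\ forall l, g l \in unitmx,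
    forall l, a' l = g l *m a l *m invmx (g l.+1) &
    forall l, b' l = g l.+1 *m b l *m invmx (g l)].
Proof.
case=> fa fb ab [fa' fb' ab'].
suff key k : exists g : forall l, 'M[F]_(legdim l), (forall l, g l \in unitmx) /\
    forall l, (size xi <= l + k)%N ->
      a' l = g l *m a l *m invmx (g l.+1) /\ b' l = g l.+1 *m b l *m invmx (g l).
  have [g [ug gP]] := key (size xi).
  by exists g; split=> // l; case: (gP l (leq_addl _ _)).
elim: k => [|k [g [ug gP]]].
  exists (fun l => 1%:M); split=> l; first exact: unitmx1.
  rewrite addn0 => le; split; [exact: legdim0_eq (legdim0 le) _ _ _|].
  exact: legdim0_eqr (legdim0 le) _ _ _.
case: (leqP (size xi) k) => [xk|kx].
  by exists g; split=> // l le; apply: gP; rewrite (leq_trans xk) // leq_addl.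
pose l0 := (size xi - k.+1)%N.
have l0S : (size xi <= l0.+1 + k)%N by rewrite /l0; clear -kx; lia.
have [ag bg] := gP l0.+1 l0S.
have ug1 := ug l0.+1; have ug2 := ug l0.+2.
have [h uh [ha hb]] : exists2 h, h \in unitmx & h *m a l0 = a' l0 *m g l0.+1 /\
    (invmx (g l0.+1) *m b' l0) *m h = b l0.
  apply: full_pair_conj => //.
  - case/row_fullP: (fa' l0) => c ca; apply/row_fullP; exists (invmx (g l0.+1) *m c).
    by rewrite -mulmxA (mulmxA c) ca mul1mx mulVmx.
  - case/row_freeP: (fb' l0) => c bc; apply/row_freeP; exists (c *m g l0.+1).
    by rewrite -mulmxA (mulmxA (b' l0)) bc mul1mx mulVmx.
  have -> : b l0 *m a l0 = a l0.+1 *m b l0.+1 - (xi`_l0 - xi`_l0.+1)%:M.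
    by rewrite -ab opprB addrC subrK.
  have b'a' : b' l0 *m a' l0 = a' l0.+1 *m b' l0.+1 - (xi`_l0 - xi`_l0.+1)%:M.
    by rewrite -ab' opprB addrC subrK.
  rewrite -mulmxA (mulmxA (b' l0)) b'a' ag bg mulmxBl mulmxBr.
  have -> : g l0.+1 *m a l0.+1 *m invmx (g l0.+2) *m (g l0.+2 *m b l0.+1 *m invmx (g l0.+1)) =
    g l0.+1 *m (a l0.+1 *m b l0.+1) *m invmx (g l0.+1).
    by rewrite !mulmxA mulmxKV.
  by rewrite (mulmxKV ug1) (mulKmx ug1) -scalar_mxC (mulKmx ug1).
exists (dfwith g h); split=> [l|l le].
  by case: dfwithP => //.
have [ll0|nl] := eqVneq l0 l.
  subst l; rewrite dfwith_in dfwith_out ?neq_ltn ?ltnSn //.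
  rewrite ha mulmxK //; split=> //; rewrite -hb -!mulmxA mulmxV // mulmx1 mulKVmx //.
have l0l : (l0 < l)%N by rewrite /l0 in nl *; clear -le nl kx; lia.
rewrite !dfwith_out // ?neq_ltn ?(leqW l0l) ?l0l //.
by apply: gP; rewrite /l0 in l0l; clear -l0l kx; lia.
Qed.

(** Opposite direction to [isleg_iso]: [h] is prescribed at level 0 and extended outwards, each
    [a k *m b k] being a full rank factorization. *)
Lemma isleg_uniq a b a' b' h : isleg a b -> isleg a' b' -> h \in unitmx ->
  a' 0%N *m b' 0%N = h *m (a 0%N *m b 0%N) *m invmx h ->
  exists g : forall l, 'M[F]_(legdim l), [/\ g 0%N = h, forall l, g l \in unitmx,
    forall l, a' l = g l *m a l *m invmx (g l.+1) &
    forall l, b' l = g l.+1 *m b l *m invmx (g l)].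
Proof.
case=> fa fb ab [fa' fb' ab'] uh ab0.
suff key k : exists g : forall l, 'M[F]_(legdim l), [/\ g 0%N = h, (forall l, g l \in unitmx) &
    forall l, (l < k)%N ->
      a' l = g l *m a l *m invmx (g l.+1) /\ b' l = g l.+1 *m b l *m invmx (g l)].
  have [g [g0 ug gP]] := key (size xi); exists g; split=> // l.
    have [/gP[]//|le] := ltnP l (size xi).
    exact: legdim0_eq (legdim0 le) _ _ _.
  have [/gP[]//|le] := ltnP l (size xi).
  exact: legdim0_eqr (legdim0 le) _ _ _.
elim: k => [|k [g [g0 ug gP]]].
  exists (@dfwith _ (fun l => 'M[F]_(legdim l)) (fun l => 1%:M) 0%N h); split=> [|l|//].
    by rewrite dfwith_in.
  by case: dfwithP => // l' _; exact: unitmx1.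
have abk : a' k *m b' k = g k *m (a k *m b k) *m invmx (g k).
  case: k gP => [|k] gP; first by rewrite g0.
  have [ak bk] := gP k (ltnSn k).
  have -> : a' k.+1 *m b' k.+1 = b' k *m a' k + (xi`_k - xi`_k.+1)%:M by rewrite -ab' addrC subrK.
  have -> : a k.+1 *m b k.+1 = b k *m a k + (xi`_k - xi`_k.+1)%:M by rewrite -ab addrC subrK.
  have ugk := ug k; have ugk1 := ug k.+1.
  rewrite ak bk mulmxDr mulmxDl; congr (_ + _).
    by rewrite !mulmxA mulmxKV.
  by rewrite scalar_mxC mulmxK.
have ugk := ug k.
have [h' uh' [ah bh]] : exists2 h', h' \in unitmx &
    a' k *m h' = g k *m a k /\ b' k = h' *m (b k *m invmx (g k)).
  apply: full_factor_uniq => //.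
  - case/row_fullP: (fa k) => c ca; apply/row_fullP; exists (c *m invmx (g k)).
    by rewrite -mulmxA (mulKmx ugk).
  - case/row_freeP: (fb k) => c bc; apply/row_freeP; exists (g k *m c).
    by rewrite -mulmxA (mulKmx ugk).
  by rewrite abk !mulmxA.
exists (dfwith g h'); split=> [|l|l lk].
- by rewrite dfwith_out.
- by case: dfwithP.
have [kl|nl] := eqVneq k l.
  subst l; rewrite dfwith_in dfwith_out ?gtn_eqF // -ah mulmxK //; split=> //.
  by rewrite bh mulmxA.
have lk' : (l < k)%N by rewrite ltn_neqAle eq_sym nl -ltnS.
rewrite dfwith_out ?gtn_eqF // dfwith_out ?gtn_eqF //; exact: gP.
Qed.

(** Every leg is isomorphic to the one built from [R], which gives back [R] at level 0. *)
Lemma isleg_conj a b : isleg a b ->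
  exists2 h, h \in unitmx & (xi`_0)%:M + a 0%N *m b 0%N = h *m R *m invmx h.
Proof.
move=> ab; have [a' [b' [ab' ->]]] := isleg_exists.
have [g [ug ga gb]] := isleg_iso ab' ab; exists (g 0%N); first exact (ug 0%N).
have ug0 := ug 0%N; have ug1 := ug 1%N.
rewrite mulmxDr mulmxDl scalar_mxC mulmxK //; congr (_ + _).
by rewrite ga gb !mulmxA mulmxKV.
Qed.

End Legs.

From mathcomp Require Import qpoly complex.
From mathcomp Require Import boolp classical_sets functions reals.

(** * Blocks *)

Section Blocks.
Variables (F : fieldType) (N n : nat) (s : 'I_N -> nat) (e : (\sum_(j < N) s j)%N = n).

Definition binc j : 'M[F]_(n, s j) := castmx (e, erefl) (submxrow 1%:M j).
Definition bproj j : 'M[F]_(s j, n) := castmx (erefl, e) (submxcol 1%:M j).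

Lemma bproj_binc j : bproj j *m binc j = 1%:M.
Proof.
rewrite /bproj /binc; case: _ / e; rewrite !castmx_id submxcol_mul mul1mx.
apply/matrixP => a b; rewrite !mxE; congr (_%:R); congr nat_of_bool.
by rewrite -val_eqE /= order.tagnat.eq_Rank eqxx.
Qed.

Lemma bproj_binc0 j j' : j != j' -> bproj j *m binc j' = 0.
Proof.
move=> jj'; rewrite /bproj /binc; case: _ / e; rewrite !castmx_id submxcol_mul mul1mx.
by apply/matrixP => a b; rewrite !mxE -val_eqE /= order.tagnat.eq_Rank (negPf jj').
Qed.

Lemma sum_binc_bproj : \sum_j binc j *m bproj j = 1%:M.
Proof.
rewrite /bproj /binc; case: _ / e.
rewrite (eq_bigr (fun j => submxrow 1%:M j *m submxcol 1%:M j)) => [|j _].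
  by rewrite -mul_mxrow_mxcol submxrowK submxcolK mul1mx.
by rewrite !castmx_id.
Qed.

End Blocks.

Lemma bproj_block (F : fieldType) (N N' n n' : nat) (s : 'I_N -> nat) (s' : 'I_N' -> nat)
    (e : (\sum_(j < N) s j)%N = n) (e' : (\sum_(j < N') s' j)%N = n')
    (M : forall i j, 'M[F]_(s i, s' j)) i j :
  bproj F e i *m castmx (e, e') (mxblock M) *m binc F e' j = M i j.
Proof.
rewrite /bproj /binc; case: _ / e; case: _ / e'; rewrite !castmx_id.
rewrite submxcol_mul mul1mx mul_submxrow mulmx1.
by apply/matrixP => a b; rewrite -[in RHS](mxblockK M) !mxE.
Qed.

(** * Principal parts as polynomials with matrix coefficients *)

Section PrincipalParts.
Variables (F : fieldType) (n k : nat).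
Hypothesis k_gt0 : (0 < k)%N.
Local Notation M := 'M[F]_n.+1.

(** The principal part times z^k; its residue becomes the coefficient of degree [k.-1]. *)
Definition pp (A : ppart F n.+1 k) : {poly M} := \sum_(l < k) (A l)%:P * 'X^(k - l.+1).

Lemma pp_coef A (l : 'I_k) : (pp A)`_(k - l.+1) = A l.
Proof.
rewrite coef_sum (bigD1 l) //= coefCM coefXn eqxx mulr1 big1 ?addr0 // => i il.
rewrite coefCM coefXn; case: eqP => [/eqP|]; last by rewrite mulr0.
move=> e; case/eqP: il; apply/val_inj => /=.
by have := ltn_ord i; have := ltn_ord l; clear -e; lia.
Qed.

Definition entry (p : {poly M}) a b : {poly F} := \poly_(i < size p) (p`_i a b).

Lemma entry_coef p a b i : (entry p a b)`_i = p`_i a b.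
Proof. by rewrite coef_poly; case: ltnP => // le; rewrite nth_default // mxE. Qed.

(** Identifies polynomials over matrices modulo ['X^k] with matrices over the truncated ring. *)
Definition phi (p : {poly M}) : 'M[tpoly F k]_n.+1 :=
  \matrix_(a, b) in_qpoly ('X^k : {poly F}) (entry p a b).

Lemma phiM p q : phi (p * q) = phi p *m phi q.
Proof.
apply/matrixP => a b; rewrite !mxE.
under eq_bigr do rewrite !mxE -rmorphM.
rewrite -rmorph_sum /=; congr in_qpoly; apply/polyP => i.
rewrite entry_coef coefM coef_sum summxE.
under [RHS]eq_bigr do rewrite coefM.
rewrite exchange_big; apply: eq_bigr => j _ /=.
by rewrite mxE; apply: eq_bigr => c _; rewrite !entry_coef.
Qed.

Lemma phi1 : phi 1 = 1%:M.
Proof.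
apply/matrixP => a b; rewrite !mxE -(rmorph_nat (in_qpoly ('X^k : {poly F}))).
congr in_qpoly; apply/polyP => i; rewrite entry_coef coef1 -polyC_natr coefC.
by case: (i == 0)%N; rewrite !mxE.
Qed.

Lemma in_qpoly_Xn (f : {poly F}) : (in_qpoly ('X^k : {poly F}) f : {poly F}) = take_poly k f.
Proof.
rewrite /= mk_monic_Xn prednK //.
have := poly_take_drop k f => {1}<-.
rewrite addrC -Pdiv.IdomainMonic.modpE ?monicXn //.
by rewrite modp_addl_mul_small // size_polyXn ltnS size_take_poly.
Qed.

Lemma phi_eq p q : phi p = phi q <-> eqm k p q.
Proof.
split=> [/matrixP e i ik|e].
  apply/matrixP => a b; have := e a b; rewrite !mxE => /(congr1 (fun f : tpoly F k => (f : {poly F})`_i)).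
  by rewrite !in_qpoly_Xn !coef_take_poly ik !entry_coef.
apply/matrixP => a b; rewrite !mxE; apply/val_inj; rewrite [LHS]in_qpoly_Xn [RHS]in_qpoly_Xn.
apply/polyP => i; rewrite !coef_take_poly; case: ifP => // ik.
by rewrite !entry_coef e.
Qed.

Lemma phi_surj g : exists p, phi p = g.
Proof.
exists (\poly_(i < k) (\matrix_(a, b) (g a b : {poly F})`_i)).
apply/matrixP => a b; rewrite mxE; apply/val_inj; rewrite [LHS]in_qpoly_Xn.
apply/polyP => i; rewrite coef_take_poly entry_coef coef_poly.
case: ltnP => ik; first by rewrite mxE.
rewrite nth_default //; apply: leq_trans ik.
by apply: leq_trans (size_npoly _) _; rewrite mk_monic_Xn prednK // size_polyXn.
Qed.

Lemma phi_pp A : phi (pp A) = clear_pole A.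
Proof.
apply/matrixP => a b; rewrite !mxE; congr in_qpoly; apply/polyP => i.
rewrite entry_coef !coef_sum summxE; apply: eq_bigr => l _.
by rewrite coefCM coefZ !coefXn; case: eqP; rewrite ?mulr1 ?mulr0 // mxE.
Qed.

(** A matrix over the truncated ring is invertible exactly when its constant coefficient is, by
    [poly_inv]. *)
Lemma torbitP (B A : ppart F n.+1 k) : torbit B A <->
  exists g : {poly M}, g`_0 \is a GRing.unit /\ eqm k (pp A * g) (g * pp B).
Proof.
split=> [[g ug AB]|[p [up e]]].
  have [p pg] := phi_surj g; move: ug AB; rewrite -pg => ug AB.
  have [q qE] := phi_surj (invmx (phi p)).
  have pq : eqm k (p * q) 1 by apply/phi_eq; rewrite phiM qE phi1 mulmxV.
  have qp : eqm k (q * p) 1 by apply/phi_eq; rewrite phiM qE phi1 mulVmx.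
  exists p; split.
    have := pq 0%N k_gt0; have := qp 0%N k_gt0; rewrite !coefM !big_ord1 !coef1 /= => qp0 pq0.
    by apply/unitrP; exists q`_0.
  by apply/phi_eq; rewrite !phiM !phi_pp AB mulmxKV.
have [q [pq qp]] := poly_inv k (mulrV up) (mulVr up).
have pqE : phi p *m phi q = 1%:M by rewrite -phiM -phi1; apply/phi_eq.
have [uphi _] := mulmx1_unit pqE.
exists (phi p) => //.
rewrite -!phi_pp -phiM; have /phi_eq <- := e; rewrite phiM.
by rewrite mulmxK.
Qed.

End PrincipalParts.

(** * The local normal form at one pole *)

Section LocalNormalForm.
Variables (F : fieldType) (n k : nat).
Hypothesis k_gt0 : (0 < k)%N.
Local Notation M := 'M[F]_n.+1.
Variable B : htl F n.+1 k.
Local Notation J := 'I_(nblk B).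

Definition hinc (j : J) : 'M[F]_(n.+1, bsize B j) := binc F (bsize_sum B) j.
Definition hproj (j : J) : 'M[F]_(bsize B j, n.+1) := bproj F (bsize_sum B) j.
Definition bidem (j : J) : M := hinc j *m hproj j.
(** This is z^k q_j(1/z); the separating degrees of the tree refer to it. *)
Definition revpoly (j : J) : {poly F} := \poly_(i < k) (bpoly B j)`_(k - i).
Definition fullres : M := \sum_j hinc j *m bres B j *m hproj j.

Lemma hprojK j : hproj j *m hinc j = 1%:M. Proof. exact: bproj_binc. Qed.
Lemma hproj0 j j' : j != j' -> hproj j *m hinc j' = 0. Proof. exact: bproj_binc0. Qed.
Lemma bidem_orth j j' : bidem j * bidem j' = if j == j' then bidem j else 0.
Proof.
rewrite /bidem -mulmxE mulmxA -(mulmxA (hinc j)).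
case: eqP => [<-|/eqP ne]; first by rewrite hprojK mulmx1.
by rewrite hproj0 // mulmx0 mul0mx.
Qed.
Lemma bidem_sum : \sum_j bidem j = 1. Proof. exact: sum_binc_bproj. Qed.
Lemma EE_setT : EE bidem [set: J] = 1.
Proof. by rewrite /EE -bidem_sum; apply: eq_bigl => j; rewrite inE. Qed.
Lemma hproj_idem j : hproj j *m bidem j = hproj j.
Proof. by rewrite mulmxA hprojK mul1mx. Qed.
Lemma hproj_full j : hproj j *m fullres *m hinc j = bres B j.
Proof.
rewrite mulmx_sumr mulmx_suml (bigD1 j) //= big1 ?addr0 => [|i ij].
  by rewrite !mulmxA hprojK mul1mx -mulmxA hprojK mulmx1.
by rewrite !mulmxA hproj0 ?mul0mx // eq_sym.
Qed.

Lemma bpoly_coef0 j i : (i < 2)%N -> (bpoly B j)`_i = 0.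
Proof.
have /Pdiv.Field.dvdpP [q ->] := bpoly_ord j.
by move=> i2; rewrite coefMXn i2.
Qed.

Lemma revpoly_res j : (revpoly j)`_k.-1 = 0.
Proof.
rewrite coef_poly; case: ifP => // _; apply: bpoly_coef0.
by clear -k_gt0; lia.
Qed.

Lemma revpoly_coef j i : (i <= k)%N -> (0 < i)%N -> (revpoly j)`_(k - i) = (bpoly B j)`_i.
Proof.
by move=> ik i0; rewrite coef_poly subKn // ifT //; clear -ik i0; lia.
Qed.

Lemma bpoly_big j i : (k < i)%N -> (bpoly B j)`_i = 0.
Proof. by move=> ki; rewrite nth_default //; apply: leq_trans ki; exact: bpoly_deg. Qed.

(** Only degrees from 2 to [k] occur in q_j, and reversal sends them to the degrees below [k.-1]. *)
Lemma revpoly_sep j j' : j != j' -> ~ eqm k.-1 (revpoly j) (revpoly j').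
Proof.
move=> /eqP ne e; apply: ne; apply: (@bpoly_inj _ _ _ B); apply/polyP => i.
have [i2|i2] := ltnP i 2; first by rewrite !bpoly_coef0.
have [ki|ik] := ltnP k i; first by rewrite !bpoly_big.
have i0 : (0 < i)%N by clear -i2; lia.
by rewrite -!revpoly_coef //; apply: e; clear -i2 ik; lia.
Qed.

Lemma htl_block (l : 'I_k) : htl_ppart B l =
  \sum_j (bpoly B j)`_l.+1 *: bidem j + (if l == 0%N :> nat then fullres else 0).
Proof.
set X := RHS.
have fr j j' : j != j' -> hproj j *m fullres *m hinc j' = 0.
  move=> ne; rewrite mulmx_sumr mulmx_suml big1 // => i _.
  case: (eqVneq j i) => [<-|ji]; last by rewrite !mulmxA hproj0 ?mul0mx.
  by rewrite -!mulmxA hproj0 ?mulmx0.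
have hb j : hproj j *m (\sum_j (bpoly B j)`_l.+1 *: bidem j) = (bpoly B j)`_l.+1 *: hproj j.
  rewrite mulmx_sumr (bigD1 j) //= big1 ?addr0 => [|i ij].
    by rewrite -scalemxAr hproj_idem.
  by rewrite -scalemxAr /bidem mulmxA hproj0 ?mul0mx ?scaler0 // eq_sym.
have XE1 j : hproj j *m X *m hinc j =
    ((bpoly B j)`_l.+1)%:M + (if l == 0%N :> nat then bres B j else 0).
  rewrite /X mulmxDr mulmxDl hb -scalemxAl hprojK scalemx1; congr (_ + _).
  by case: ifP => _; rewrite ?hproj_full // mulmx0 mul0mx.
have XE0 j j' : j != j' -> hproj j *m X *m hinc j' = 0.
  move=> ne; rewrite /X mulmxDr mulmxDl hb -scalemxAl hproj0 // scaler0 add0r.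
  by case: ifP => _; rewrite ?fr // mulmx0 mul0mx.
have dec (Y : M) : Y = \sum_j \sum_j' hinc j *m (hproj j *m Y *m hinc j') *m hproj j'.
  rewrite -[LHS]mul1r -[LHS]mulr1 -{1 2}bidem_sum mulr_suml mulr_suml.
  apply: eq_bigr => j _; rewrite mulr_sumr; apply: eq_bigr => j' _.
  by rewrite /bidem -!mulmxE !mulmxA.
rewrite (dec (htl_ppart B l)) (dec X); apply: eq_bigr => j _; apply: eq_bigr => j' _.
congr (_ *m _ *m _); rewrite /htl_ppart /mxdiag bproj_block.
by case: eqVneq => [<-|/XE0 -> //]; rewrite conform_mx_id XE1.
Qed.

Lemma pp_htl : pp (htl_ppart B) = Tdiag bidem revpoly [set: J]%SET + fullres%:P * 'X^(k.-1).
Proof.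
apply/polyP => i; have [ik|ki] := ltnP i k; last first.
  rewrite coef_sum big1 => [|l _]; last first.
    rewrite coefCM coefXn; case: eqP => [e|]; rewrite ?mulr0 //.
    by have := ltn_ord l; clear -e ki; lia.
  rewrite coefD Tdiag_coef big1 => [|j _]; last by rewrite coef_poly ltnNge ki /= scale0r.
  rewrite coefCM coefXn; case: eqP => [e|]; rewrite ?mulr0 ?addr0 //.
  by clear -e ki k_gt0; lia.
have lk : (k - i.+1 < k)%N by clear -ik; lia.
pose l := Ordinal lk.
have -> : i = (k - l.+1)%N by rewrite /=; clear -ik; lia.
rewrite pp_coef htl_block coefD Tdiag_coef coefCM coefXn.
have -> : ((k - l.+1)%N == k.-1) = (l == 0%N :> nat).
  by apply/eqP/eqP => /= h; clear -h ik; lia.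
congr (_ + _); last by case: ifP => _; rewrite ?mulr1 ?mulr0.
rewrite [RHS](eq_bigl xpredT) => [|j]; last by rewrite inE.
by apply: eq_bigr => j _; rewrite revpoly_coef.
Qed.

Variable t : btree J.
Hypothesis wt : wf_tree revpoly t.
Hypothesis lt : leaves t = [set: J]%SET.
Local Notation Y := (fun x => Yhat bidem k revpoly x t).

Lemma conj_coef (g h : M) (p : {poly M}) i : (g%:P * p * h%:P)`_i = g * p`_i * h.
Proof. by rewrite coefMC coefCM. Qed.

Lemma torbit_fwd A : torbit (htl_ppart B) A ->
  exists g : M, exists x, [/\ g \in unitmx,
    eqm k.-1 (pp A) (g%:P * Y x * (invmx g)%:P) &
    forall j, bidem j * (invmx g * (pp A)`_k.-1 * g - (Y x)`_k.-1) * bidem j =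
              bidem j * fullres * bidem j].
Proof.
case/(torbitP k_gt0) => G [uG GP].
have ug : G`_0 \in unitmx by [].
rewrite pp_htl in GP.
have gg : G`_0 * invmx G`_0 = 1 := mulmxV ug.
have ggi : invmx G`_0 * G`_0 = 1 := mulVmx ug.
have [x [AY AE]] := conj_orb_fwd k_gt0 bidem_orth revpoly_sep wt lt EE_setT
  gg ggi (erefl _) GP.
by exists G`_0, x.
Qed.

Lemma torbit_bwd A (g h : M) x : g \in unitmx -> h \in unitmx ->
  (forall j, h * bidem j = bidem j * h) ->
  eqm k.-1 (pp A) (g%:P * Y x * (invmx g)%:P) ->
  (forall j, bidem j * (invmx g * (pp A)`_k.-1 * g - (Y x)`_k.-1) * bidem j =
             bidem j * (h * fullres * invmx h) * bidem j) ->
  torbit (htl_ppart B) A.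
Proof.
move=> ug uh hE AY AE; apply/(torbitP k_gt0).
have gg : g * invmx g = 1 := mulmxV ug.
have ggi : invmx g * g = 1 := mulVmx ug.
have hh : invmx h * h = 1 := mulVmx uh.
have [G [G0 GP]] := conj_orb_bwd k_gt0 bidem_orth revpoly_sep wt lt EE_setT
  gg ggi hh hE AY AE.
exists G; rewrite pp_htl; split=> //.
by rewrite G0; have : g * h \in unitmx by rewrite unitmx_mul ug.
Qed.

End LocalNormalForm.

(** * Column spaces and traces *)

Section ColumnSpaces.
Variable F : fieldType.

(** The rank predicates speak of row spaces while matrices act on columns: injective means
    [row_full] and surjective means [row_free]. *)
Lemma row_full_inj m n (a : 'M[F]_(m, n)) :
  (forall v : 'cV_n, a *m v = 0 -> v = 0) -> row_full a.
Proof.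
move=> inj; rewrite /row_full -mxrank_tr -[_ == _]/(row_free a^T) -kermx_eq0.
apply/eqP/row_matrixP => i; rewrite row0; apply: trmx_inj; rewrite trmx0; apply: inj.
by apply: trmx_inj; rewrite trmx_mul trmxK trmx0 -row_mul mulmx_ker row0.
Qed.

Lemma row_full_mul0 m n (a : 'M[F]_(m, n)) (v : 'cV_n) : row_full a -> a *m v = 0 -> v = 0.
Proof. by move=> /row_fullP[c ca] av; rewrite -[v]mul1mx -ca -mulmxA av mulmx0. Qed.

Lemma row_free_surj m n (b : 'M[F]_(m, n)) :
  (forall w : 'cV_m, exists v, b *m v = w) -> row_free b.
Proof.
move=> surj; apply/row_freeP.
exists (\matrix_(i, j) (projT1 (cid (surj (delta_mx j 0)))) i 0).
apply/matrixP => i j; rewrite !mxE.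
have := projT2 (cid (surj (delta_mx j 0))); move/matrixP/(_ i 0); rewrite !mxE !eqxx andbT => <-.
by apply: eq_bigr => s _; rewrite !mxE.
Qed.

Lemma row_free_lift m n (b : 'M[F]_(m, n)) (w : 'cV_m) : row_free b -> exists v, w = b *m v.
Proof. by move=> /row_freeP[c bc]; exists (c *m w); rewrite mulmxA bc mul1mx. Qed.

(** [P] has a basis of [U] as columns; [L *m Z *m P] is then the matrix of the restriction to [U] of
    a map [Z] preserving [U]. *)
Lemma col_space m (U : {vspace 'cV[F]_m}) :
  exists (P : 'M[F]_(m, \dim U)) (L : 'M[F]_(\dim U, m)),
    [/\ L *m P = 1%:M, forall w, P *m w \in U & forall v, v \in U -> v = P *m (L *m v)].
Proof.
pose P : 'M[F]_(m, \dim U) := \matrix_(i, j) (vbasis U)`_j i 0.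
have PE (w : 'cV_(\dim U)) : P *m w = \sum_j w j 0 *: (vbasis U)`_j.
  apply/matrixP => i c; rewrite ord1 !mxE summxE; apply: eq_bigr => j _.
  by rewrite !mxE mulrC.
have ub := vbasisP U.
have Uf : free (vbasis U) := basis_free ub.
have : row_full P.
  apply: row_full_inj => w; rewrite PE => w0; have {}w0 := freeP Uf (fun j => w j 0) w0.
  by apply/matrixP => i j; rewrite ord1 w0 mxE.
case/row_fullP => L LP; exists P, L; split=> // [w|v vU].
  by rewrite PE; apply: memv_suml => j _; apply/memvZ/vbasis_mem/mem_nth; rewrite size_tuple.
have -> : v = P *m (\col_j coord (vbasis U) j v).
  by rewrite PE [LHS](coord_vbasis vU); apply: eq_bigr => j _; rewrite mxE.
by rewrite (mulmxA L) LP mul1mx.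
Qed.

Lemma mem_preim_mx m n (a : 'M[F]_(m, n)) (U : {vspace 'cV[F]_m}) v :
  (v \in (linfun (mulmx a : 'cV_n -> 'cV_m) @^-1: U)%VS) = (a *m v \in U).
Proof. by rewrite -memv_preim lfunE. Qed.

Lemma mem_img_mx m n (a : 'M[F]_(m, n)) (U : {vspace 'cV[F]_n}) v :
  v \in U -> a *m v \in (linfun (mulmx a : 'cV_n -> 'cV_m) @: U)%VS.
Proof. by move=> vU; apply/memv_imgP; exists v; rewrite ?lfunE. Qed.

Lemma img_mxP m n (a : 'M[F]_(m, n)) (U : {vspace 'cV[F]_n}) w :
  w \in (linfun (mulmx a : 'cV_n -> 'cV_m) @: U)%VS -> exists2 v, v \in U & w = a *m v.
Proof. by case/memv_imgP => v vU ->; exists v; rewrite ?lfunE. Qed.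

Lemma dim_img_mx m n (a : 'M[F]_(m, n)) (U : {vspace 'cV[F]_n}) :
  (forall v : 'cV_n, a *m v = 0 -> v = 0) -> \dim (linfun (mulmx a : 'cV_n -> 'cV_m) @: U) = \dim U.
Proof.
move=> inj; apply: limg_dim_eq; apply/eqP; rewrite -subv0; apply/subvP => v.
by rewrite memv_cap memv_ker lfunE memv0 => /andP[_ /eqP /inj ->].
Qed.

End ColumnSpaces.

(** * Extending a subspace along a leg *)

Section LegExtensions.
Variables (F : fieldType) (D : nat -> nat).
Variables (a : forall l, 'M[F]_(D l, D l.+1)) (b : forall l, 'M[F]_(D l.+1, D l)) (c : nat -> F).
Hypothesis ab : forall l, a l.+1 *m b l.+1 - b l *m a l = (c l)%:M.
Variable U : {vspace 'cV[F]_(D 0)}.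
Hypothesis U_ab : forall v, v \in U -> a 0%N *m b 0%N *m v \in U.

(** The largest stable family on the leg with [U] at level 0; [minext] is the smallest. *)
Fixpoint maxext l : {vspace 'cV[F]_(D l)} :=
  match l with 0 => U | l.+1 => (linfun (mulmx (a l) : 'cV_(D l.+1) -> 'cV_(D l)) @^-1: maxext l)%VS end.

Fixpoint minext l : {vspace 'cV[F]_(D l)} :=
  match l with 0 => U | l.+1 => (linfun (mulmx (b l) : 'cV_(D l) -> 'cV_(D l.+1)) @: minext l)%VS end.

Lemma maxext_a l v : v \in maxext l.+1 -> a l *m v \in maxext l.
Proof. by rewrite mem_preim_mx. Qed.

Lemma abE l : a l.+1 *m b l.+1 = b l *m a l + (c l)%:M.
Proof. by rewrite -ab addrC subrK. Qed.

(** The relation [ab] exchanges [a] and [b] up to a scalar, which reduces the claim to level 0 and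
    [U_ab]. *)
Lemma maxext_b l v : v \in maxext l -> b l *m v \in maxext l.+1.
Proof.
elim: l v => [|l IH] v vl; first by rewrite mem_preim_mx mulmxA U_ab.
rewrite mem_preim_mx mulmxA abE mulmxDl mul_scalar_mx -mulmxA.
by apply: rpredD; [exact/IH/maxext_a|exact: memvZ].
Qed.

Lemma minext_b l v : v \in minext l -> b l *m v \in minext l.+1.
Proof. exact: mem_img_mx. Qed.

Lemma minext_a l v : v \in minext l.+1 -> a l *m v \in minext l.
Proof.
elim: l v => [|l IH] v /img_mxP[u ul ->]; first by rewrite mulmxA U_ab.
rewrite mulmxA abE mulmxDl mul_scalar_mx -mulmxA.
by apply: rpredD; [exact/minext_b/IH|exact: memvZ].
Qed.

End LegExtensions.

Lemma trace_swap (F : fieldType) s t ds dt (x : 'M[F]_(t, s)) (y : 'M_(s, t))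
    (Ps : 'M_(s, ds)) (Ls : 'M_(ds, s)) (Pt : 'M_(t, dt)) (Lt : 'M_(dt, t)) :
  x *m Ps = Pt *m (Lt *m (x *m Ps)) -> y *m Pt = Ps *m (Ls *m (y *m Pt)) ->
  \tr (Lt *m (x *m y) *m Pt) = \tr (Ls *m (y *m x) *m Ps).
Proof.
move=> Px Py; rewrite -!mulmxA Px Py.
by rewrite (mulmxA x) (mulmxA Lt) mxtrace_mulC !mulmxA.
Qed.

Section TraceOfSubrepresentation.
Variables (F : fieldType) (Q : quiver) (alpha : vert Q -> nat).

(** Trace of the moment map equation restricted to [U]: an arrow contributes a trace of x x^* at its
    target and minus a trace of x^* x at its source, and these cancel. *)
Lemma trace_subrep (x : drep F alpha) (mu : vert Q -> F)
    (U : forall a, {vspace 'cV[F]_(alpha a)}) :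
  (forall a, moment x a = (mu a)%:M) ->
  (forall r (v : 'cV[F]_(alpha (@src (Defs.double Q) r))),
     v \in U (@src (Defs.double Q) r) -> x r *m v \in U (@tgt (Defs.double Q) r)) ->
  \sum_a mu a * (\dim (U a))%:R = 0.
Proof.
move=> xmu xU.
pose P a := projT1 (cid (col_space (U a))).
pose L a := projT1 (cid (projT2 (cid (col_space (U a))))).
have PL a : [/\ L a *m P a = 1%:M, forall w, P a *m w \in U a & forall v, v \in U a -> v = P a *m (L a *m v)].
  exact: (projT2 (cid (projT2 (cid (col_space (U a)))))).
have xP r : x r *m P (@src (Defs.double Q) r) = P (@tgt (Defs.double Q) r) *m (L (@tgt (Defs.double Q) r) *m (x r *m P (@src (Defs.double Q) r))).
  apply/matrixP => i j.
  have [_ _ PLt] := PL (@tgt (Defs.double Q) r); have [_ Ps _] := PL (@src (Defs.double Q) r).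
  have := PLt (x r *m (P (@src (Defs.double Q) r) *m delta_mx j 0)) (xU _ _ (Ps _)).
  move=> PLe; suff : col j (x r *m P (@src (Defs.double Q) r)) =
      col j (P (@tgt (Defs.double Q) r) *m (L (@tgt (Defs.double Q) r) *m (x r *m P (@src (Defs.double Q) r)))).
    by move/matrixP/(_ i 0); rewrite !mxE.
  by rewrite !colE -!mulmxA.
pose T a (Z : 'M[F]_(alpha a)) := \tr (L a *m Z *m P a).
have T_sum a (I : finType) (p : pred I) (Z : I -> 'M[F]_(alpha a)) : T a (\sum_(i | p i) Z i) = \sum_(i | p i) T a (Z i).
  by rewrite /T mulmx_sumr mulmx_suml raddf_sum.
have TB a (Z Z' : 'M[F]_(alpha a)) : T a (Z - Z') = T a Z - T a Z'.
  by rewrite /T mulmxBr mulmxBl raddfB.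
have Tmu a : T a (mu a)%:M = mu a * (\dim (U a))%:R.
  by have [LP _ _] := PL a; rewrite /T scalar_mxC -mulmxA LP mulmx1 mxtrace_scalar mulr_natr.
transitivity (\sum_a T a (moment x a)); first by apply: eq_bigr => a _; rewrite xmu Tmu.
under eq_bigr => a _ do rewrite /moment TB !T_sum.
rewrite sumrB.
have cast (f : arrow Q -> vert Q) (Z : forall r, 'M[F]_(alpha (f r))) :
    \sum_a \sum_(r | f r == a) T a (conform_mx (0 : 'M_(alpha a)) (Z r)) = \sum_r T (f r) (Z r).
  rewrite (partition_big f predT) //=; apply: eq_bigr => a _.
  by apply: eq_bigr => r /eqP <-; rewrite conform_mx_id.
rewrite (cast tgt) (cast src) -sumrB big1 // => r _.
have Px := xP (inl r); have Py := xP (inr r); rewrite /= in Px Py.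
by apply/eqP; rewrite subr_eq0; apply/eqP/trace_swap.
Qed.

End TraceOfSubrepresentation.

(** * Representations of the quiver *)

Section DependentSums.
Variable V : zmodType.

Lemma sum_sig2 (A : finType) (J : A -> finType) (g : {a : A & J a} -> V)
    (h : forall a, J a -> V) :
  (forall a j, g (existT _ a j) = h a j) ->
  \sum_s g s = \sum_a \sum_j h a j.
Proof. by move=> gh; rewrite sig_big_dep; apply: eq_bigr => -[a j] _; rewrite gh. Qed.

Lemma sum_sig3 (A : finType) (J : A -> finType) (K : forall a, J a -> finType)
    (g : {a : A & {j : J a & K a j}} -> V) (h : forall a j, K a j -> V) :
  (forall a j c, g (existT _ a (existT _ j c)) = h a j c) ->
  \sum_s g s = \sum_a \sum_j \sum_c h a j c.
Proof.
move=> gh; rewrite (@sum_sig2 A (fun a => {j : J a & K a j} : finType) g (fun a s => g (existT _ a s))) //.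
by apply: eq_bigr => a _; apply: sum_sig2 => j c.
Qed.

Lemma sum_sigX2 (A : finType) (J K : A -> finType)
    (g : {a : A & (J a * K a)%type} -> V) (h : forall a, J a -> K a -> V) :
  (forall a j c, g (existT _ a (j, c)) = h a j c) ->
  \sum_s g s = \sum_a \sum_j \sum_c h a j c.
Proof.
move=> gh; rewrite (@sum_sig2 A (fun a => (J a * K a)%type : finType) g (fun a u => h a u.1 u.2)) => [|a [j c]] //.
by apply: eq_bigr => a _; rewrite pair_big.
Qed.

Lemma sum_sigX3 (A : finType) (J K L : A -> finType)
    (g : {a : A & (J a * (K a * L a))%type} -> V) (h : forall a, J a -> K a -> L a -> V) :
  (forall a j c l, g (existT _ a (j, (c, l))) = h a j c l) ->
  \sum_s g s = \sum_a \sum_j \sum_c \sum_l h a j c l.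
Proof.
move=> gh; rewrite (@sum_sigX2 A J (fun a => (K a * L a)%type : finType) g
  (fun a j u => h a j u.1 u.2)) => [|a j [c l]] //.
by apply: eq_bigr => a _; apply: eq_bigr => j _; rewrite pair_big.
Qed.

Lemma sum_sub (T : finType) (P : pred T) (f : forall x, P x -> V) :
  \sum_(s : {x | P x}) f (sval s) (proj2_sig s) =
  \sum_x \sum_(u : {_ : unit | P x}) f x (proj2_sig u).
Proof.
pose h (s : {x : T & {_ : unit | P x}}) : {x | P x} := exist _ (tag s) (proj2_sig (tagged s)).
rewrite (reindex h) /=; last first.
  exists (fun s : {x | P x} => existT (fun x => {_ : unit | P x}) (sval s) (exist (fun=> P (sval s)) tt (proj2_sig s))).
    by move=> [x [[] Px]].
  by move=> [x Px].
exact: sum_sig2.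
Qed.

Lemma sum_holds (b : bool) (f : b -> V) (h : b) : \sum_(u : {_ : unit | b}) f (proj2_sig u) = f h.
Proof.
rewrite (big_pred1 (exist _ tt h)) => [|[[] h']] /=; last by rewrite (bool_irrelevance h' h) eqxx.
by congr f; exact: bool_irrelevance.
Qed.

Lemma sum_holdsF (b : bool) (f : b -> V) : ~~ b -> \sum_(u : {_ : unit | b}) f (proj2_sig u) = 0.
Proof. by move=> nb; apply: big1 => -[[] h]; case/negP: nb. Qed.

Lemma sum_pick (T : finType) (t : T) (f : T -> V) :
  (forall t', t' != t -> f t' = 0) -> \sum_t' f t' = f t.
Proof. by move=> f0; rewrite (bigD1 t) //= big1 ?addr0. Qed.

End DependentSums.

Lemma dep_choice (I : Type) (T : I -> Type) (P : forall i, T i -> Prop) :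
  (forall i, exists y, P i y) -> exists f : forall i, T i, forall i, P i (f i).
Proof. by move=> H; exists (fun i => projT1 (cid (H i))) => i; case: (cid (H i)). Qed.

Section QuiverData.
Variables (F : fieldType) (n p : nat) (k : 'I_p.+1 -> nat).
Hypothesis k_gt0 : forall i, (0 < k i)%N.
Variable B : forall i : 'I_p.+1, htl F n.+1 (k i).
Variable xi : forall i : 'I_p.+1, 'I_(nblk (B i)) -> seq F.
Arguments xi : clear implicits.
Hypothesis xi_res : xi_annihilates xi.

(* A sum over [holds b] is a term that is present only if [b] holds and that may
   use the proof of [b]. *)
Local Notation holds b := {_ : unit | b}.
Local Notation M := 'M[F]_n.+1.
Local Notation blk i := 'I_(nblk (B i)).
Local Notation alpha := (halpha xi).
Local Notation Q := (hquiver xi).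
Local Notation lgd i j := (legdim (bres (B i) j) (xi i j)).
Local Notation xi0 i j := (nth 0 (xi i j) 0%N).
Local Notation inc i j := (@hinc F n (k i) (B i) j).
Local Notation proj i j := (@hproj F n (k i) (B i) j).
Local Notation idem i := (@bidem F n (k i) (B i)).
Local Notation rev i := (@revpoly F n (k i) (B i)).

Lemma xi_gt0 i j : (0 < size (xi i j))%N.
Proof.
rewrite lt0n size_eq0; apply/eqP => x0.
have := xi_res j; rewrite x0 big_nil => /matrixP /(_ (Ordinal (bsize_gt0 j)) (Ordinal (bsize_gt0 j))).
by rewrite !mxE eqxx => /eqP; rewrite oner_eq0.
Qed.

Lemma nblk_gt0 i : (0 < nblk (B i))%N.
Proof.
have := bsize_sum (B i); case: (nblk (B i)) (@bsize F n.+1 (k i) (B i)) => // s.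
by rewrite big_ord0.
Qed.

Lemma htree_exists i : exists t : btree (blk i), wf_tree (rev i) t /\ leaves t = [set: blk i]%SET.
Proof.
apply: (btree_exists (K := k i)); first exact: revpoly_sep.
by apply/set0Pn; exists (Ordinal (nblk_gt0 i)); rewrite inE.
Qed.

Definition htree i := projT1 (cid (htree_exists i)).
Lemma htree_wf i : wf_tree (rev i) (htree i). Proof. by rewrite /htree; case: cid => t []. Qed.
Lemma htree_leaves i : leaves (htree i) = [set: blk i]%SET.
Proof. by rewrite /htree; case: cid => t []. Qed.
Lemma mem_htree i j : j \in leaves (htree i). Proof. by rewrite htree_leaves inE. Qed.

Definition hside i (j' j : blk i) : F := side F (htree i) j' j.
Definition hY i (x : nat -> M) : {poly M} := Yhat (idem i) (k i) (rev i) x (htree i).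

(** If q_j - q_j' has degree d, the reversed polynomials first differ in degree k - d, and k - (k -
    d) - 2 = d - 2. *)
Lemma mult_irr i (j j' : blk i) : j != j' -> mult (k i) (htree i) j j' = irr_mult j j'.
Proof.
move=> ne; pose dp := bpoly (B i) j - bpoly (B i) j'.
have dp0 : dp != 0.
  rewrite subr_eq0; apply: contra ne => /eqP e; apply/eqP.
  exact: (@bpoly_inj _ _ _ (B i)).
pose d := (size dp).-1.
have dd : dp`_d != 0 by rewrite -[_`_ _]/(lead_coef dp) lead_coef_eq0.
have dk : (d <= k i)%N.
  have : (size dp <= (k i).+1)%N.
    by apply: leq_trans (size_polyD _ _) _; rewrite size_polyN geq_max !bpoly_deg.
  by rewrite /d; clear; lia.
have d2 : (2 <= d)%N.
  rewrite leqNgt; apply: contra dd => d2.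
  by rewrite coefB !bpoly_coef0 ?subrr.
have hi l : (d < l)%N -> (bpoly (B i) j)`_l = (bpoly (B i) j')`_l.
  move=> dl; apply/eqP; rewrite -subr_eq0 -coefB nth_default //.
  by apply: leq_trans dl; exact: leqSpred.
rewrite (@multE _ _ _ (rev i) _ _ _ (k i - d)%N); first last.
- rewrite !revpoly_coef //; do ?[by clear -d2; lia].
  by rewrite -subr_eq0 -coefB.
- move=> l ld; rewrite !coef_poly; case: ifP => // lk; apply: hi.
  by clear -ld; lia.
- exact: mem_htree.
- exact: mem_htree.
- exact: htree_wf.
by rewrite /irr_mult -/dp -/d; clear -dk d2; lia.
Qed.

Lemma irr_multC i (j j' : blk i) : irr_mult j j' = irr_mult j' j.
Proof. by rewrite /irr_mult -opprB size_polyN. Qed.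

(* [dX i] compares the frame at the pole [i] with the one at the pole 0.  Of the
   n x n matrices [dX], [dY], [dx] only the blocks that label arrows matter; the
   legs are indexed by all [l], the dimension being 0 beyond the last vertex. *)
Record data := Data {
  dX : 'I_p.+1 -> M;
  dY : 'I_p.+1 -> M;
  dx : 'I_p.+1 -> nat -> M;
  da : forall i (j : blk i) l, 'M[F]_(lgd i j l, lgd i j l.+1);
  db : forall i (j : blk i) l, 'M[F]_(lgd i j l.+1, lgd i j l)
}.

Section MakeRep.
Variable d : data.
Local Notation X := (dX d).
Local Notation Y := (dY d).
Local Notation xl := (dx d).
Local Notation a := (da d).
Local Notation b := (db d).

(** The factor [hside] reconciles the signs of [Yhat_res], which follow the tree, with those of the
    moment map, which follow [j < j']. Outside [Iirr] the leg ends in the frame of pole 0, hence in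
    all the blocks there. *)
Definition data_fwd (r : harrow xi) : 'M[F]_(alpha (htgt r), alpha (hsrc r)) :=
  match r return 'M[F]_(alpha (htgt r), alpha (hsrc r)) with
  | @Across _ _ _ _ _ _ j i hi h0 j' => proj i j' *m X i *m inc ord0 j
  | @Airr _ _ _ _ _ _ i hi j j' h c => hside j j' *: (proj i j' *m xl i c *m inc i j)
  | @Aend _ _ _ _ _ _ i hi j h => a j 0%N
  | @Areg _ _ _ _ _ _ i hi j1 h j => proj ord0 j *m inc i j1 *m a j1 0%N
  | @Aleg _ _ _ _ _ _ i j l h => a j l.+1
  end.

Definition data_bwd (r : harrow xi) : 'M[F]_(alpha (hsrc r), alpha (htgt r)) :=
  match r return 'M[F]_(alpha (hsrc r), alpha (htgt r)) with
  | @Across _ _ _ _ _ _ j i hi h0 j' => proj ord0 j *m Y i *m inc i j'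
  | @Airr _ _ _ _ _ _ i hi j j' h c => proj i j *m xl i c *m inc i j'
  | @Aend _ _ _ _ _ _ i hi j h => b j 0%N
  | @Areg _ _ _ _ _ _ i hi j1 h j => b j1 0%N *m proj i j1 *m inc ord0 j
  | @Aleg _ _ _ _ _ _ i j l h => b j l.+1
  end.

Definition data_rep : drep F alpha :=
  fun r => match r return 'M[F]_(alpha (@tgt (Defs.double Q) r), alpha (@src (Defs.double Q) r)) with
           | inl r => data_fwd r | inr r => data_bwd r end.

End MakeRep.

Section Sums.
Variable V : zmodType.

Lemma big_harrow_sub (f : harrow xi -> V) :
  \sum_(r : harrow xi) f r =
    \sum_(i : {i | i \in Iirr B}) \sum_(u : {_ : unit | sval i != ord0})
      \sum_(j : blk ord0) \sum_(j' : blk (sval i)) f (Across xi j (proj2_sig i) (proj2_sig u) j')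
  + \sum_(i : {i | i \in Iirr B})
      \sum_(jj : {jj : blk (sval i) * blk (sval i) | (jj.1 < jj.2)%N})
      \sum_(c : 'I_(irr_mult (sval jj).1 (sval jj).2)) f (Airr xi (proj2_sig i) (proj2_sig jj) c)
  + \sum_(i : {i | i \in Iirr B}) \sum_(j : {j : blk (sval i) | (0 < leg xi j)%N})
      f (Aend (proj2_sig i) (proj2_sig j))
  + \sum_(i : {i | i \notin Iirr B}) \sum_(j1 : {j : blk (sval i) | (0 < leg xi j)%N})
      \sum_(j : blk ord0) f (Areg (proj2_sig i) (proj2_sig j1) j)
  + \sum_(i : 'I_p.+1) \sum_(j : blk i) \sum_(l : {l : 'I_(leg xi j) | (l.+1 < leg xi j)%N})
      f (Aleg (proj2_sig l)).
Proof.
have decK : cancel (@harrow_decode F n.+1 p k B xi) (@harrow_encode F n.+1 p k B xi).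
  case=> [[[[[[i hi] [[[] h0] [j j']]]|[[i hi] [[[j j'] h] c]]]|[[i hi] [j h]]]
    |[[i hi] [[j1 h] j]]]|[i [j [l h]]]] //=.
have encK := @harrow_encodeK F n.+1 p k B xi.
pose T : finType := ({i : {i | i \in Iirr B} & ({_ : unit | sval i != ord0} * (blk ord0 * blk (sval i)))%type}
  + {i : {i | i \in Iirr B} & {jj : {jj : blk (sval i) * blk (sval i) | (jj.1 < jj.2)%N} &
      'I_(irr_mult (sval jj).1 (sval jj).2)}}
  + {i : {i | i \in Iirr B} & {j : blk (sval i) | (0 < leg xi j)%N}}
  + {i : {i | i \notin Iirr B} & ({j : blk (sval i) | (0 < leg xi j)%N} * blk ord0)%type}
  + {i : 'I_p.+1 & {j : blk i & {l : 'I_(leg xi j) | (l.+1 < leg xi j)%N}}})%type.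
pose hd : T -> harrow xi := @harrow_decode F n.+1 p k B xi.
have hd_bij : {on [pred _ | true], bijective hd}.
  by apply: onW_bij; exists (@harrow_encode F n.+1 p k B xi).
rewrite (reindex hd hd_bij) /= !big_sumType /=.
congr (_ + _ + _ + _ + _).
- by apply: sum_sigX3 => -[i hi] [[] h0] j j'.
- by apply: sum_sig3 => -[i hi] [[j j'] h] c.
- by apply: sum_sig2 => -[i hi] [j h].
- by apply: sum_sigX2 => -[i hi] [j1 h] j.
- by apply: sum_sig3 => i j [l h].
Qed.

Lemma big_harrow (f : harrow xi -> V) :
  \sum_(r : harrow xi) f r =
    \sum_i \sum_(hi : holds (i \in Iirr B)) \sum_(h0 : holds (i != ord0))
      \sum_(j : blk ord0) \sum_(j' : blk i) f (Across xi j (proj2_sig hi) (proj2_sig h0) j')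
  + \sum_i \sum_(hi : holds (i \in Iirr B)) \sum_(j : blk i) \sum_(j' : blk i)
      \sum_(h : holds (j < j')%N) \sum_(c : 'I_(irr_mult j j')) f (Airr xi (proj2_sig hi) (proj2_sig h) c)
  + \sum_i \sum_(hi : holds (i \in Iirr B)) \sum_(j : blk i)
      \sum_(h : holds (0 < leg xi j)%N) f (Aend (proj2_sig hi) (proj2_sig h))
  + \sum_i \sum_(hi : holds (i \notin Iirr B)) \sum_(j1 : blk i)
      \sum_(h : holds (0 < leg xi j1)%N) \sum_(j : blk ord0) f (Areg (proj2_sig hi) (proj2_sig h) j)
  + \sum_i \sum_(j : blk i) \sum_(l : 'I_(leg xi j)) \sum_(h : holds (l.+1 < leg xi j)%N)
      f (Aleg (proj2_sig h)).
Proof.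
rewrite big_harrow_sub; congr (_ + _ + _ + _ + _).
- exact: (@sum_sub _ _ (fun i => i \in Iirr B) (fun i hi => \sum_(h0 : holds (i != ord0))
      \sum_(j : blk ord0) \sum_(j' : blk i) f (Across xi j hi (proj2_sig h0) j'))).
- rewrite (@sum_sub _ _ (fun i => i \in Iirr B) (fun i hi =>
      \sum_(jj : {jj : blk i * blk i | (jj.1 < jj.2)%N})
      \sum_(c : 'I_(irr_mult (sval jj).1 (sval jj).2)) f (Airr xi hi (proj2_sig jj) c))).
  apply: eq_bigr => i _; apply: eq_bigr => hi _.
  rewrite (@sum_sub _ _ (fun jj : blk i * blk i => (jj.1 < jj.2)%N)
    (fun jj h => \sum_(c : 'I_(irr_mult jj.1 jj.2)) f (Airr xi (proj2_sig hi) h c))).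
  by rewrite [RHS]pair_big; apply: eq_bigr => -[j j'] _.
- rewrite (@sum_sub _ _ (fun i => i \in Iirr B) (fun i hi =>
      \sum_(j : {j : blk i | (0 < leg xi j)%N}) f (Aend hi (proj2_sig j)))).
  apply: eq_bigr => i _; apply: eq_bigr => hi _.
  exact: (@sum_sub _ _ (fun j : blk i => (0 < leg xi j)%N) (fun j h => f (Aend (proj2_sig hi) h))).
- rewrite (@sum_sub _ _ (fun i => i \notin Iirr B) (fun i hi =>
      \sum_(j1 : {j : blk i | (0 < leg xi j)%N}) \sum_(j : blk ord0) f (Areg hi (proj2_sig j1) j))).
  apply: eq_bigr => i _; apply: eq_bigr => hi _.
  exact: (@sum_sub _ _ (fun j : blk i => (0 < leg xi j)%N)
    (fun j1 h => \sum_(j : blk ord0) f (Areg (proj2_sig hi) h j))).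
- apply: eq_bigr => i _; apply: eq_bigr => j _.
  exact: (@sum_sub _ _ (fun l : 'I_(leg xi j) => (l.+1 < leg xi j)%N) (fun l h => f (Aleg h))).
Qed.

End Sums.

(* A vertex is determined by these numbers, which avoids inverting equalities
   between dependent constructors. *)
Definition vcode (v : hvert xi) : nat * nat * nat :=
  match v with
  | @Vbase _ _ _ _ _ _ i _ j => (nat_of_ord i, nat_of_ord j, 0%N)
  | @Vleg _ _ _ _ _ _ i j l => (nat_of_ord i, nat_of_ord j, l.+1)
  end.

Lemma vcode_inj : injective vcode.
Proof.
move=> [i hi j|i j l] [i' hi' j'|i' j' l'] //= [/val_inj ii].
  case: _ / ii hi' j' => hi' j' /val_inj <-.
  by rewrite (bool_irrelevance hi' hi).
by case: _ / ii j' l' => j' l' /val_inj jj; case: _ / jj l' => l' /val_inj <-.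
Qed.

Lemma hvert_eqE (v v' : hvert xi) : (v == v') = (vcode v == vcode v').
Proof. by rewrite (inj_eq vcode_inj). Qed.

(** Where [dX] labels no arrow it is set to 1: those poles use the frame of pole 0. *)
Definition normal (d : data) :=
  forall i, ~~ ((i \in Iirr B) && (i != ord0)) -> dX d i = 1.

Lemma blocks_exist i i' (D : forall (j' : blk i) (j : blk i'), 'M[F]_(bsize (B i) j', bsize (B i') j)) :
  exists Z : M, forall j' j, proj i j' *m Z *m inc i' j = D j' j.
Proof.
exists (\sum_j' \sum_j inc i j' *m D j' j *m proj i' j) => j' j.
rewrite mulmx_sumr mulmx_suml (bigD1 j') //= [X in _ + X]big1 ?addr0 => [|l lj]; last first.
  rewrite mulmx_sumr mulmx_suml big1 // => l' _.
  by rewrite !mulmxA hproj0 ?mul0mx // eq_sym.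
rewrite mulmx_sumr mulmx_suml (bigD1 j) //= big1 ?addr0 => [|l lj]; last first.
  by rewrite -!mulmxA hproj0 // !mulmx0.
by rewrite !mulmxA hprojK mul1mx -mulmxA hprojK mulmx1.
Qed.

Lemma rows_exist i m (D : forall j : blk i, 'M[F]_(bsize (B i) j, m)) :
  exists Z, forall j, proj i j *m Z = D j.
Proof.
exists (\sum_j inc i j *m D j) => j; rewrite mulmx_sumr (bigD1 j) //= big1 ?addr0 => [|l lj].
  by rewrite mulmxA hprojK mul1mx.
by rewrite mulmxA hproj0 ?mul0mx // eq_sym.
Qed.

Lemma cols_exist i m (D : forall j : blk i, 'M[F]_(m, bsize (B i) j)) :
  exists Z, forall j, Z *m inc i j = D j.
Proof.
exists (\sum_j D j *m proj i j) => j; rewrite mulmx_suml (bigD1 j) //= big1 ?addr0 => [|l lj].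
  by rewrite -mulmxA hprojK mulmx1.
by rewrite -mulmxA hproj0 ?mulmx0.
Qed.

Lemma reg_nblk i (j j' : blk i) : i \notin Iirr B -> j = j'.
Proof.
rewrite !inE negb_or -leqNgt => /andP[i1 _].
apply/val_inj => /=; have := ltn_ord j; have := ltn_ord j'.
by clear -i1; lia.
Qed.

Lemma reg_idem i (j : blk i) : i \notin Iirr B -> inc i j *m proj i j = 1.
Proof.
move=> ir; rewrite -[RHS](@bidem_sum _ _ _ (B i)) (bigD1 j) //= big1 ?addr0 // => j' /eqP [].
exact: reg_nblk.
Qed.

Lemma hside_sqr i (j j' : blk i) : j != j' -> hside j j' * hside j j' = 1.
Proof.
move=> ne; have [] := side_opp (htree_wf i) (mem_htree j) (mem_htree j') ne.
by rewrite /hside => _ [] ->; rewrite ?mulr1 // mulrNN mulr1.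
Qed.

Lemma hside_opp i (j j' : blk i) : j != j' -> hside j j' = - hside j' j.
Proof.
move=> ne; rewrite eq_sym in ne.
by have [] := side_opp (htree_wf i) (mem_htree j') (mem_htree j) ne.
Qed.

(** The blocks on the arrows are assembled into full matrices, with dummies where there is no arrow;
    the sign on a forward arrow is undone by [hside_sqr]. *)
Lemma data_rep_surj (x : drep F alpha) : exists2 d, normal d & x = data_rep d.
Proof.
have /dep_choice[X XP] i : exists Xi : M,
    (~~ ((i \in Iirr B) && (i != ord0)) -> Xi = 1) /\
    forall hi h0 j j', x (inl (Across xi j hi h0 j')) = proj i j' *m Xi *m inc ord0 j.
  have [hi|hi] := orP (orbN (i \in Iirr B)); last by exists 1; split=> // hi'; rewrite hi' in hi.
  have [h0|h0] := orP (orbN (i != ord0)); last by exists 1; split=> // ? h0'; rewrite h0' in h0.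
  have [Z ZP] := blocks_exist (fun j' j => x (inl (Across xi j hi h0 j'))).
  exists Z; split=> [|hi' h0' j j']; first by rewrite hi h0.
  by rewrite ZP (bool_irrelevance hi' hi) (bool_irrelevance h0' h0).
have /dep_choice[Y YP] i : exists Yi : M, forall hi h0 j j',
    x (inr (Across xi j hi h0 j')) = proj ord0 j *m Yi *m inc i j'.
  have [hi|hi] := orP (orbN (i \in Iirr B)); last by exists 1 => hi'; case/negP: hi.
  have [h0|h0] := orP (orbN (i != ord0)); last by exists 1 => ? h0'; case/negP: h0.
  have [Z ZP] := blocks_exist (fun j j' => x (inr (Across xi j hi h0 j'))).
  exists Z => hi' h0' j j'.
  by rewrite ZP (bool_irrelevance hi' hi) (bool_irrelevance h0' h0).
have xlH i l : exists Z : M, forall hi (j j' : blk i) (h : (j < j')%N)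
    (c : 'I_(irr_mult j j')), c = l :> nat ->
    x (inl (Airr xi hi h c)) = hside j j' *: (proj i j' *m Z *m inc i j) /\
    x (inr (Airr xi hi h c)) = proj i j *m Z *m inc i j'.
  have DH j' j : exists D : 'M[F]_(bsize (B i) j', bsize (B i) j), forall hi,
       (forall (h : (j < j')%N) (c : 'I_(irr_mult j j')), c = l :> nat ->
          x (inl (Airr xi hi h c)) = hside j j' *: D) /\
       (forall (h : (j' < j)%N) (c : 'I_(irr_mult j' j)), c = l :> nat ->
          x (inr (Airr xi hi h c)) = D).
    have [hi|hi] := orP (orbN (i \in Iirr B)); last by exists 0 => hi'; case/negP: hi.
    have [jj|[jj|jj]] : (j < j')%N \/ (j' < j)%N \/ j = j' :> nat.
      by case: (ltngtP j j') => jj; [left|right; left|right; right].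
    - have [lm|lm] := leqP (irr_mult j j') l.
        exists 0 => hi'; split=> [h c cl|h]; last by have := ltn_trans h jj; rewrite ltnn.
        by have := ltn_ord c; rewrite cl ltnNge lm.
      exists (hside j j' *: (x (inl (Airr xi hi jj (Ordinal lm))) : 'M_(_, _))) => hi'.
      split=> [h c cl|h]; last by have := ltn_trans h jj; rewrite ltnn.
      rewrite scalerA hside_sqr ?scale1r; last by rewrite -val_eqE /= ltn_eqF.
      have -> : c = Ordinal lm by apply/val_inj.
      by rewrite (bool_irrelevance hi' hi) (bool_irrelevance h jj).
    - have [lm|lm] := leqP (irr_mult j' j) l.
        exists 0 => hi'; split=> [h|h c cl]; first by have := ltn_trans h jj; rewrite ltnn.
        by have := ltn_ord c; rewrite cl ltnNge lm.
      exists (x (inr (Airr xi hi jj (Ordinal lm)))) => hi'.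
      split=> [h|h c cl]; first by have := ltn_trans h jj; rewrite ltnn.
      have -> : c = Ordinal lm by apply/val_inj.
      by rewrite (bool_irrelevance hi' hi) (bool_irrelevance h jj).
    - by exists 0 => hi'; split=> h; exfalso; move: (h); rewrite jj ltnn.
  have /dep_choice[D DP] := fun j' => dep_choice (DH j').
  have [Z ZP] := blocks_exist D.
  exists Z => hi j j' h c cl; rewrite !ZP.
  by have [H1 _] := DP j' j hi; have [_ H2] := DP j j' hi; rewrite H1 // H2.
have /dep_choice[xl xlP] := fun i => dep_choice (xlH i).
have aH i (j : blk i) : exists a : forall l, 'M[F]_(lgd i j l, lgd i j l.+1),
    [/\ forall hi h, x (inl (Aend hi h)) = a 0%N,
        forall hi h j0, x (inl (Areg hi h j0)) = proj ord0 j0 *m inc i j *m a 0%N &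
        forall (c : 'I_(leg xi j)) h, x (inl (@Aleg _ _ _ _ _ _ i j c h)) = a c.+1].
  pose P l : 'M[F]_(lgd i j l, lgd i j l.+1) -> Prop := match l with
    | 0 => fun a => (forall hi h, x (inl (Aend hi h)) = a) /\
            (forall hi h j0, x (inl (Areg hi h j0)) = proj ord0 j0 *m inc i j *m a)
    | l.+1 => fun a => forall (c : (l < leg xi j)%N) h,
         x (inl (@Aleg _ _ _ _ _ _ i j (Ordinal c) h)) = a end.
  suff /dep_choice[a aP] : forall l, exists y, P l y.
    exists a; split; [exact: (aP 0%N).1|exact: (aP 0%N).2|].
    by case=> c hc h; exact: (aP c.+1).
  case=> [|l] /=; last first.
    have [c|c] := orP (orbN (l < leg xi j)%N); last by exists 0 => c'; case/negP: c.
    have [h|h] := orP (orbN (l.+1 < leg xi j)%N); last by exists 0 => c' h'; case/negP: h.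
    by exists (x (inl (Aleg (l := Ordinal c) h))) => c' h'; rewrite (bool_irrelevance c' c) (bool_irrelevance h' h).
  have [h|h] := orP (orbN (0 < leg xi j)%N); last by exists 0; split=> hi h'; case/negP: h.
  have [hi|hi] := orP (orbN (i \in Iirr B)).
    exists (x (inl (Aend hi h))); split=> [hi' h'|hi']; last by case/negP: (hi').
    by rewrite (bool_irrelevance hi' hi) (bool_irrelevance h' h).
  (* With a single block at [i], [inc i j] and [proj i j] are mutually inverse, so the arrows to all
     blocks at 0 amount to one matrix. *)
  have [Z ZP] := rows_exist (fun j0 => x (inl (Areg hi h j0)) : 'M[F]_(bsize (B ord0) j0, lgd i j 1)).
  exists (proj i j *m Z); split=> [hi'|hi' h' j0]; first by case/negP: (hi).
  rewrite (bool_irrelevance hi' hi) (bool_irrelevance h' h).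
  by rewrite mulmxA -(mulmxA (proj ord0 j0)) reg_idem // mulmx1 ZP.
have /dep_choice[a aP] := fun i => dep_choice (aH i).
have bH i (j : blk i) : exists b : forall l, 'M[F]_(lgd i j l.+1, lgd i j l),
    [/\ forall hi h, x (inr (Aend hi h)) = b 0%N,
        forall hi h j0, x (inr (Areg hi h j0)) = b 0%N *m proj i j *m inc ord0 j0 &
        forall (c : 'I_(leg xi j)) h, x (inr (@Aleg _ _ _ _ _ _ i j c h)) = b c.+1].
  pose P l : 'M[F]_(lgd i j l.+1, lgd i j l) -> Prop := match l with
    | 0 => fun b => (forall hi h, x (inr (Aend hi h)) = b) /\
            (forall hi h j0, x (inr (Areg hi h j0)) = b *m proj i j *m inc ord0 j0)
    | l.+1 => fun b => forall (c : (l < leg xi j)%N) h,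
         x (inr (@Aleg _ _ _ _ _ _ i j (Ordinal c) h)) = b end.
  suff /dep_choice[b bP] : forall l, exists y, P l y.
    exists b; split; [exact: (bP 0%N).1|exact: (bP 0%N).2|].
    by case=> c hc h; exact: (bP c.+1).
  case=> [|l] /=; last first.
    have [c|c] := orP (orbN (l < leg xi j)%N); last by exists 0 => c'; case/negP: c.
    have [h|h] := orP (orbN (l.+1 < leg xi j)%N); last by exists 0 => c' h'; case/negP: h.
    by exists (x (inr (Aleg (l := Ordinal c) h))) => c' h'; rewrite (bool_irrelevance c' c) (bool_irrelevance h' h).
  have [h|h] := orP (orbN (0 < leg xi j)%N); last by exists 0; split=> hi h'; case/negP: h.
  have [hi|hi] := orP (orbN (i \in Iirr B)).
    exists (x (inr (Aend hi h))); split=> [hi' h'|hi']; last by case/negP: (hi').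
    by rewrite (bool_irrelevance hi' hi) (bool_irrelevance h' h).
  have [Z ZP] := cols_exist (fun j0 => x (inr (Areg hi h j0)) : 'M[F]_(lgd i j 1, bsize (B ord0) j0)).
  exists (Z *m inc i j); split=> [hi'|hi' h' j0]; first by case/negP: (hi).
  rewrite (bool_irrelevance hi' hi) (bool_irrelevance h' h).
  by rewrite -(mulmxA Z) reg_idem // mulmx1 ZP.
have /dep_choice[b bP] := fun i => dep_choice (bH i).
exists (Data X Y xl a b); first by move=> i; case: (XP i).
apply/functional_extensionality_dep => -[] [] /=.
- by move=> j i hi h0 j'; have [_ H] := XP i; exact: H.
- by move=> i hi j j' h c; have [] := xlP i c hi j j' h c erefl.
- by move=> i hi j h; have [H _ _] := aP i j; exact: H.
- by move=> i hi j1 h j; have [_ H _] := aP i j1; exact: H.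
- by move=> i j l h; have [_ _ H] := aP i j; exact: H.
- by move=> j i hi h0 j'; exact: YP.
- by move=> i hi j j' h c; have [] := xlP i c hi j j' h c erefl.
- by move=> i hi j h; have [H _ _] := bP i j; exact: H.
- by move=> i hi j1 h j; have [_ H _] := bP i j1; exact: H.
- by move=> i j l h; have [_ _ H] := bP i j; exact: H.
Qed.

Lemma Vbase_neqi i i' (hi : i \in Iirr B) (hi' : i' \in Iirr B) (j : blk i) (j' : blk i') :
  i' != i -> (Vbase xi hi' j' == Vbase xi hi j) = false.
Proof. by move=> ne; rewrite hvert_eqE /= !xpair_eqE val_eqE (negbTE ne). Qed.

Lemma Vbase_neqj i (hi hi' : i \in Iirr B) (j j' : blk i) :
  j' != j -> (Vbase xi hi' j' == Vbase xi hi j) = false.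
Proof. by move=> ne; rewrite hvert_eqE /= !xpair_eqE (negbTE ne : (val j' == val j) = false) andbF. Qed.

Lemma Vleg_neqi i i' (j : blk i) (j' : blk i') (l : 'I_(leg xi j)) (l' : 'I_(leg xi j')) :
  i' != i -> (Vleg l' == Vleg l) = false.
Proof. by move=> ne; rewrite hvert_eqE /= !xpair_eqE val_eqE (negbTE ne). Qed.

Lemma Vleg_neqj i (j j' : blk i) (l : 'I_(leg xi j)) (l' : 'I_(leg xi j')) :
  j' != j -> (Vleg l' == Vleg l) = false.
Proof. by move=> ne; rewrite hvert_eqE /= !xpair_eqE (negbTE ne : (val j' == val j) = false) andbF. Qed.

Lemma Vleg_eqE i (j : blk i) (l l' : 'I_(leg xi j)) :
  (Vleg l' == Vleg l) = (l' == l).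
Proof. by rewrite hvert_eqE /= !xpair_eqE !eqxx. Qed.

Section ArrowSums.
Variable V : zmodType.

(** The arrows [Areg] end over pole 0 only; the comparison of vertices stays inside the sum and is
    decided once [i] is known. *)
Lemma sum_tgt_base (g : harrow xi -> V) i (hi : i \in Iirr B) (j : blk i) :
  \sum_(r | htgt r == Vbase xi hi j) g r =
    \sum_(h0 : holds (i != ord0)) \sum_(j0 : blk ord0) g (Across xi j0 hi (proj2_sig h0) j)
  + \sum_(j' : blk i) \sum_(h : holds (j' < j)%N) \sum_c g (Airr xi hi (proj2_sig h) c)
  + \sum_(h : holds (0 < leg xi j)%N) g (Aend hi (proj2_sig h))
  + \sum_i' \sum_(hi' : holds (i' \notin Iirr B)) \sum_(j1 : blk i')
      \sum_(h : holds (0 < leg xi j1)%N) \sum_(j0 : blk ord0)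
        if Vbase xi (ord0_irr B) j0 == Vbase xi hi j then g (Areg (proj2_sig hi') (proj2_sig h) j0) else 0.
Proof.
rewrite big_mkcond big_harrow /= [X in _ + X]big1 ?addr0 => [|i' _]; last first.
  by do 3! [apply: big1 => ? _].
congr (_ + _ + _ + _).
- rewrite (sum_pick (t := i)) => [|i' ii']; last first.
    by do 4! [apply: big1 => ? _]; rewrite Vbase_neqi.
  rewrite (sum_holds (fun hi' => \sum_(h0 : holds (i != ord0)) \sum_(j0 : blk ord0) \sum_(j' : blk i)
     if Vbase xi hi' j' == Vbase xi hi j then g (Across xi j0 hi' (proj2_sig h0) j') else 0) hi).
  apply: eq_bigr => h0 _; apply: eq_bigr => j0 _; rewrite (sum_pick (t := j)) ?eqxx // => j' jj'.
  by rewrite Vbase_neqj.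
- rewrite (sum_pick (t := i)) => [|i' ii']; last first.
    by do 5! [apply: big1 => ? _]; rewrite Vbase_neqi.
  rewrite (sum_holds (fun hi' => \sum_(j1 : blk i) \sum_(j' : blk i)
      \sum_(h : holds (j1 < j')%N) \sum_(c : 'I_(irr_mult j1 j'))
      if Vbase xi hi' j' == Vbase xi hi j then g (Airr xi hi' (proj2_sig h) c) else 0) hi).
  apply: eq_bigr => j1 _; rewrite (sum_pick (t := j)) => [|j' jj'].
    by apply: eq_bigr => h _; apply: eq_bigr => c _; rewrite eqxx.
  by do 2! [apply: big1 => ? _]; rewrite Vbase_neqj.
- rewrite (sum_pick (t := i)) => [|i' ii']; last first.
    by do 3! [apply: big1 => ? _]; rewrite Vbase_neqi.
  rewrite (sum_holds (fun hi' => \sum_(j1 : blk i) \sum_(h : holds (0 < leg xi j1)%N)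
      if Vbase xi hi' j1 == Vbase xi hi j then g (Aend hi' (proj2_sig h)) else 0) hi).
  rewrite (sum_pick (t := j)) => [|j' jj'].
    by apply: eq_bigr => h _; rewrite eqxx.
  by apply: big1 => ? _; rewrite Vbase_neqj.
Qed.

Lemma sum_src_base (g : harrow xi -> V) i (hi : i \in Iirr B) (j : blk i) :
  \sum_(r | hsrc r == Vbase xi hi j) g r =
    \sum_i' \sum_(hi' : holds (i' \in Iirr B)) \sum_(h0 : holds (i' != ord0)) \sum_(j0 : blk ord0)
       \sum_(j' : blk i') (if Vbase xi (ord0_irr B) j0 == Vbase xi hi j then
                  g (Across xi j0 (proj2_sig hi') (proj2_sig h0) j') else 0)
  + \sum_(j' : blk i) \sum_(h : holds (j < j')%N) \sum_c g (Airr xi hi (proj2_sig h) c).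
Proof.
rewrite big_mkcond big_harrow /= [X in _ + X]big1 ?addr0 => [|i' _]; last first.
  by do 3! [apply: big1 => ? _].
rewrite [X in _ + X]big1 ?addr0 => [|i' _]; last first.
  by do 4! [apply: big1 => ? _].
rewrite [X in _ + X]big1 ?addr0 => [|i' _]; last first.
  by do 3! [apply: big1 => ? _].
congr (_ + _).
rewrite (sum_pick (t := i)) => [|i' ii']; last first.
  by do 5! [apply: big1 => ? _]; rewrite Vbase_neqi.
rewrite (sum_holds (fun hi' => \sum_(j1 : blk i) \sum_(j' : blk i)
    \sum_(h : holds (j1 < j')%N) \sum_(c : 'I_(irr_mult j1 j'))
    if Vbase xi hi' j1 == Vbase xi hi j then g (Airr xi hi' (proj2_sig h) c) else 0) hi).
rewrite (sum_pick (t := j)) => [|j1 jj1].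
  by do 3! [apply: eq_bigr => ? _]; rewrite eqxx.
by do 3! [apply: big1 => ? _]; rewrite Vbase_neqj.
Qed.

Lemma sum_tgt_leg (g : harrow xi -> V) i (j : blk i) (l : 'I_(leg xi j)) :
  \sum_(r | htgt r == Vleg l) g r = \sum_(h : holds (l.+1 < leg xi j)%N) g (Aleg (proj2_sig h)).
Proof.
rewrite big_mkcond big_harrow /= -!addrA.
rewrite [X in X + _]big1 ?add0r => [|i' _]; last by do 4! [apply: big1 => ? _].
rewrite [X in X + _]big1 ?add0r => [|i' _]; last by do 5! [apply: big1 => ? _].
rewrite [X in X + _]big1 ?add0r => [|i' _]; last by do 3! [apply: big1 => ? _].
rewrite [X in X + _]big1 ?add0r => [|i' _]; last by do 4! [apply: big1 => ? _].
rewrite (sum_pick (t := i)) => [|i' ii']; last first.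
  by do 3! [apply: big1 => ? _]; rewrite Vleg_neqi.
rewrite (sum_pick (t := j)) => [|j' jj']; last first.
  by do 2! [apply: big1 => ? _]; rewrite Vleg_neqj.
rewrite (sum_pick (t := l)) => [|l' ll']; last first.
  by apply: big1 => ? _; rewrite Vleg_eqE (negbTE ll').
by apply: eq_bigr => h _; rewrite eqxx.
Qed.

Lemma sum_src_leg0_irr (g : harrow xi -> V) i (hi : i \in Iirr B) (j : blk i) (h : (0 < leg xi j)%N) :
  \sum_(r | hsrc r == Vleg (Ordinal h)) g r = g (Aend hi h).
Proof.
rewrite big_mkcond big_harrow /= -!addrA.
rewrite [X in X + _]big1 ?add0r => [|i' _]; last by do 4! [apply: big1 => ? _].
rewrite [X in X + _]big1 ?add0r => [|i' _]; last by do 5! [apply: big1 => ? _].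
rewrite [X in _ + (_ + X)]big1 ?addr0 => [|i' _]; last first.
  by do 3! [apply: big1 => ? _]; rewrite hvert_eqE /= !xpair_eqE andbF.
rewrite [X in _ + X](sum_pick (t := i)) => [|i' ii']; last first.
  by do 4! [apply: big1 => ? _]; rewrite Vleg_neqi.
rewrite [X in _ + X]big1 ?addr0 => [|[[] hi'] _]; last by case/negP: (hi').
rewrite (sum_pick (t := i)) => [|i' ii']; last first.
  by do 3! [apply: big1 => ? _]; rewrite Vleg_neqi.
rewrite (sum_holds (fun hi' => \sum_(j1 : blk i) \sum_(h1 : holds (0 < leg xi j1)%N)
  if Vleg (Ordinal (proj2_sig h1)) == Vleg (Ordinal h) then g (Aend hi' (proj2_sig h1)) else 0) hi).
rewrite (sum_pick (t := j)) => [|j' jj']; last first.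
  by apply: big1 => ? _; rewrite Vleg_neqj.
rewrite (sum_holds (fun h1 => if Vleg (Ordinal h1) == Vleg (Ordinal h) then g (Aend hi h1) else 0) h).
by rewrite eqxx.
Qed.

Lemma sum_src_leg0_reg (g : harrow xi -> V) i (hi : i \notin Iirr B) (j : blk i) (h : (0 < leg xi j)%N) :
  \sum_(r | hsrc r == Vleg (Ordinal h)) g r = \sum_(j0 : blk ord0) g (Areg hi h j0).
Proof.
rewrite big_mkcond big_harrow /= -!addrA.
rewrite [X in X + _]big1 ?add0r => [|i' _]; last by do 4! [apply: big1 => ? _].
rewrite [X in X + _]big1 ?add0r => [|i' _]; last by do 5! [apply: big1 => ? _].
rewrite [X in _ + (_ + X)]big1 ?addr0 => [|i' _]; last first.
  by do 3! [apply: big1 => ? _]; rewrite hvert_eqE /= !xpair_eqE andbF.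
rewrite [X in X + _](sum_pick (t := i)) => [|i' ii']; last first.
  by do 3! [apply: big1 => ? _]; rewrite Vleg_neqi.
rewrite [X in X + _]big1 ?add0r => [|[[] hi'] _]; last by case/negP: (hi).
rewrite (sum_pick (t := i)) => [|i' ii']; last first.
  by do 4! [apply: big1 => ? _]; rewrite Vleg_neqi.
rewrite (sum_holds (fun hi' => \sum_(j1 : blk i) \sum_(h1 : holds (0 < leg xi j1)%N) \sum_(j0 : blk ord0)
  if Vleg (Ordinal (proj2_sig h1)) == Vleg (Ordinal h) then g (Areg hi' (proj2_sig h1) j0) else 0) hi).
rewrite (sum_pick (t := j)) => [|j' jj']; last first.
  by do 2! [apply: big1 => ? _]; rewrite Vleg_neqj.
rewrite (sum_holds (fun h1 => \sum_(j0 : blk ord0) if Vleg (Ordinal h1) == Vleg (Ordinal h) then g (Areg hi h1 j0) else 0) h).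
by apply: eq_bigr => j0 _; rewrite eqxx.
Qed.

Lemma sum_src_legS (g : harrow xi -> V) i (j : blk i) l (hl : (l < leg xi j)%N) (h : (l.+1 < leg xi j)%N) :
  \sum_(r | hsrc r == Vleg (Ordinal h)) g r = g (Aleg (l := Ordinal hl) h).
Proof.
rewrite big_mkcond big_harrow /= -!addrA.
rewrite [X in X + _]big1 ?add0r => [|i' _]; last by do 4! [apply: big1 => ? _].
rewrite [X in X + _]big1 ?add0r => [|i' _]; last by do 5! [apply: big1 => ? _].
rewrite [X in X + _]big1 ?add0r => [|i' _]; last first.
  by do 3! [apply: big1 => ? _]; rewrite hvert_eqE /= !xpair_eqE andbF.
rewrite [X in X + _]big1 ?add0r => [|i' _]; last first.
  by do 4! [apply: big1 => ? _]; rewrite hvert_eqE /= !xpair_eqE andbF.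
rewrite (sum_pick (t := i)) => [|i' ii']; last first.
  by do 3! [apply: big1 => ? _]; rewrite Vleg_neqi.
rewrite (sum_pick (t := j)) => [|j' jj']; last first.
  by do 2! [apply: big1 => ? _]; rewrite Vleg_neqj.
rewrite (sum_pick (t := Ordinal hl)) => [|l' ll']; last first.
  apply: big1 => ? _; rewrite Vleg_eqE; case: eqP => // -[ll]; case/eqP: ll'; exact/val_inj.
rewrite (sum_holds (fun h1 => if Vleg (Ordinal h1) == Vleg (Ordinal h) then g (Aleg (l := Ordinal hl) h1) else 0) h).
by rewrite eqxx.
Qed.

End ArrowSums.

(** * The moment map *)

(** The residue prescribed by the legs; by [isleg_conj] its blocks are conjugate to the [bres] when
    the legs have full rank. *)
Definition hR (d : data) i : M :=
  \sum_j inc i j *m ((xi0 i j)%:M + da d j 0%N *m db d j 0%N) *m proj i j.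

Definition hYr (d : data) i : M := (hY i (dx d i))`_(k i).-1.

Lemma hproj_diag i (D : forall j, 'M[F]_(bsize (B i) j)) j :
  proj i j *m (\sum_j inc i j *m D j *m proj i j) *m inc i j = D j.
Proof.
rewrite mulmx_sumr mulmx_suml (bigD1 j) //= big1 ?addr0 => [|l lj].
  by rewrite !mulmxA hprojK mul1mx -mulmxA hprojK mulmx1.
by rewrite !mulmxA hproj0 ?mul0mx // eq_sym.
Qed.

Lemma hproj_hR d i j : proj i j *m hR d i *m inc i j = (xi0 i j)%:M + da d j 0%N *m db d j 0%N.
Proof. exact: hproj_diag. Qed.

Lemma hside_diag i (j : blk i) : hside j j = 0.
Proof.
rewrite /hside; have := htree_wf i; have := mem_htree j.
elim: (htree i) => //= m a IHa b IHb; rewrite inE => jt [wa wb d _].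
rewrite !andbb; case: ifP => ja; first exact: IHa.
by case: ifP => jb; [exact: IHb|rewrite ja jb in jt].
Qed.

Lemma idem_sandwich i (j : blk i) (A : M) : proj i j *m (idem i j * A * idem i j) *m inc i j = proj i j *m A *m inc i j.
Proof. by rewrite -!mulmxE !mulmxA hprojK mul1mx -!mulmxA hprojK mulmx1. Qed.

(** These are the terms of the arrows [Airr] in the moment map: [hside] is antisymmetric, whence a
    plus sign at the target and a minus sign at the source. *)
Lemma hY_res (d : data) i (j : blk i) :
  proj i j *m hYr d i *m inc i j =
  \sum_(j' : blk i) \sum_(h : holds (j' < j)%N) \sum_(c < irr_mult j' j)
    hside j' j *: (proj i j *m dx d i c *m inc i j') *m (proj i j' *m dx d i c *m inc i j)
  - \sum_(j' : blk i) \sum_(h : holds (j < j')%N) \sum_(c < irr_mult j j')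
    (proj i j *m dx d i c *m inc i j') *m (hside j j' *: (proj i j' *m dx d i c *m inc i j)).
Proof.
rewrite -idem_sandwich /hYr /hY Yhat_res; first last.
- exact: mem_htree.
- exact: htree_wf.
- exact: revpoly_sep.
- exact: revpoly_res.
- exact: bidem_orth.
rewrite mulmx_sumr mulmx_suml -sumrB htree_leaves.
apply: eq_big => [j'|j' _]; first by rewrite inE.
pose t c := (proj i j *m dx d i c *m inc i j') *m (proj i j' *m dx d i c *m inc i j).
have E c : proj i j *m (hside j' j *: (idem i j * dx d i c * idem i j' * dx d i c * idem i j)) *m inc i j
    = hside j' j *: t c.
  rewrite -scalemxAr -scalemxAl; congr (_ *: _).
  by rewrite -!mulmxE !mulmxA hprojK mul1mx -!mulmxA hprojK mulmx1 /t !mulmxA.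
rewrite mulmx_sumr mulmx_suml; under eq_bigr do rewrite E.
have [jj|jj|/val_inj jj] := ltngtP j' j.
- rewrite (sum_holds (fun=> _)) // [X in _ - X]big1 ?subr0 => [|[[] h] //].
  rewrite mult_irr 1?irr_multC 1?eq_sym; last by apply/negP => /eqP e; rewrite e ltnn in jj.
  by apply: eq_bigr => c _; rewrite /t scalemxAl.
- rewrite [X in X - _]big1 ?sub0r => [|[[] h] //].
  have ne : j != j' by apply/negP => /eqP e; rewrite e ltnn in jj.
  rewrite (sum_holds (fun=> _)) // mult_irr // -sumrN.
  by apply: eq_bigr => c _; rewrite hside_opp 1?eq_sym // scaleNr /t scalemxAr.
- rewrite jj hside_diag big1 => [|c _]; last by rewrite scale0r.
  rewrite [X in X - _]big1 ?[X in _ - X]big1 ?subr0 // => h _; apply: big1 => c _.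
    by rewrite scale0r mulmx0.
  by rewrite scale0r mul0mx.
Qed.

Lemma lgd_big i (j : blk i) l : (leg xi j < l)%N -> lgd i j l = 0%N.
Proof.
move=> h; apply: (legdim0 (xi_gt0 j) (xi_res j)).
by move: h; rewrite /leg; clear; lia.
Qed.

Lemma leg_term i (j : blk i) l (a : 'M[F]_(lgd i j l, lgd i j l.+1)) (b : 'M[F]_(lgd i j l.+1, lgd i j l)) :
  \sum_(h : holds (l < leg xi j)%N) a *m b = a *m b.
Proof.
have [h|h] := ltnP l (leg xi j); first by rewrite (sum_holds (fun=> _)).
rewrite big1 => [|[[] h'] //].
by rewrite (legdim0_eqr (lgd_big (h : (leg xi j < l.+1)%N)) a 0) mul0mx.
Qed.

Lemma moment_leg (d : data) i (j : blk i) (l : 'I_(leg xi j)) :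
  moment (data_rep d) (Vleg l) = da d j l.+1 *m db d j l.+1 - db d j l *m da d j l.
Proof.
rewrite /moment; congr (_ - _).
  rewrite sum_tgt_leg -[RHS]leg_term; apply: eq_bigr => h _.
  exact: conform_mx_id.
case: l => -[|l] hl.
  have [hi|hi] := orP (orbN (i \in Iirr B)).
    by rewrite (sum_src_leg0_irr _ hi); exact: conform_mx_id.
  rewrite (sum_src_leg0_reg _ hi).
  transitivity (\sum_(j0 : blk ord0) db d j 0%N *m proj i j *m idem ord0 j0 *m (inc i j *m da d j 0%N)).
    by apply: eq_bigr => j0 _; rewrite conform_mx_id /= !mulmxA.
  rewrite -mulmx_suml -mulmx_sumr bidem_sum mulmx1 mulmxA -(mulmxA _ (proj i j)) hprojK mulmx1.
  by [].
rewrite (sum_src_legS _ (ltnW hl)); exact: conform_mx_id.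
Qed.

Lemma moment_base (d : data) i (hi : i \in Iirr B) (j : blk i) :
  moment (data_rep d) (Vbase xi hi j) =
  \sum_(h0 : holds (i != ord0)) proj i j *m (dX d i *m dY d i) *m inc i j
  + \sum_i' \sum_(hi' : holds (i' \notin Iirr B)) \sum_(j1 : blk i')
      \sum_(h : holds (0 < leg xi j1)%N) \sum_(j0 : blk ord0)
        (if Vbase xi (ord0_irr B) j0 == Vbase xi hi j then conform_mx (0 : 'M_(alpha (Vbase xi hi j)))
            (data_fwd d (Areg (proj2_sig hi') (proj2_sig h) j0) *m data_bwd d (Areg (proj2_sig hi') (proj2_sig h) j0)) else 0)
  - \sum_i' \sum_(hi' : holds (i' \in Iirr B)) \sum_(h0 : holds (i' != ord0)) \sum_(j0 : blk ord0)
       \sum_(j' : blk i') (if Vbase xi (ord0_irr B) j0 == Vbase xi hi j then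
          conform_mx (0 : 'M_(alpha (Vbase xi hi j))) (data_bwd d (Across xi j0 (proj2_sig hi') (proj2_sig h0) j') *m
            data_fwd d (Across xi j0 (proj2_sig hi') (proj2_sig h0) j')) else 0)
  + proj i j *m (hR d i + hYr d i) *m inc i j - (xi0 i j)%:M.
Proof.
rewrite /moment sum_tgt_base sum_src_base !mulmxDr !mulmxDl hproj_hR hY_res.
(* The scalar [x] completes [da *m db] to the diagonal block of [hR]. *)
have aux m (s1 s2 s3 s4 s5 s6 x : 'M[F]_m) : (s1 + s2 + s3 + s4) - (s5 + s6) =
    s1 + s4 - s5 + (x + s3 + (s2 - s6)) - x.
  by apply/matrixP => u v; rewrite !mxE; ring.
rewrite (aux _ _ _ _ _ _ _ (xi0 i j)%:M); congr (_ + _ - _ + (_ + _ + (_ - _)) - _).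
- apply: eq_bigr => h0 _.
  transitivity (\sum_(j0 : blk ord0) proj i j *m dX d i *m idem ord0 j0 *m (dY d i *m inc i j)).
    by apply: eq_bigr => j0 _; rewrite conform_mx_id /= !mulmxA.
  by rewrite -mulmx_suml -mulmx_sumr bidem_sum mulmx1 !mulmxA.
- by rewrite -[RHS]leg_term; apply: eq_bigr => h _; exact: conform_mx_id.
- by do 3! [apply: eq_bigr => ? _]; exact: conform_mx_id.
- by do 3! [apply: eq_bigr => ? _]; exact: conform_mx_id.
Qed.

Lemma moment_irr (d : data) i (hi : i \in Iirr B) (j : blk i) : i != ord0 ->
  moment (data_rep d) (Vbase xi hi j) =
  proj i j *m (dX d i *m dY d i + hR d i + hYr d i) *m inc i j - (xi0 i j)%:M.
Proof.
move=> h0; rewrite moment_base (sum_holds (fun=> _)) //.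
rewrite [X in _ + X - _ + _]big1 ?addr0 => [|i' _]; last first.
  by do 4! [apply: big1 => ? _]; rewrite Vbase_neqi // eq_sym.
rewrite [X in _ - X + _]big1 ?subr0 => [|i' _]; last first.
  by do 4! [apply: big1 => ? _]; rewrite Vbase_neqi // eq_sym.
by rewrite -mulmxDl -mulmxDr !addrA.
Qed.

Lemma sum_filter (V : zmodType) (P : pred 'I_p.+1) (G : 'I_p.+1 -> V) :
  \sum_i \sum_(h : holds (P i)) G i = \sum_(i | P i) G i.
Proof.
rewrite [RHS]big_mkcond; apply: eq_bigr => i _.
case: (boolP (P i)) => Pi; first by rewrite (sum_holds (fun=> _)).
by rewrite (sum_holdsF (fun=> _)).
Qed.

(** A leg outside [Iirr] contributes its [hR] without the scalar; the missing scalars are the ones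
    that [hlambda] subtracts at pole 0. *)
Lemma moment_0 (d : data) (j : blk ord0) :
  moment (data_rep d) (Vbase xi (ord0_irr B) j) =
  proj ord0 j *m (hR d ord0 + hYr d ord0
    + \sum_(i | i \notin Iirr B) (hR d i - (\sum_(j1 < nblk (B i)) xi0 i j1)%:M)
    - \sum_(i | (i \in Iirr B) && (i != ord0)) dY d i *m dX d i) *m inc ord0 j - (xi0 ord0 j)%:M.
Proof.
rewrite moment_base (sum_holdsF (fun=> _)) // add0r.
have -> : \sum_(i | i \notin Iirr B) (hR d i - (\sum_(j1 < nblk (B i)) xi0 i j1)%:M) =
   \sum_i \sum_(hi : holds (i \notin Iirr B)) \sum_(j1 : blk i) inc i j1 *m (da d j1 0%N *m db d j1 0%N) *m proj i j1.
  rewrite -sum_filter; apply: eq_bigr => i _; apply: eq_bigr => -[[] hi] _.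
  rewrite raddf_sum -sumrB; apply: eq_bigr => j1 _.
  by rewrite mulmxDr mulmxDl mul_mx_scalar -scalemxAl reg_idem // -[1]/(1%:M) scalemx1 addrC addKr.
have -> : \sum_(i | (i \in Iirr B) && (i != ord0)) dY d i *m dX d i =
   \sum_i \sum_(hi : holds (i \in Iirr B)) \sum_(h0 : holds (i != ord0)) \sum_(j' : blk i)
     dY d i *m idem i j' *m dX d i.
  rewrite [LHS]big_mkcond; apply: eq_bigr => i _.
  case: (boolP (i \in Iirr B)) => hi; last by rewrite big1 // => -[[] //].
  rewrite (sum_holds (fun=> _)) //; case: eqP => h0; first by rewrite big1 // => -[[] //].
  by rewrite (sum_holds (fun=> _)) // -mulmx_suml -mulmx_sumr bidem_sum mulmx1.
rewrite mulmxBr mulmxBl [in RHS]mulmxDr [in RHS]mulmxDl.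
rewrite [_ - _ + _]addrC [in LHS]addrA; congr (_ + _ - _ - _).
- rewrite mulmx_sumr mulmx_suml; apply: eq_bigr => i _.
  rewrite mulmx_sumr mulmx_suml; apply: eq_bigr => hi _.
  rewrite mulmx_sumr mulmx_suml; apply: eq_bigr => j1 _.
  rewrite -leg_term mulmx_sumr mulmx_suml mulmx_sumr mulmx_suml; apply: eq_bigr => h _.
  rewrite (sum_pick (t := j)) => [|j0 jj0]; last by rewrite Vbase_neqj.
  by rewrite eqxx conform_mx_id /= !mulmxA.
- rewrite mulmx_sumr mulmx_suml; apply: eq_bigr => i _.
  rewrite mulmx_sumr mulmx_suml; apply: eq_bigr => hi _.
  rewrite mulmx_sumr mulmx_suml; apply: eq_bigr => h0 _.
  rewrite (sum_pick (t := j)) => [|j0 jj0]; last first.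
    by apply: big1 => ? _; rewrite Vbase_neqj.
  rewrite mulmx_sumr mulmx_suml; apply: eq_bigr => j' _.
  by rewrite eqxx conform_mx_id /= !mulmxA.
Qed.

Lemma big_reg (V : zmodType) (f : 'I_p.+1 -> V) :
  \sum_(i | i != ord0) f i =
  \sum_(i | i \notin Iirr B) f i + \sum_(i | (i \in Iirr B) && (i != ord0)) f i.
Proof.
rewrite (bigID (fun i => i \in Iirr B)) /= addrC; congr (_ + _); apply: eq_bigl => i; last by rewrite andbC.
by case: eqP => // ->; rewrite ord0_irr.
Qed.

Lemma scal_block i (j : blk i) (c : F) : proj i j *m c%:M *m inc i j = c%:M.
Proof. by rewrite mul_mx_scalar -scalemxAl hprojK scalemx1. Qed.

Lemma hYr_reg (d : data) i : i \notin Iirr B -> hYr d i = 0.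
Proof.
move=> hi; pose j := Ordinal (nblk_gt0 i).
have E : hYr d i = inc i j *m (proj i j *m hYr d i *m inc i j) *m proj i j.
  by rewrite !mulmxA reg_idem // mul1mx -mulmxA reg_idem // mulmx1.
rewrite {}E hY_res // [X in X - _]big1 ?[X in _ - X]big1 ?subr0 ?mulmx0 ?mul0mx // => j' _.
  by apply: big1 => -[[] h] _; exfalso; move: (h); rewrite (reg_nblk j j' hi) ltnn.
by apply: big1 => -[[] h] _; exfalso; move: (h); rewrite (reg_nblk j j' hi) ltnn.
Qed.

(** Orthogonal to the dimension vector, since the block sizes over each pole of [Iirr] add up to the
    rank; so the trace condition on the parameter is not affected. *)
Definition lambda_shift (a : vert Q) : F :=
  match a with
  | Vbase i _ _ => if i == ord0 then - (#|Iirr B :\ ord0|%SET)%:R else 1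
  | Vleg _ _ _ => 0
  end.

(** * Subrepresentations and intertwiners *)

Lemma mult_diag i (j : blk i) : mult (k i) (htree i) j j = 0%N.
Proof.
have := htree_wf i; have := mem_htree j.
elim: (htree i) => //= m a IHa b IHb; rewrite inE => jt [wa wb d _].
rewrite !andbb; case: ifP => ja; first exact: IHa.
by case: ifP => jb; [exact: IHb|rewrite ja jb in jt].
Qed.

Section Relations.
Variables (i : 'I_p.+1) (Rel : M -> M -> Prop).
Hypothesis RelD : forall a a' b b', Rel a a' -> Rel b b' -> Rel (a + b) (a' + b').
Hypothesis RelM : forall a a' b b', Rel a a' -> Rel b b' -> Rel (a *m b) (a' *m b').
Hypothesis RelZ : forall r a a', Rel a a' -> Rel (r *: a) (r *: a').
Hypothesis Rel1 : Rel 1%:M 1%:M.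

Lemma hrel_fwd x x' :
  (forall c, (c < (k i).-1)%N -> Rel (hY i x)`_c (hY i x')`_c) ->
  (forall j, Rel (idem i j) (idem i j)) /\
  (forall (j j' : blk i) l, j != j' -> (l < irr_mult j j')%N ->
     Rel (idem i j' *m x l *m idem i j) (idem i j' *m x' l *m idem i j)).
Proof.
move=> RY.
have [] := @rel_fwd F M _ (idem i) (k i) (rev i) (@bidem_orth _ _ _ _)
  (@revpoly_sep _ _ _ _) Rel RelD RelM RelZ Rel1 (htree i) x x' (htree_wf i) _ RY.
  by rewrite htree_leaves EE_setT.
move=> RE Rx; split=> [j|j j' l jj lm]; first exact/RE/mem_htree.
by apply: Rx; [exact: mem_htree|exact: mem_htree|rewrite mult_irr].
Qed.

Lemma hrel_bwd x x' :
  (forall j, Rel (idem i j) (idem i j)) ->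
  (forall (j j' : blk i) l, j != j' -> (l < irr_mult j j')%N ->
     Rel (idem i j' *m x l *m idem i j) (idem i j' *m x' l *m idem i j)) ->
  forall c, Rel (hY i x)`_c (hY i x')`_c.
Proof.
move=> RE Rx c.
apply: (@rel_bwd F M _ (idem i) (k i) (rev i) Rel RelD RelM RelZ Rel1 (htree i) x x'
  (htree_wf i) _ _ c.+1) => // j j' l _ _ lm.
have [jj|jj] := eqVneq j j'; first by rewrite jj mult_diag in lm.
by apply: Rx => //; rewrite -mult_irr.
Qed.

End Relations.

Lemma blocks_eq i i' (A A' : M) :
  (forall (j' : blk i) (j : blk i'), proj i j' *m A *m inc i' j = proj i j' *m A' *m inc i' j) -> A = A'.
Proof.
move=> e; rewrite -[A]mul1mx -[A']mul1mx -[1%:M](bidem_sum (B i)) -[A]mulmx1 -[A']mulmx1 -[1%:M](bidem_sum (B i')).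
rewrite !mulmx_suml; apply: eq_bigr => j' _; rewrite !mulmx_sumr; apply: eq_bigr => j _.
by rewrite -!mulmxA; congr (_ *m _); rewrite !mulmxA; congr (_ *m _); exact: e.
Qed.

Lemma rows_eq i m (A A' : 'M[F]_(n.+1, m)) : (forall j : blk i, proj i j *m A = proj i j *m A') -> A = A'.
Proof.
move=> e; rewrite -[A]mul1mx -[A']mul1mx -[1%:M](bidem_sum (B i)) !mulmx_suml.
by apply: eq_bigr => j _; rewrite -!mulmxA e.
Qed.

Lemma cols_eq i m (A A' : 'M[F]_(m, n.+1)) : (forall j : blk i, A *m inc i j = A' *m inc i j) -> A = A'.
Proof.
move=> e; rewrite -[A]mulmx1 -[A']mulmx1 -[1%:M](bidem_sum (B i)) !mulmx_sumr.
by apply: eq_bigr => j _; rewrite !mulmxA e.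
Qed.

Section Subrepresentations.
Variable d : data.
Variables (W : 'I_p.+1 -> {vspace 'cV[F]_n.+1}).
Variables (L : forall i (j : blk i) l, {vspace 'cV[F]_(lgd i j l)}).

Definition sub_at (a : vert Q) : {vspace 'cV[F]_(alpha a)} :=
  match a return {vspace 'cV[F]_(alpha a)} with
  | Vbase i _ j => L j 0%N
  | Vleg i j l => L j l.+1
  end.

Lemma data_subrep :
  (forall i (j : blk i) v, v \in W i -> proj i j *m v \in L j 0%N) ->
  (forall i (j : blk i) (v : 'cV_(bsize (B i) j)), v \in L j 0%N -> inc i j *m v \in W i) ->
  (forall i, i \in Iirr B -> i != ord0 -> forall v, v \in W ord0 -> dX d i *m v \in W i) ->
  (forall i, i \in Iirr B -> i != ord0 -> forall v, v \in W i -> dY d i *m v \in W ord0) ->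
  (forall i, i \in Iirr B -> forall (j j' : blk i) c, j != j' -> (c < irr_mult j j')%N ->
     forall v, v \in W i -> idem i j' *m dx d i c *m idem i j *m v \in W i) ->
  (forall i, i \notin Iirr B -> W i = W ord0) ->
  (forall i (j : blk i) l v, v \in L j l.+1 -> da d j l *m v \in L j l) ->
  (forall i (j : blk i) l v, v \in L j l -> db d j l *m v \in L j l.+1) ->
  forall r (v : 'cV[F]_(alpha (@src (Defs.double Q) r))),
    v \in sub_at (@src (Defs.double Q) r) -> data_rep d r *m v \in sub_at (@tgt (Defs.double Q) r).
Proof.
move=> WL LW WX WY Wx Wreg La Lb.
have Lx i (hi : i \in Iirr B) (j j' : blk i) c v : j != j' -> (c < irr_mult j j')%N ->
    v \in L j 0%N -> proj i j' *m dx d i c *m inc i j *m v \in L j' 0%N.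
  move=> jj cm /LW vW; have := WL _ j' _ (Wx _ hi _ _ _ jj cm _ vW).
  by rewrite !mulmxA hprojK mul1mx -!mulmxA (mulmxA (proj i j)) hprojK mul1mx.
case=> [] [] /=.
- move=> j i hi h0 j' v /LW vW; rewrite -!mulmxA; exact/WL/WX.
- move=> i hi j j' h c v vj; rewrite -scalemxAl; apply/memvZ/Lx => //.
  by rewrite -val_eqE /= ltn_eqF.
- by move=> i hi j h v; exact: La.
- move=> i hi j1 h j v /La /LW; rewrite Wreg // => vW; rewrite -!mulmxA; exact: WL.
- by move=> i j l h v; exact: La.
- move=> j i hi h0 j' v /LW vW; rewrite -!mulmxA; exact/WL/WY.
- move=> i hi j j' h c v vj; apply/Lx => //; last by rewrite (irr_multC j').
  by rewrite -val_eqE /= gtn_eqF.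
- by move=> i hi j h v; exact: (Lb i j 0%N v).
- move=> i hi j1 h j v /LW vW; rewrite -!mulmxA; apply/Lb/WL; by rewrite Wreg.
- by move=> i j l h v; exact: (Lb i j l.+1 v).
Qed.

End Subrepresentations.

Section Intertwiners.

(** A change of basis of the representation, with the blocks over the pole [i] collected in [H i]. A
    pole outside [Iirr] has no base vertex and borrows the one at 0. *)
Record dconj (d d' : data) (H : 'I_p.+1 -> M)
    (G : forall i (j : blk i) l, 'M[F]_(lgd i j l)) : Prop := DConj {
  dc_uH : forall i, H i \in unitmx;
  dc_uG : forall i (j : blk i) l, G i j l \in unitmx;
  dc_H : forall i j, H i *m idem i j = idem i j *m H i;
  dc_G0 : forall i (j : blk i), G i j 0%N = proj i j *m H i *m inc i j;
  dc_X : forall i, i \in Iirr B -> i != ord0 -> dX d' i *m H ord0 = H i *m dX d i;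
  dc_Y : forall i, i \in Iirr B -> i != ord0 -> dY d' i *m H i = H ord0 *m dY d i;
  dc_x : forall i, i \in Iirr B -> forall (j j' : blk i) c, j != j' -> (c < irr_mult j j')%N ->
     idem i j' *m dx d' i c *m idem i j *m H i = H i *m (idem i j' *m dx d i c *m idem i j);
  dc_reg : forall i, i \notin Iirr B -> H i = H ord0;
  dc_a : forall i (j : blk i) l, da d' j l *m G i j l.+1 = G i j l *m da d j l;
  dc_b : forall i (j : blk i) l, db d' j l *m G i j l = G i j l.+1 *m db d j l
}.

Lemma proj_comm i (j : blk i) (H : M) : H *m idem i j = idem i j *m H ->
  proj i j *m H = (proj i j *m H *m inc i j) *m proj i j.
Proof. by move=> HE; rewrite -!mulmxA HE !mulmxA hprojK mul1mx. Qed.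

Lemma inc_comm i (j : blk i) (H : M) : H *m idem i j = idem i j *m H ->
  H *m inc i j = inc i j *m (proj i j *m H *m inc i j).
Proof. by move=> HE; rewrite !mulmxA -HE -!mulmxA hprojK mulmx1. Qed.

Lemma unit_block i (j : blk i) (H : M) : H \in unitmx -> H *m idem i j = idem i j *m H ->
  proj i j *m H *m inc i j \in unitmx.
Proof.
move=> uH HE; suff /mulmx1_unit [] : (proj i j *m H *m inc i j) *m (proj i j *m invmx H *m inc i j) = 1%:M by [].
by rewrite 2!(mulmxA (proj i j *m H *m inc i j)) -proj_comm // mulmxK // hprojK.
Qed.

Lemma dconj_orbit d d' H G : dconj d d' H G -> rep_orbit (data_rep d) (data_rep d').
Proof.
case=> uH uG HE G0 HX HY Hx Hreg Ha Hb.
pose g (a : vert Q) : 'M[F]_(alpha a) := match a return 'M[F]_(alpha a) with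
  | Vbase i _ j => G i j 0%N | Vleg i j l => G i j l.+1 end.
have ug a : g a \in unitmx by case: a => [i hi j|i j l]; [exact: (uG i j 0%N)|exact: (uG i j l.+1)].
exists g => //; apply/functional_extensionality_dep => r.
apply: (canRL (mulmxK (ug _))).
have pH i (j : blk i) : proj i j *m H i = G i j 0%N *m proj i j by rewrite G0 -proj_comm.
have iH i (j : blk i) : H i *m inc i j = inc i j *m G i j 0%N by rewrite G0 -inc_comm.
have xH i (hi : i \in Iirr B) (j j' : blk i) c : j != j' -> (c < irr_mult j j')%N ->
    proj i j' *m dx d' i c *m inc i j *m G i j 0%N = G i j' 0%N *m (proj i j' *m dx d i c *m inc i j).
  move=> jj cm; transitivity (proj i j' *m (idem i j' *m dx d' i c *m idem i j *m H i) *m inc i j).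
    by rewrite -!mulmxA iH (mulmxA (proj i j)) (hprojK j) mul1mx (mulmxA (proj i j') (inc i j')) hprojK mul1mx.
  rewrite Hx // (mulmxA (proj i j')) pH -!mulmxA (hprojK j) mulmx1 (mulmxA (proj i j') (inc i j')) hprojK mul1mx.
  by [].
case: r => [] [] /=.
- move=> j i hi h0 j'; rewrite -!mulmxA -iH (mulmxA (dX d' i)) HX // !mulmxA pH.
  by [].
- move=> i hi j j' h c; rewrite -scalemxAl xH //; last by rewrite -val_eqE /= ltn_eqF.
  by rewrite scalemxAr.
- by move=> i hi j h; exact: (Ha i j 0%N).
- move=> i hi j1 h j; rewrite -!mulmxA (Ha i j1 0%N) (mulmxA (inc i j1)) -iH Hreg // !mulmxA pH.
  by [].
- by move=> i j l h; exact: (Ha i j l.+1).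
- move=> j i hi h0 j'; rewrite -!mulmxA -iH (mulmxA (dY d' i)) HY // !mulmxA pH.
  by [].
- move=> i hi j j' h c; rewrite xH //; last by rewrite (irr_multC j').
  by rewrite -val_eqE /= gtn_eqF.
- by move=> i hi j h; exact: (Hb i j 0%N).
- move=> i hi j1 h j; rewrite -!mulmxA -iH -(Hreg _ hi) (mulmxA (proj i j1)) pH !mulmxA (Hb i j1 0%N).
  by [].
- by move=> i j l h; exact: (Hb i j l.+1).
Qed.

Lemma orbit_dconj d d' : rep_orbit (data_rep d) (data_rep d') -> exists H G, dconj d d' H G.
Proof.
case=> g ug e.
have {}e r : data_rep d' r *m g (@src (Defs.double Q) r) = g (@tgt (Defs.double Q) r) *m data_rep d r.
  by rewrite e mulmxKV.
have [H HP] : exists H : 'I_p.+1 -> M, forall i, [/\ H i \in unitmx,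
    forall (hi : i \in Iirr B) j, proj i j *m H i = (g (Vbase xi hi j) : 'M_(bsize (B i) j)) *m proj i j /\
      H i *m inc i j = inc i j *m (g (Vbase xi hi j) : 'M_(bsize (B i) j)) &
    i \notin Iirr B -> H i = H ord0].
  have DH i : exists H : M, i \in Iirr B -> H \in unitmx /\
      forall (hi : i \in Iirr B) j, proj i j *m H = (g (Vbase xi hi j) : 'M_(bsize (B i) j)) *m proj i j /\
      H *m inc i j = inc i j *m (g (Vbase xi hi j) : 'M_(bsize (B i) j)).
    have [hi|hi] := orP (orbN (i \in Iirr B)); last by exists 0 => hi'; case/negP: hi.
    pose D (f : forall a, 'M[F]_(alpha a)) j := f (Vbase xi hi j) : 'M[F]_(bsize (B i) j).
    pose HH f := \sum_j inc i j *m D f j *m proj i j.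
    have HHp f j : proj i j *m HH f = D f j *m proj i j.
      rewrite mulmx_sumr (bigD1 j) //= big1 ?addr0 => [|l lj].
        by rewrite !mulmxA hprojK mul1mx.
      by rewrite !mulmxA hproj0 ?mul0mx // eq_sym.
    have HHi f j : HH f *m inc i j = inc i j *m D f j.
      rewrite mulmx_suml (bigD1 j) //= big1 ?addr0 => [|l lj].
        by rewrite -!mulmxA hprojK mulmx1.
      by rewrite -!mulmxA hproj0 ?mulmx0.
    exists (HH g) => _; split=> [|hi' j]; last by rewrite (bool_irrelevance hi' hi) HHp HHi.
    suff /mulmx1_unit [] : HH g *m HH (fun a => invmx (g a)) = 1%:M by [].
    apply: (@rows_eq i) => j; rewrite mulmxA HHp -mulmxA HHp mulmxA mulmxV ?mul1mx ?mulmx1 //.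
    exact: (ug (Vbase xi hi j)).
  have /dep_choice[H HP] := DH.
  pose H' i := if i \in Iirr B then H i else H ord0.
  have H1 i : i \in Iirr B -> H' i = H i by rewrite /H' => ->.
  have H2 i : i \notin Iirr B -> H' i = H ord0 by rewrite /H' => /negbTE ->.
  exists H' => i; rewrite (H1 ord0 (ord0_irr B)).
  have [hi|hi] := orP (orbN (i \in Iirr B)).
    by have [uH Hg] := HP i hi; rewrite (H1 _ hi); split=> //; rewrite hi.
  have [uH _] := HP ord0 (ord0_irr B).
  by rewrite (H2 _ hi); split=> // hi'; case/negP: (hi).
have Hreg i (hi : i \notin Iirr B) : H i = H ord0 by case: (HP i) => _ _; exact.
have HE i j : H i *m idem i j = idem i j *m H i.
  have [hi|hi] := orP (orbN (i \in Iirr B)); last by rewrite /bidem reg_idem // mul1mx mulmx1.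
  by have [_ Hg _] := HP i; have [Hp Hi] := Hg hi j; rewrite mulmxA Hi -!mulmxA Hp.
have [G GP] : exists G : forall i (j : blk i) l, 'M[F]_(lgd i j l), forall i j,
   G i j 0%N = proj i j *m H i *m inc i j /\
   forall l, G i j l.+1 \in unitmx /\ forall h : (l < leg xi j)%N, G i j l.+1 = g (Vleg (Ordinal h)).
  have GH i (j : blk i) : exists G : forall l, 'M[F]_(lgd i j l), G 0%N = proj i j *m H i *m inc i j /\
     forall l, G l.+1 \in unitmx /\ forall h : (l < leg xi j)%N, G l.+1 = g (Vleg (Ordinal h)).
    pose P l : 'M[F]_(lgd i j l) -> Prop := match l with
      | 0 => fun G => G = proj i j *m H i *m inc i j
      | l.+1 => fun G => G \in unitmx /\ forall h : (l < leg xi j)%N, G = g (Vleg (Ordinal h)) end.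
    suff /dep_choice[G GP] : forall l, exists y, P l y.
      by exists G; split=> [|l]; [exact: (GP 0%N)|exact: (GP l.+1)].
    case=> [|l]; first by exists (proj i j *m H i *m inc i j).
    have [h|h] := orP (orbN (l < leg xi j)%N); last by exists 1%:M; split; [exact: unitmx1|move=> h'; case/negP: h].
    exists (g (Vleg (Ordinal h))); split; first exact: (ug (Vleg (Ordinal h))).
    by move=> h'; rewrite (bool_irrelevance h' h).
  by have /dep_choice[G GP] := fun i => dep_choice (GH i); exists G.
have uH i : H i \in unitmx by case: (HP i).
have G0 i (j : blk i) : G i j 0%N = proj i j *m H i *m inc i j by case: (GP i j).
have G0g i (hi : i \in Iirr B) (j : blk i) : G i j 0%N = g (Vbase xi hi j).
  by have [_ Hg _] := HP i; have [Hp Hi] := Hg hi j; rewrite G0 Hp -mulmxA hprojK mulmx1.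
have pH i (j : blk i) : proj i j *m H i = G i j 0%N *m proj i j by rewrite G0 -proj_comm.
have iH i (j : blk i) : H i *m inc i j = inc i j *m G i j 0%N by rewrite G0 -inc_comm.
have Gg i (j : blk i) l (h : (l < leg xi j)%N) : G i j l.+1 = g (Vleg (Ordinal h)).
  by case: (GP i j) => _ /(_ l) [_]; exact.
exists H, G; split=> //.
- move=> i j [|l]; last by case: (GP i j) => _ /(_ l) [].
  by rewrite G0; exact: unit_block.
- move=> i hi h0; apply: (@blocks_eq i ord0) => j' j; have := e (inl (Across xi j hi h0 j')); rewrite /= -!G0g => ee.
  by rewrite -!mulmxA iH !mulmxA ee !mulmxA pH.
- move=> i hi h0; apply: (@blocks_eq ord0 i) => j' j; have := e (inr (Across xi j' hi h0 j)); rewrite /= -!G0g => ee.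
  by rewrite -!mulmxA iH !mulmxA ee !mulmxA pH.
- move=> i hi j j' c jj cm.
  have xG : proj i j' *m dx d' i c *m inc i j *m G i j 0%N = G i j' 0%N *m (proj i j' *m dx d i c *m inc i j).
    have [lt|[lt|/val_inj eqj]] : (j < j')%N \/ (j' < j)%N \/ j = j' :> nat.
    - by case: (ltngtP j j') => h; [left|right; left|right; right].
    - have := e (inl (Airr xi hi lt (Ordinal cm))); rewrite /= -!G0g => /(congr1 (fun Z => hside j j' *: Z)).
      by rewrite -scalemxAl -scalemxAr !scalerA hside_sqr // !scale1r.
    - by have := cm; rewrite irr_multC => cm'; have := e (inr (Airr xi hi lt (Ordinal cm'))); rewrite /= -!G0g.
    by rewrite eqj eqxx in jj.
  transitivity (inc i j' *m (proj i j' *m dx d' i c *m inc i j *m G i j 0%N) *m proj i j).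
    by rewrite -!mulmxA pH.
  by rewrite xG !mulmxA iH.
- move=> i j [|l].
    have [h|h] := leqP 1 (leg xi j); last exact: (legdim0_eqr (lgd_big (h : (leg xi j < 1)%N))).
    have [hi|hi] := orP (orbN (i \in Iirr B)).
      by have := e (inl (Aend hi h)); rewrite /= -Gg -G0g.
    suff : inc i j *m (da d' j 0%N *m G i j 1%N) = inc i j *m (G i j 0%N *m da d j 0%N).
      by move/(congr1 (mulmx (proj i j))); rewrite !(mulmxA (proj i j)) (hprojK j) !mul1mx.
    rewrite (mulmxA _ (G i j 0%N)) -iH Hreg //; apply: (@rows_eq ord0) => j0.
    by have := e (inl (Areg hi h j0)); rewrite /= -Gg -G0g !mulmxA pH.
  have [h|h] := leqP l.+2 (leg xi j); last exact: (legdim0_eqr (lgd_big (h : (leg xi j < l.+2)%N))).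
  by have := e (inl (Aleg (l := Ordinal (ltnW h)) h)); rewrite /= -!Gg.
- move=> i j [|l].
    have [h|h] := leqP 1 (leg xi j); last exact: (legdim0_eq (lgd_big (h : (leg xi j < 1)%N))).
    have [hi|hi] := orP (orbN (i \in Iirr B)).
      by have := e (inr (Aend hi h)); rewrite /= -Gg -G0g.
    suff : db d' j 0%N *m G i j 0%N *m proj i j = G i j 1%N *m db d j 0%N *m proj i j.
      by move/(congr1 (mulmx^~ (inc i j))); rewrite -!(mulmxA _ (proj i j)) (hprojK j) !mulmx1.
    rewrite -(mulmxA _ (G i j 0%N)) -pH Hreg //; apply: (@cols_eq ord0) => j0.
    by have := e (inr (Areg hi h j0)); rewrite /= -Gg -G0g -!mulmxA iH.
  have [h|h] := leqP l.+2 (leg xi j); last exact: (legdim0_eq (lgd_big (h : (leg xi j < l.+2)%N))).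
  by have := e (inr (Aleg (l := Ordinal (ltnW h)) h)); rewrite /= -!Gg.
Qed.

End Intertwiners.
(** * From representations to connections *)

Section Shifted.
Variable zeta : F.

Definition shifted_lambda (a : vert Q) : F := hlambda xi a + zeta * lambda_shift a.

(** Outside [Iirr] there is a single block, so the leg determines the whole residue and not just its
    diagonal blocks. *)
Definition frame_res1 (d : data) i : M :=
  if i \in Iirr B then zeta%:M - dX d i *m dY d i else hR d i.

(* The residue at the pole [i] in the frame of that pole. *)
Definition frame_res (d : data) i : M :=
  if i == ord0 then - \sum_(i' | i' != ord0) invmx (dX d i') *m frame_res1 d i' *m dX d i' else frame_res1 d i.

Definition data_conn (d : data) : pparts F n.+1 k := fun i l =>
  invmx (dX d i) *m (if l == 0%N :> nat then frame_res d i else (hY i (dx d i))`_(k i - l.+1)) *m dX d i.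

Arguments data_conn : clear implicits.

Definition framed (d : data) := normal d /\ forall i, dX d i \in unitmx.

Lemma framed_X0 d : framed d -> dX d ord0 = 1.
Proof. by case=> nd _; apply: nd; rewrite eqxx andbF. Qed.

Lemma framed_Xreg d i : framed d -> i \notin Iirr B -> dX d i = 1.
Proof. by case=> nd _ hi; apply: nd; rewrite (negbTE hi). Qed.

Lemma sum_residue d : framed d -> \sum_(i < p.+1) residue (data_conn d) i = 0.
Proof.
move=> gd; have resE i : residue (data_conn d) i = invmx (dX d i) *m frame_res d i *m dX d i.
  by rewrite /residue (big_pred1 (Ordinal (k_gt0 i))).
rewrite (bigD1 ord0) //= resE (framed_X0 gd) invmx1 mul1mx mulmx1 /frame_res eqxx.
rewrite -[X in _ + X = _]opprK -opprD; apply/eqP; rewrite oppr_eq0 subr_eq0; apply/eqP.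
by apply: eq_bigr => i /negbTE i0; rewrite resE /frame_res i0.
Qed.

Lemma frame_res0E d : framed d -> frame_res d ord0 = - \sum_(i | i \notin Iirr B) hR d i
  - \sum_(i | (i \in Iirr B) && (i != ord0)) (zeta%:M - dY d i *m dX d i).
Proof.
move=> gd; rewrite /frame_res eqxx big_reg opprD; congr (- _ - _); apply: eq_bigr => i hi.
  by rewrite (framed_Xreg gd hi) invmx1 mul1mx mulmx1 /frame_res1 (negbTE hi).
case/andP: hi => hi i0; rewrite /frame_res1 hi mulmxBr mulmxBl !mulmxA.
have [_ u] := gd; rewrite mulVmx // mul1mx; congr (_ - _).
by rewrite mul_mx_scalar -scalemxAl mulVmx // scalemx1.
Qed.

Definition leg_rel (d : data) := forall i (j : blk i) l,
  da d j l.+1 *m db d j l.+1 - db d j l *m da d j l = ((xi i j)`_l - (xi i j)`_l.+1)%:M.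

(** The moment map equations at the base vertices, read on the residues; nothing is imposed off the
    diagonal, in accordance with [torbit_bwd]. *)
Definition block_rel (d : data) := forall i (j : blk i),
  proj i j *m frame_res d i *m inc i j = proj i j *m (hR d i + hYr d i) *m inc i j.

Lemma moment_irrP d i (hi : i \in Iirr B) (j : blk i) : i != ord0 ->
  moment (data_rep d) (Vbase xi hi j) = (shifted_lambda (Vbase xi hi j))%:M <->
  proj i j *m frame_res d i *m inc i j = proj i j *m (hR d i + hYr d i) *m inc i j.
Proof.
move=> i0; rewrite moment_irr // /frame_res (negbTE i0) /frame_res1 hi /shifted_lambda /= (negbTE i0) subr0 mulr1.
rewrite -addrA mulmxDr mulmxDl mulmxBr mulmxBl scal_block.
have -> : (- xi0 i j + zeta)%:M = - (xi0 i j)%:M + zeta%:M :> 'M[F]_(bsize (B i) j).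
  by rewrite raddfD raddfN.
have aux (V : zmodType) (x z s c : V) : x + z - s = - s + c <-> c - x = z.
  split=> [e|<-]; last by rewrite [x + _]addrC subrK addrC.
  by rewrite -[c](addKr (- s)) -e opprK [s + _]addrC subrK addrC addKr.
exact: aux.
Qed.

Lemma moment_0P d (j : blk ord0) : framed d ->
  moment (data_rep d) (Vbase xi (ord0_irr B) j) = (shifted_lambda (Vbase xi (ord0_irr B) j))%:M <->
  proj ord0 j *m frame_res d ord0 *m inc ord0 j = proj ord0 j *m (hR d ord0 + hYr d ord0) *m inc ord0 j.
Proof.
move=> gd; rewrite moment_0 // (frame_res0E gd) /shifted_lambda /=.
set T := \sum_(i | i \notin Iirr B) \sum_(j' < nblk (B i)) _.
set SR := \sum_(i | i \notin Iirr B) hR d i.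
set SY := \sum_(i | _ && _) dY d i *m dX d i.
have -> : \sum_(i | i \notin Iirr B) (hR d i - (\sum_(j1 < nblk (B i)) xi0 i j1)%:M) = SR - T%:M.
  by rewrite sumrB -raddf_sum.
(* Each residue [zeta - X Y] contributes one [zeta] to the sum that defines the residue at 0; this
   explains the value of [lambda_shift] there. *)
pose N : F := (#|Iirr B :\ ord0|%SET)%:R.
have -> : \sum_(i | (i \in Iirr B) && (i != ord0)) (zeta%:M - dY d i *m dX d i) = (zeta * N)%:M - SY.
  rewrite sumrB; congr (_ - _); rewrite mulr_natr raddfMn /= -sumr_const.
  by apply: eq_bigl => i; rewrite !inE andbC.
have -> : (- xi0 ord0 j - T + zeta * - N)%:M =
    - (xi0 ord0 j)%:M - T%:M - (zeta * N)%:M :> 'M[F]_(bsize (B ord0) j).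
  by rewrite mulrN !raddfD !raddfN.
rewrite !opprD !opprK !(mulmxDr, mulmxDl, mulmxN, mulNmx) !scal_block.
have aux (V : zmodType) (a b c e : V) : a - b = - (c - e) -> (a = b <-> c = e).
  move=> E; split=> /eqP; rewrite -subr_eq0 => /eqP e0; apply/eqP; rewrite -subr_eq0.
    by rewrite -oppr_eq0 -E e0.
  by rewrite E e0 oppr0.
by apply: aux; apply/matrixP => u v; rewrite !mxE; ring.
Qed.

Lemma moment_legP d i (j : blk i) (l : 'I_(leg xi j)) :
  moment (data_rep d) (Vleg l) = (shifted_lambda (Vleg l))%:M <->
  da d j l.+1 *m db d j l.+1 - db d j l *m da d j l = ((xi i j)`_l - (xi i j)`_l.+1)%:M.
Proof. by rewrite moment_leg // /shifted_lambda /= mulr0 addr0. Qed.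

Lemma momentP d : framed d ->
  (forall a, moment (data_rep d) a = (shifted_lambda a)%:M) <-> block_rel d /\ leg_rel d.
Proof.
move=> gd; split=> [mo|[br lr] a].
  split=> [i j|i j l]; last first.
    have [h|h] := leqP (leg xi j) l.
      exact: (legdim0_eq (lgd_big (h : (leg xi j < l.+1)%N))).
    exact/(moment_legP d (Ordinal h))/mo.
  have [/eqP i0|i0] := orP (orbN (i == ord0)).
    by move: j; rewrite i0 => j; exact/moment_0P.
  have [hi|hi] := orP (orbN (i \in Iirr B)).
    by apply/moment_irrP/mo.
  by rewrite hYr_reg // addr0 /frame_res (negbTE i0) /frame_res1 (negbTE hi).
case: a => [i hi j|i j l]; last exact/moment_legP/lr.
have [/eqP i0|i0] := orP (orbN (i == ord0)); last by apply/moment_irrP => //; exact: br.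
case: _ / (esym i0) hi j => hi j; rewrite (bool_irrelevance hi (ord0_irr B)).
by apply/moment_0P => //; exact: br.
Qed.

Lemma conj_inter (X X' H0 H Z Z' : M) : X \in unitmx -> X' \in unitmx ->
  X' *m H0 = H *m X -> Z' *m H = H *m Z ->
  invmx X' *m Z' *m X' *m H0 = H0 *m (invmx X *m Z *m X).
Proof.
move=> uX uX' XH ZH.
have e : H0 *m invmx X = invmx X' *m H by rewrite -[H0](mulKmx uX') XH -!mulmxA mulmxV ?mulmx1.
by rewrite -!mulmxA XH (mulmxA Z') ZH !mulmxA e.
Qed.

Lemma block_comm i (j : blk i) (H C C' : M) : H *m idem i j = idem i j *m H -> C' *m H = H *m C ->
  (proj i j *m C' *m inc i j) *m (proj i j *m H *m inc i j) =
  (proj i j *m H *m inc i j) *m (proj i j *m C *m inc i j).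
Proof.
move=> HE CH; rewrite -(mulmxA (proj i j *m C')) -inc_comm // 2!(mulmxA (proj i j *m H *m inc i j)) -proj_comm //.
by rewrite -!mulmxA (mulmxA C') CH !mulmxA.
Qed.

Section Equivariance.
Variables (d d' : data) (H : 'I_p.+1 -> M).
Hypothesis HE : forall i j, H i *m idem i j = idem i j *m H i.
Hypothesis Hx : forall i, i \in Iirr B -> forall (j j' : blk i) c, j != j' -> (c < irr_mult j j')%N ->
  idem i j' *m dx d' i c *m idem i j *m H i = H i *m (idem i j' *m dx d i c *m idem i j).

Lemma hY_inter i c : (hY i (dx d' i))`_c *m H i = H i *m (hY i (dx d i))`_c.
Proof.
apply/esym; apply: (hrel_bwd (i := i) (Rel := fun a a' => H i *m a = a' *m H i)).
- by move=> a a' b b' e e'; rewrite mulmxDr mulmxDl e e'.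
- by move=> a a' b b' e e'; rewrite mulmxA e -mulmxA e' mulmxA.
- by move=> r a a' e; rewrite -scalemxAr e scalemxAl.
- by rewrite mulmx1 mul1mx.
- by move=> j; rewrite HE.
- move=> j j' l jj lm; have [hi|hi] := orP (orbN (i \in Iirr B)); first by rewrite Hx.
  by rewrite (reg_nblk j j' hi) eqxx in jj.
Qed.

End Equivariance.

Lemma data_conn_dconj (d d' : data) (H : 'I_p.+1 -> M) G : framed d -> framed d' -> dconj d d' H G ->
  data_conn d' = fun i l => H ord0 *m data_conn d i l *m invmx (H ord0).
Proof.
move=> gd gd' [uH uG HE G0 HX HY Hx Hreg Ha Hb].
have uX i : dX d i \in unitmx by case: gd.
have uX' i : dX d' i \in unitmx by case: gd'.
have XH i : dX d' i *m H ord0 = H i *m dX d i.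
  have [hi|hi] := orP (orbN (i \in Iirr B)); last first.
    by rewrite (framed_Xreg gd hi) (framed_Xreg gd' hi) mul1mx mulmx1 Hreg.
  have [/eqP ->|i0] := orP (orbN (i == ord0)); last exact: HX.
  by rewrite (framed_X0 gd) (framed_X0 gd') mul1mx mulmx1.
have RH i : hR d' i *m H i = H i *m hR d i.
  rewrite /hR mulmx_suml mulmx_sumr; apply: eq_bigr => j _.
  rewrite -!mulmxA proj_comm // (mulmxA (H i)) inc_comm // -G0 !mulmxA.
  congr (_ *m _); rewrite -!mulmxA; congr (_ *m _).
  by rewrite mulmxDl mulmxDr scalar_mxC -!mulmxA (Hb i j 0%N) (mulmxA (da d' j 0%N)) (Ha i j 0%N) !mulmxA.
have C1H i : i != ord0 -> frame_res1 d' i *m H i = H i *m frame_res1 d i.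
  move=> i0; rewrite /frame_res1; have [hi|hi] := orP (orbN (i \in Iirr B)); last by rewrite (negbTE hi).
  rewrite hi mulmxBl mulmxBr scalar_mxC; congr (_ - _).
  by rewrite -mulmxA HY // !mulmxA HX.
have CH i : frame_res d' i *m H i = H i *m frame_res d i.
  rewrite /frame_res; have [i0|i0] := eqVneq i ord0; last exact: C1H.
  rewrite i0 mulNmx mulmxN mulmx_suml mulmx_sumr; congr (- _); apply: eq_bigr => i' i'0.
  by apply: conj_inter => //; exact: C1H.
apply/functional_extensionality_dep => i; apply/functional_extensionality_dep => l.
apply: (canRL (mulmxK (uH _))); apply: conj_inter => //.
by case: ifP => _; [exact: CH|exact: hY_inter].
Qed.

Definition hisleg (d : data) := forall i (j : blk i), isleg (da d j) (db d j).

(** Transport [g] to every frame. There it intertwines the irregular coefficients, hence idempotents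
    and blocks of [dx] by [hrel_fwd]; it also conjugates the diagonal blocks of the residues, so
    [isleg_uniq] extends it over the legs. *)
Lemma dconj_of_data_conn (d d' : data) (g : M) : framed d -> framed d' -> block_rel d -> block_rel d' ->
  hisleg d -> hisleg d' -> g \in unitmx ->
  data_conn d' = (fun i l => g *m data_conn d i l *m invmx g) -> exists H G, dconj d d' H G.
Proof.
move=> gd gd' br br' ld ld' ug e.
have uX i : dX d i \in unitmx by case: gd.
have uX' i : dX d' i \in unitmx by case: gd'.
pose H i := dX d' i *m g *m invmx (dX d i).
have uH i : H i \in unitmx by rewrite !unitmx_mul uX' ug unitmx_inv uX.
have H0 : H ord0 = g by rewrite /H (framed_X0 gd) (framed_X0 gd') invmx1 mul1mx mulmx1.
have HX i : dX d' i *m H ord0 = H i *m dX d i by rewrite H0 /H mulmxKV.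
have key i (Z Z' : M) : invmx (dX d' i) *m Z' *m dX d' i = g *m (invmx (dX d i) *m Z *m dX d i) *m invmx g ->
    Z' *m H i = H i *m Z.
  move/(congr1 (fun A => dX d' i *m (A *m g *m invmx (dX d i)))).
  rewrite mulmxKV // -!mulmxA mulKVmx // mulmxV // mulmx1 => E.
  by rewrite /H -!mulmxA E.
have CH i : frame_res d' i *m H i = H i *m frame_res d i.
  by apply: key; have := congr1 (fun A => A i (Ordinal (k_gt0 i))) e.
have YH i c : (c < (k i).-1)%N -> H i *m (hY i (dx d i))`_c = (hY i (dx d' i))`_c *m H i.
  move=> ck; have lk : (k i - c.+1 < k i)%N by move: ck (k_gt0 i); clear; lia.
  apply/esym/key; have := congr1 (fun A => A i (Ordinal lk)) e; rewrite /data_conn /=.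
  have -> : (k i - c.+1 == 0)%N = false by move: ck (k_gt0 i); clear; lia.
  by have -> : (k i - (k i - c.+1).+1 = c)%N by move: ck (k_gt0 i); clear; lia.
have Hrel i : (forall j, H i *m idem i j = idem i j *m H i) /\
  (forall (j j' : blk i) l, j != j' -> (l < irr_mult j j')%N ->
     H i *m (idem i j' *m dx d i l *m idem i j) = (idem i j' *m dx d' i l *m idem i j) *m H i).
  apply: (hrel_fwd (i := i) (Rel := fun a a' => H i *m a = a' *m H i)).
  - by move=> a a' b b' e1 e2; rewrite mulmxDr mulmxDl e1 e2.
  - by move=> a a' b b' e1 e2; rewrite mulmxA e1 -mulmxA e2 mulmxA.
  - by move=> r a a' e1; rewrite -scalemxAr e1 scalemxAl.
  - by rewrite mulmx1 mul1mx.
  - exact: YH.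
have HE i j : H i *m idem i j = idem i j *m H i by have [] := Hrel i.
have Hx i (hi : i \in Iirr B) (j j' : blk i) c : j != j' -> (c < irr_mult j j')%N ->
    idem i j' *m dx d' i c *m idem i j *m H i = H i *m (idem i j' *m dx d i c *m idem i j).
  by move=> jj cm; have [_ ->] := Hrel i.
have YrH i : hYr d' i *m H i = H i *m hYr d i by exact: hY_inter.
have legH i (j : blk i) : exists G : forall l, 'M[F]_(lgd i j l),
    [/\ G 0%N = proj i j *m H i *m inc i j, forall l, G l \in unitmx,
        forall l, da d' j l *m G l.+1 = G l *m da d j l & forall l, db d' j l *m G l = G l.+1 *m db d j l].
  have uh : proj i j *m H i *m inc i j \in unitmx by exact: unit_block.
  have [|G [G0 uG Ga Gb]] := isleg_uniq (xi_gt0 j) (xi_res j) (ld i j) (ld' i j) uh.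
    apply: (canRL (mulmxK uh)).
    have := block_comm (HE i j) (CH i); rewrite br br' !(mulmxDr, mulmxDl) !hproj_hR.
    rewrite (block_comm (HE i j) (YrH i)) => /addIr; rewrite mulmxDl mulmxDr scalar_mxC.
    exact: addrI.
  by exists G; split=> // l; rewrite ?Ga ?Gb mulmxKV.
have /dep_choice[G GP] := fun i => dep_choice (legH i).
exists H, G; split=> //.
- by move=> i j l; case: (GP i j).
- by move=> i j; case: (GP i j).
(* [zeta] is central, so [X Y] is intertwined; cancelling the invertible [X] leaves [Y]. *)
- move=> i hi i0; have := CH i; rewrite /frame_res (negbTE i0) /frame_res1 hi mulmxBl mulmxBr scalar_mxC => /addrI /oppr_inj.
  rewrite -mulmxA => E; rewrite -[LHS](mulKmx (uX' i)) E.
  by rewrite (mulmxA (H i)) -HX -!mulmxA mulKmx.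
- by move=> i hi; rewrite H0 /H (framed_Xreg gd hi) (framed_Xreg gd' hi) invmx1 mul1mx mulmx1.
- by move=> i j l; case: (GP i j).
- by move=> i j l; case: (GP i j).
Qed.

Lemma fullv_neq0 m : (0 < m)%N -> (0%VS : {vspace 'cV[F]_m}) <> fullv.
Proof.
case: m => // m _ e; have : (const_mx 1 : 'cV[F]_m.+1) \in 0%VS by rewrite e memvf.
by rewrite memv0 => /eqP /matrixP /(_ 0 0); rewrite !mxE => /eqP; rewrite oner_eq0.
Qed.

(** Kernels along the legs lie in [maxext] of 0, a subrepresentation vanishing on the base; dually,
    [minext] of the full base spaces is a nonzero subrepresentation made of images. *)
Lemma irr_isleg (d : data) : leg_rel d -> rep_irr (data_rep d) -> hisleg d.
Proof.
move=> lr irr.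
pose j0 : blk ord0 := Ordinal (nblk_gt0 ord0).
have rf i (j : blk i) l : row_full (da d j l).
  pose Lx i (j : blk i) := maxext (da d j) 0%VS.
  have ab0 i' (j' : blk i') v : v \in (0%VS : {vspace 'cV_(lgd i' j' 0)}) -> da d j' 0%N *m db d j' 0%N *m v \in (0%VS : {vspace 'cV_(lgd i' j' 0)}).
    by rewrite memv0 => /eqP ->; rewrite mulmx0 mem0v.
  have [] := irr (sub_at Lx).
  - apply: (data_subrep (W := fun=> 0%VS)) => //.
    + by move=> i' j' v; rewrite !memv0 => /eqP ->; rewrite mulmx0.
    + by move=> i' j' v; rewrite !memv0 => /eqP ->; rewrite mulmx0.
    + by move=> i' _ _ v; rewrite !memv0 => /eqP ->; rewrite mulmx0.
    + by move=> i' _ _ v; rewrite !memv0 => /eqP ->; rewrite mulmx0.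
    + by move=> i' _ j1 j2 c _ _ v; rewrite !memv0 => /eqP ->; rewrite mulmx0.
    + by move=> i' j' l' v; exact: maxext_a.
    + by move=> i' j' l' v; apply: (maxext_b (lr i' j')); exact: ab0.
  - move=> L0; apply: row_full_inj => v av.
    have [h|h] := leqP (leg xi j) l; first exact: (legdim0_eq (lgd_big (h : (leg xi j < l.+1)%N))).
    have : v \in sub_at Lx (Vleg (Ordinal h)) by rewrite mem_preim_mx av mem0v.
    by rewrite L0 memv0 => /eqP.
  - move=> /(_ (Vbase xi (ord0_irr B) j0)) e; case: (fullv_neq0 (bsize_gt0 j0) e).
have rb i (j : blk i) l : row_free (db d j l).
  pose Ln i (j : blk i) := minext (db d j) fullv.
  have [] := irr (sub_at Ln).
  - apply: (data_subrep (W := fun=> fullv)) => //; do ?[by move=> *; exact: memvf].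
    + by move=> i' j' l' v; apply: (minext_a (lr i' j')) => ? _; exact: memvf.
    + by move=> i' j' l' v; exact: minext_b.
  - move=> /(_ (Vbase xi (ord0_irr B) j0)) /esym e; case: (fullv_neq0 (bsize_gt0 j0) e).
  - move=> L1; apply: row_free_surj => w.
    have [h|h] := leqP (leg xi j) l.
      by exists 0; exact: (legdim0_eq (lgd_big (h : (leg xi j < l.+1)%N))).
    have : w \in sub_at Ln (Vleg (Ordinal h)) by rewrite L1 memvf.
    by case/img_mxP => v _ ->; exists v.
by move=> i j; split; [exact: rf|exact: rb|exact: lr].
Qed.

Section Stable.
Variables (i : 'I_p.+1) (W : {vspace 'cV[F]_n.+1}) (x : nat -> M).

(** Stability is a unary condition, obtained from [hrel_fwd] with a relation that ignores its second
    argument. *)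
Lemma stab_fwd : (forall c, (c < (k i).-1)%N -> forall v, v \in W -> (hY i x)`_c *m v \in W) ->
  (forall j v, v \in W -> idem i j *m v \in W) /\
  (forall (j j' : blk i) l, j != j' -> (l < irr_mult j j')%N ->
     forall v, v \in W -> idem i j' *m x l *m idem i j *m v \in W).
Proof.
move=> YW; apply: (hrel_fwd (Rel := fun a _ => forall v, v \in W -> a *m v \in W) _ _ _ _ (x := x) (x' := x)) => //.
- by move=> a _ b _ sa sb v vW; rewrite mulmxDl; apply: rpredD; [exact: sa|exact: sb].
- by move=> a _ b _ sa sb v vW; rewrite -mulmxA; exact/sa/sb.
- by move=> r a _ sa v vW; rewrite -scalemxAl; exact/memvZ/sa.
- by move=> v vW; rewrite mul1mx.
Qed.

Lemma stab_bwd : (forall j v, v \in W -> idem i j *m v \in W) ->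
  (forall (j j' : blk i) l, j != j' -> (l < irr_mult j j')%N ->
     forall v, v \in W -> idem i j' *m x l *m idem i j *m v \in W) ->
  forall c v, v \in W -> (hY i x)`_c *m v \in W.
Proof.
move=> EW xW; apply: (hrel_bwd (Rel := fun a _ => forall v, v \in W -> a *m v \in W) _ _ _ _ (x := x) (x' := x)) => //.
- by move=> a _ b _ sa sb v vW; rewrite mulmxDl; apply: rpredD; [exact: sa|exact: sb].
- by move=> a _ b _ sa sb v vW; rewrite -mulmxA; exact/sa/sb.
- by move=> r a _ sa v vW; rewrite -scalemxAl; exact/memvZ/sa.
- by move=> v vW; rewrite mul1mx.
Qed.

End Stable.

Lemma data_conn_res (d : data) i : data_conn d i (Ordinal (k_gt0 i)) = invmx (dX d i) *m frame_res d i *m dX d i.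
Proof. by []. Qed.

Lemma data_conn_coef (d : data) i c (ck : (c < (k i).-1)%N) : exists l : 'I_(k i), (k i - l.+1 = c)%N /\
  data_conn d i l = invmx (dX d i) *m (hY i (dx d i))`_c *m dX d i.
Proof.
have lk : (k i - c.+1 < k i)%N by move: ck (k_gt0 i); clear; lia.
exists (Ordinal lk); rewrite /data_conn /=.
have -> : (k i - c.+1 == 0)%N = false by move: ck (k_gt0 i); clear; lia.
by have -> : (k i - (k i - c.+1).+1 = c)%N by move: ck (k_gt0 i); clear; lia.
Qed.

(** An invariant [U] is carried by [X_i] to every pole, where [stab_fwd] makes it compatible with
    the blocks, and extended to the legs by [minext]; [block_rel] gives the stability under
    [da *m db] which that requires. *)
Lemma data_conn_irr (d : data) : framed d -> block_rel d -> leg_rel d -> rep_irr (data_rep d) -> pparts_irr (data_conn d).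
Proof.
move=> gd br lr irr U SU.
have uX i : dX d i \in unitmx by case: gd.
pose W i := (linfun (mulmx (dX d i) : 'cV_n.+1 -> 'cV_n.+1) @: U)%VS.
have SW i (Z : M) : (forall v, v \in U -> invmx (dX d i) *m Z *m dX d i *m v \in U) ->
    forall v, v \in W i -> Z *m v \in W i.
  move=> ZU v /img_mxP[u uU ->].
  have -> : Z *m (dX d i *m u) = dX d i *m (invmx (dX d i) *m Z *m dX d i *m u).
    by rewrite -!mulmxA mulKVmx.
  exact/mem_img_mx/ZU.
have CW i v : v \in W i -> frame_res d i *m v \in W i by apply: SW => u; rewrite -data_conn_res; exact: SU.
have YW i c : (c < (k i).-1)%N -> forall v, v \in W i -> (hY i (dx d i))`_c *m v \in W i.
  by move=> ck; apply: SW => u; have [l [_ <-]] := data_conn_coef d ck; exact: SU.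
have EW i := (stab_fwd (YW i)).1; have xW i := (stab_fwd (YW i)).2.
have YrW i v : v \in W i -> hYr d i *m v \in W i by exact: (stab_bwd (EW i) (xW i)).
have W0 : W ord0 = U.
  apply/vspaceP => v; rewrite /W (framed_X0 gd); apply/idP/idP => [/img_mxP[u uU ->]|vU]; first by rewrite mul1mx.
  by rewrite -[v]mul1mx; exact: mem_img_mx.
pose L i (j : blk i) := minext (db d j) (linfun (mulmx (proj i j) : 'cV_n.+1 -> 'cV_(bsize (B i) j)) @: W i)%VS.
have abL i (j : blk i) v : v \in L i j 0%N -> da d j 0%N *m db d j 0%N *m v \in L i j 0%N.
  move=> /img_mxP[w wW ->].
  have abE : da d j 0%N *m db d j 0%N =
      proj i j *m frame_res d i *m inc i j - proj i j *m hYr d i *m inc i j - (xi0 i j)%:M :> 'M[F]_(bsize (B i) j).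
    by rewrite br mulmxDr mulmxDl hproj_hR addrK addrC addKr.
  have -> : da d j 0%N *m db d j 0%N *m (proj i j *m w)
     = proj i j *m (frame_res d i *m (idem i j *m w) - hYr d i *m (idem i j *m w) - xi0 i j *: w).
    by rewrite abE !(mulmxDl, mulmxDr, mulNmx, mulmxN) mul_scalar_mx -scalemxAr !mulmxA.
  by apply: mem_img_mx; rewrite !rpredB ?memvZ // ?CW ?YrW ?EW.
have [|L0|L1] := irr (sub_at L).
- apply: (data_subrep (W := W)).
  + by move=> i j v vW; exact: mem_img_mx.
  + by move=> i j v /img_mxP[w wW ->]; rewrite mulmxA; exact: EW.
  + by move=> i _ _ v; rewrite W0 => vU; exact: mem_img_mx.
  + move=> i hi i0 v vW; rewrite W0; have := CW i v vW; move: vW => /img_mxP[u uU ->].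
    rewrite /frame_res (negbTE i0) /frame_res1 hi mulmxBl mul_scalar_mx => cW.
    (* [W i] is stable under [zeta - X Y], hence under [X Y]; then [X] is cancelled to get back into
       [U]. *)
    have : dX d i *m (dY d i *m (dX d i *m u)) \in W i.
      have zW : zeta *: (dX d i *m u) \in W i by exact/memvZ/mem_img_mx.
      by rewrite mulmxA -[X in X \in _](subKr (zeta *: (dX d i *m u))) rpredB.
    by case/img_mxP => u' u'U /(congr1 (mulmx (invmx (dX d i)))); rewrite !mulKmx // => ->.
  + by move=> i _; exact: xW.
  + by move=> i hi; rewrite /W (framed_X0 gd) (framed_Xreg gd hi).
  + by move=> i j l v; apply: (minext_a (lr i j)); exact: abL.
  + by move=> i j l v; exact: minext_b.
- left; apply/eqP; rewrite -subv0; apply/subvP => v; rewrite -W0 memv0 => vW; apply/eqP.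
  apply: (rows_eq (i := ord0)) => j; rewrite mulmx0; apply/eqP.
  by rewrite -memv0 -(L0 (Vbase xi (ord0_irr B) j)); exact: mem_img_mx.
- right; apply/vspaceP => v; rewrite memvf -W0.
  rewrite -[v]mul1mx -[1%:M](bidem_sum (B ord0)) mulmx_suml; apply: rpred_sum => j _.
  have : proj ord0 j *m v \in L ord0 j 0%N.
    by have -> : L ord0 j 0%N = fullv := L1 (Vbase xi (ord0_irr B) j); exact: memvf.
  by case/img_mxP => w wW e; rewrite -mulmxA e mulmxA; exact: EW.
Qed.

Definition bdiag i (D : forall j, 'M[F]_(bsize (B i) j)) : M := \sum_j inc i j *m D j *m proj i j.

Lemma bdiagM i (D D' : forall j, 'M[F]_(bsize (B i) j)) :
  bdiag D *m bdiag D' = bdiag (fun j => D j *m D' j).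
Proof.
rewrite /bdiag mulmx_suml; apply: eq_bigr => j _.
rewrite mulmx_sumr (bigD1 j) //= big1 ?addr0 => [|l lj].
  by rewrite -!mulmxA (mulmxA (proj i j)) hprojK mul1mx.
by rewrite -!mulmxA (mulmxA (proj i j)) hproj0 1?eq_sym // mul0mx !mulmx0.
Qed.

Lemma bdiag_idem i (D : forall j, 'M[F]_(bsize (B i) j)) j : bdiag D *m idem i j = idem i j *m bdiag D.
Proof.
rewrite mulmx_suml mulmx_sumr; apply: eq_bigr => l _.
have [->|lj] := eqVneq l j.
  by rewrite -!mulmxA (mulmxA (proj i j)) hprojK mul1mx (mulmxA (proj i j)) hprojK mul1mx.
by rewrite -!mulmxA (mulmxA (proj i l)) hproj0 // mul0mx !mulmx0 (mulmxA (proj i j)) hproj0 1?eq_sym // mul0mx !mulmx0.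
Qed.

Lemma bdiag_inv i (D : forall j, 'M[F]_(bsize (B i) j)) : (forall j, D j \in unitmx) ->
  bdiag D \in unitmx /\ invmx (bdiag D) = bdiag (fun j => invmx (D j)).
Proof.
move=> uD; have e : bdiag D *m bdiag (fun j => invmx (D j)) = 1%:M.
  rewrite bdiagM -[RHS](bidem_sum (B i)); apply: eq_bigr => j _.
  by rewrite mulmxV // mulmx1.
have [u _] := mulmx1_unit e; split=> //.
by rewrite -[RHS](mulKmx u) e mulmx1.
Qed.

(** [isleg_conj] at each block provides a block diagonal [h] that conjugates [fullres] to [hR], as
    [torbit_bwd] asks. *)
Lemma data_conn_torbit (d : data) i : framed d -> block_rel d -> hisleg d -> torbit (htl_ppart (B i)) (data_conn d i).
Proof.
move=> gd br ld; have uX : dX d i \in unitmx by case: gd.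
have hH (j : blk i) : exists h : 'M[F]_(bsize (B i) j), h \in unitmx /\
    (xi0 i j)%:M + da d j 0%N *m db d j 0%N = h *m bres (B i) j *m invmx h.
  by have [h uh e] := isleg_conj (xi_gt0 j) (xi_res j) (ld i j); exists h.
have /dep_choice[h hP] := hH.
have [uh ih] := bdiag_inv (fun j => (hP j).1).
have RE : hR d i = bdiag h *m fullres (B i) *m invmx (bdiag h).
  rewrite ih -[fullres _]/(bdiag (bres (B i))) !bdiagM.
  by apply: eq_bigr => j _; rewrite (hP j).2.
apply: (torbit_bwd (k_gt0 i) (htree_wf i) (htree_leaves i) (g := invmx (dX d i)) (h := bdiag h) (x := dx d i)) => //.
- by rewrite unitmx_inv.
- by move=> j; exact: bdiag_idem.
- move=> c ck; rewrite conj_coef invmxK.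
  by have [l [lc e]] := data_conn_coef d ck; rewrite -lc pp_coef e lc.
- move=> j; rewrite -!mulmxE -RE invmxK.
  have -> : (pp (data_conn d i))`_(k i).-1 = invmx (dX d i) *m frame_res d i *m dX d i.
    by rewrite -data_conn_res -pp_coef subn1.
  rewrite -/(hYr d i); have -> : dX d i *m (invmx (dX d i) *m frame_res d i *m dX d i) *m invmx (dX d i) = frame_res d i.
    by rewrite -!mulmxA mulmxV // mulmx1 mulKVmx.
  have e : proj i j *m (frame_res d i - hYr d i) *m inc i j = proj i j *m hR d i *m inc i j.
    by rewrite mulmxBr mulmxBl br mulmxDr mulmxDl addrK.
  by have := congr1 (fun Z => inc i j *m Z *m proj i j) e; rewrite /= -!mulmxA.
Qed.

(** * From connections to representations *)

(** Conjugation at level 0 only touches the two maps adjacent to it. *)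
Lemma isleg_exists_conj m (R : 'M[F]_m) (s : seq F) (h : 'M[F]_m) :
  \prod_(c <- s) (R - c%:M) = 0 -> h \in unitmx ->
  exists (a : forall l, 'M[F]_(legdim R s l, legdim R s l.+1))
         (b : forall l, 'M[F]_(legdim R s l.+1, legdim R s l)),
    isleg a b /\ (nth 0 s 0%N)%:M + a 0%N *m b 0%N = h *m R *m invmx h.
Proof.
move=> s0 uh; have [a [b [[fa fb ab] RE]]] := isleg_exists s0.
exists (fun l => match l return 'M[F]_(legdim R s l, legdim R s l.+1) with
  | 0 => h *m a 0%N | l.+1 => a l.+1 end).
exists (fun l => match l return 'M[F]_(legdim R s l.+1, legdim R s l) with
  | 0 => b 0%N *m invmx h | l.+1 => b l.+1 end).
split; last first.
  transitivity (h *m ((nth 0 s 0%N)%:M + a 0%N *m b 0%N) *m invmx h); last by rewrite -RE.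
  by rewrite mulmxDr mulmxDl scalar_mxC -(mulmxA _ h) mulmxV // mulmx1 !mulmxA.
split.
- case=> [|l] //; have /row_fullP[c ca] := fa 0%N.
  by apply/row_fullP; exists (c *m invmx h); rewrite -mulmxA mulKmx.
- case=> [|l] //; have /row_freeP[c bc] := fb 0%N.
  by apply/row_freeP; exists (h *m c); rewrite -mulmxA mulKmx.
- case=> [|l] //; rewrite -ab; congr (_ - _).
  by rewrite -mulmxA mulKmx.
Qed.

(** With one block the only idempotent is 1 and no block of [x] enters, so commuting with every
    matrix is inherited by the coefficients. *)
Lemma hY_reg_central i x c (N : M) : i \notin Iirr B -> (hY i x)`_c *m N = N *m (hY i x)`_c.
Proof.
move=> hi; move: N; apply: (hrel_bwd (i := i) (Rel := fun a _ => forall N, a *m N = N *m a) _ _ _ _ (x := x) (x' := x)).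
- by move=> a _ b _ ea eb N; rewrite mulmxDl mulmxDr ea eb.
- by move=> a _ b _ ea eb N; rewrite -mulmxA eb !mulmxA ea.
- by move=> r a _ ea N; rewrite -scalemxAl -scalemxAr ea.
- by move=> N; rewrite mul1mx mulmx1.
- by move=> j N; rewrite /bidem reg_idem // mul1mx mulmx1.
- by move=> j j' l jj; rewrite (reg_nblk j j' hi) eqxx in jj.
Qed.

Lemma bidem_diag i (Z Z' : M) j : idem i j *m Z *m idem i j = idem i j *m Z' *m idem i j ->
  proj i j *m Z *m inc i j = proj i j *m Z' *m inc i j.
Proof. by move=> e; have := congr1 (fun A => proj i j *m A *m inc i j) e; rewrite !idem_sandwich. Qed.

Lemma conjK (V Z : M) : V \in unitmx -> invmx V *m (V *m Z *m invmx V) *m V = Z.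
Proof. by move=> uV; rewrite -!mulmxA mulVmx // mulmx1 mulKmx. Qed.

Lemma reg_sandwich i (j : blk i) (Z : M) : i \notin Iirr B ->
  inc i j *m (proj i j *m Z *m inc i j) *m proj i j = Z.
Proof. by move=> hi; rewrite -!mulmxA reg_idem // mulmx1 mulmxA reg_idem // mul1mx. Qed.

Lemma data_exists (A : pparts F n.+1 k) :
  (forall i, torbit (htl_ppart (B i)) (A i)) -> \sum_(i < p.+1) residue A i = 0 ->
  exists (d : data) (g : M), [/\ framed d, g \in unitmx, block_rel d, hisleg d &
    data_conn d = fun i l => g *m A i l *m invmx g].
Proof.
move=> oA sA.
have tA i := torbit_fwd (k_gt0 i) (htree_wf i) (htree_leaves i) (oA i).
have [g gP] := dep_choice tA; have {gP}[x gx] := dep_choice gP.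
pose ri i : 'I_(k i) := Ordinal (k_gt0 i).
have ug i : g i \in unitmx by case: (gx i).
have coefA i (l : 'I_(k i)) : l != 0%N :> nat -> A i l = g i *m (hY i (x i))`_(k i - l.+1) *m invmx (g i).
  move=> l0; have [_ e _] := gx i; have := e (k i - l.+1)%N; rewrite pp_coef conj_coef; apply.
  by have := ltn_ord l; move: l0 (k_gt0 i); clear; lia.
have resA i j : proj i j *m (invmx (g i) *m A i (ri i) *m g i - (hY i (x i))`_(k i).-1) *m inc i j = bres (B i) j.
  have [_ _ e] := gx i; rewrite -hproj_full; apply: bidem_diag; have := e j.
  by have -> : (pp (A i))`_(k i).-1 = A i (ri i) by rewrite -pp_coef subn1.
pose T i : M := invmx (g i) *m g ord0.
have uT i : T i \in unitmx by rewrite unitmx_mul unitmx_inv !ug.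
(* Outside [Iirr] no arrow can record the comparison of frames; there the legs are conjugated
   instead, by the inverse of [T i] in [Hh]. *)
pose X i : M := if i \in Iirr B then T i else 1%:M.
have uX i : X i \in unitmx by rewrite /X; case: ifP => // _; exact: unitmx1.
pose A' i l : M := invmx (g ord0) *m A i l *m g ord0.
pose C i := X i *m A' i (ri i) *m invmx (X i).
(* Solved from [zeta - X Y = C], [C i] being the residue in the frame of the pole. *)
pose Y i := invmx (X i) *m (zeta%:M - C i).
pose Hh i : M := if i \in Iirr B then 1%:M else invmx (T i).
have uHh i : Hh i \in unitmx by rewrite /Hh; case: ifP => _; rewrite ?unitmx1 ?unitmx_inv.
have HhE i j : Hh i *m idem i j = idem i j *m Hh i.
  have [hi|hi] := orP (orbN (i \in Iirr B)); last by rewrite /bidem reg_idem // mul1mx mulmx1.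
  by rewrite /Hh hi mul1mx mulmx1.
have legs i (j : blk i) := isleg_exists_conj (xi_res j) (unit_block (uHh i) (HhE i j)).
have /dep_choice[a aP] := fun i => dep_choice (legs i).
have /dep_choice[b bP] := fun i => dep_choice (aP i).
pose d := Data X Y x a b.
have CT i : T i *m A' i (ri i) *m invmx (T i) = invmx (g i) *m A i (ri i) *m g i.
  apply: (canLR (mulmxK (uT i))); by rewrite /A' /T -!mulmxA mulKVmx // mulKVmx.
have gd : framed d.
  split=> // i; rewrite negb_and negbK => ii; rewrite /= /X; case: ifP => // hi.
  by move: ii; rewrite hi /= => /eqP ->; rewrite /T mulVmx.
have RE i (hi : i \notin Iirr B) : hR d i = A' i (ri i).
  have j := Ordinal (nblk_gt0 i).
  have e1 : invmx (g i) *m A i (ri i) *m g i = inc i j *m bres (B i) j *m proj i j.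
    by rewrite -(resA i j) -[(hY i (x i))`_ _]/(hYr d i) hYr_reg // subr0 reg_sandwich.
  rewrite /hR (big_pred1 j) => [|j']; last by apply/esym/eqP; exact: reg_nblk.
  have Ti : Hh i = invmx (T i) by rewrite /Hh (negbTE hi).
  have uh := unit_block (uHh i) (HhE i j).
  have [_] := bP i j; rewrite /= => ->.
  rewrite !mulmxA -(mulmxA (inc i j)) -(mulmxA (inc i j) _ (inc i j)) -inc_comm //.
  have hp : invmx (proj i j *m Hh i *m inc i j) *m proj i j = proj i j *m T i.
    apply: (canLR (mulKmx uh)); rewrite mulmxA -proj_comm // Ti.
    by rewrite -(mulmxA (proj i j)) mulVmx // mulmx1.
  transitivity (Hh i *m (inc i j *m bres (B i) j *m proj i j) *m T i).
    by rewrite -(mulmxA _ (invmx _)) hp !mulmxA.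
  by rewrite -e1 -CT Ti conjK.
have CE i : frame_res d i = C i.
  have reg i' : i' \notin Iirr B -> X i' = 1%:M by rewrite /X => /negbTE ->.
  have irr i' : i' != ord0 -> frame_res1 d i' = C i'.
    rewrite /frame_res1 => i0; have [hi|hi] := orP (orbN (i' \in Iirr B)).
      by rewrite hi /= /Y mulKVmx // subKr.
    by rewrite (negbTE hi) RE // /C reg // mul1mx invmx1 mulmx1.
  rewrite /frame_res; have [i0|i0] := eqVneq i ord0; last exact: irr.
  have XCX i' : invmx (X i') *m C i' *m X i' = A' i' (ri i').
    by rewrite /C conjK.
  have X0 : X ord0 = 1%:M by rewrite /X ord0_irr /T mulVmx.
  have -> : C i = A' ord0 (ri ord0) by rewrite i0 -XCX X0 invmx1 mul1mx mulmx1.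
  have S0 : \sum_i A' i (ri i) = 0.
    rewrite -mulmx_suml -mulmx_sumr; have := sA.
    under eq_bigr => i' _ do rewrite /residue (big_pred1 (ri i')) //.
    by move=> ->; rewrite mulmx0 mul0mx.
  move: S0; rewrite (bigD1 ord0) //= => /eqP; rewrite addr_eq0 => /eqP ->; congr (- _).
  by apply: eq_bigr => i' i'0; rewrite irr.
exists d, (invmx (g ord0)); split=> //.
- by rewrite unitmx_inv.
- move=> i j; have [hi|hi] := orP (orbN (i \in Iirr B)); last first.
    rewrite hYr_reg // addr0 CE RE // /C /X (negbTE hi) invmx1 mul1mx mulmx1.
    by [].
  rewrite CE mulmxDr mulmxDl hproj_hR; have [_ ->] := bP i j.
  rewrite /Hh hi mulmx1 hprojK mul1mx invmx1 mulmx1 -[X in X + _](resA i j) mulmxBr mulmxBl subrK.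
  by rewrite -CT /C /X hi.
- by move=> i j; have [] := bP i j.
- apply/functional_extensionality_dep => i; apply/functional_extensionality_dep => l.
  rewrite invmxK -/(A' i l) /data_conn /=; case: ifP => [/eqP l0|/negbT l0].
    have -> : l = ri i by exact/val_inj.
    by rewrite CE /C conjK.
  have -> : A' i l = invmx (T i) *m (hY i (x i))`_(k i - l.+1) *m T i.
    have -> : invmx (T i) = invmx (g ord0) *m g i.
      by rewrite -[RHS](mulKmx (uT i)) /T -!mulmxA mulKVmx // mulVmx // mulmx1.
    by rewrite /A' coefA // /T !mulmxA.
  have [hi|hi] := orP (orbN (i \in Iirr B)); first by rewrite /X hi.
  (* Outside [Iirr] the irregular coefficients are central, so it is harmless that [X] forgets
     [T i]. *)
  rewrite /X (negbTE hi) invmx1 mul1mx mulmx1 -mulmxA hY_reg_central // mulKmx //.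
Qed.

Lemma big_hvert (V : zmodType) (f : hvert xi -> V) :
  \sum_(a : hvert xi) f a =
    \sum_i \sum_(hi : holds (i \in Iirr B)) \sum_(j : blk i) f (Vbase xi (proj2_sig hi) j)
  + \sum_i \sum_(j : blk i) \sum_(l : 'I_(leg xi j)) f (Vleg l).
Proof.
have decK : cancel (@hvert_decode F n.+1 p k B xi) (@hvert_encode F n.+1 p k B xi).
  by case=> [[[i hi] j]|[i [j l]]].
rewrite (reindex (@hvert_decode F n.+1 p k B xi)) /=; last first.
  by apply: onW_bij; exists (@hvert_encode F n.+1 p k B xi) => //; exact: hvert_encodeK.
rewrite big_sumType /=; congr (_ + _).
  rewrite -(@sum_sub _ _ (fun i => i \in Iirr B) (fun i hi => \sum_(j : blk i) f (Vbase xi hi j))).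
  by apply: sum_sig2 => -[i hi] j.
by apply: sum_sig3 => i j l.
Qed.

(* The shift [zeta] is generic with respect to the finitely many dimension
   vectors of possible subrepresentations. *)
Definition avoids := forall dv : vert Q -> nat, (forall a, dv a <= alpha a)%N ->
  \sum_a shifted_lambda a * (dv a)%:R = 0 -> \sum_a lambda_shift a * (dv a)%:R = 0.

Hypothesis natr_inj : injective (fun m : nat => m%:R : F).
Hypothesis zeta_avoids : avoids.

(** * Subrepresentations for a generic shift *)

Section Subrep.
Variable d : data.
Hypothesis gd : framed d.
Hypothesis br : block_rel d.
Hypothesis lr : leg_rel d.
Variable U : forall a : vert Q, {vspace 'cV[F]_(alpha a)}.
Hypothesis xU : forall r (v : 'cV[F]_(alpha (@src (Defs.double Q) r))),
  v \in U (@src (Defs.double Q) r) -> data_rep d r *m v \in U (@tgt (Defs.double Q) r).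

Definition Ub i (hi : i \in Iirr B) j : {vspace 'cV[F]_(bsize (B i) j)} := U (Vbase xi hi j).

Definition Ublk i (hi : i \in Iirr B) : {vspace 'cV[F]_n.+1} :=
  (\sum_j linfun (mulmx (inc i j) : 'cV_(bsize (B i) j) -> 'cV_n.+1) @: Ub hi j)%VS.

Lemma mem_Ublk i (hi : i \in Iirr B) v :
  v \in Ublk hi <-> forall j, proj i j *m v \in Ub hi j.
Proof.
split=> [/memv_sumP[w wU ->] j|vU].
  rewrite mulmx_sumr (bigD1 j) //= big1 ?addr0 => [|l lj].
    by have /img_mxP[u uU ->] := wU j isT; rewrite mulmxA hprojK mul1mx.
  by have /img_mxP[u uU ->] := wU l isT; rewrite mulmxA hproj0 ?mul0mx // eq_sym.
rewrite -[v]mul1mx -[1%:M](bidem_sum (B i)) mulmx_suml.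
by apply: memv_sumr => j _; rewrite -mulmxA; exact/mem_img_mx/vU.
Qed.

Lemma dim_Ublk i (hi : i \in Iirr B) : \dim (Ublk hi) = (\sum_j \dim (Ub hi j))%N.
Proof.
have dir : directv (\sum_j linfun (mulmx (inc i j) : 'cV_(bsize (B i) j) -> 'cV_n.+1) @: Ub hi j)%VS.
  apply/directv_sum_independent => us usU us0 j _.
  have /img_mxP[u uU e] := usU j isT.
  have := congr1 (mulmx (proj i j)) us0; rewrite mulmx0 mulmx_sumr (bigD1 j) //= big1 ?addr0 => [|l lj].
    by rewrite e mulmxA hprojK mul1mx => ->; rewrite mulmx0.
  by have /img_mxP[w _ ->] := usU l isT; rewrite mulmxA hproj0 ?mul0mx // eq_sym.
rewrite /Ublk (directvP dir) /=; apply: eq_bigr => j _; apply: dim_img_mx => v e.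
by rewrite -[v]mul1mx -(hprojK j) -mulmxA e mulmx0.
Qed.

Lemma Ublk_X i (hi : i \in Iirr B) v : i != ord0 -> v \in Ublk (ord0_irr B) -> dX d i *m v \in Ublk hi.
Proof.
move=> h0 /mem_Ublk vU; apply/mem_Ublk => j'.
rewrite -[v]mul1mx -[1%:M](bidem_sum (B ord0)) mulmx_suml !mulmx_sumr; apply: rpred_sum => j _.
by have := xU (r := inl (Across xi j hi h0 j')) (vU j); rewrite /= !mulmxA.
Qed.

Lemma Ublk_Y i (hi : i \in Iirr B) v : i != ord0 -> v \in Ublk hi -> dY d i *m v \in Ublk (ord0_irr B).
Proof.
move=> h0 /mem_Ublk vU; apply/mem_Ublk => j'.
rewrite -[v]mul1mx -[1%:M](bidem_sum (B i)) mulmx_suml !mulmx_sumr; apply: rpred_sum => j _.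
by have := xU (r := inr (Across xi j' hi h0 j)) (vU j); rewrite /= !mulmxA.
Qed.

Lemma Ublk_E i (hi : i \in Iirr B) j v : v \in Ublk hi -> idem i j *m v \in Ublk hi.
Proof.
move=> /mem_Ublk vU; apply/mem_Ublk => j'; rewrite -mulmxA mulmxA.
have [->|jj] := eqVneq j' j; first by rewrite hprojK mul1mx.
by rewrite hproj0 // mul0mx mem0v.
Qed.

Lemma Ublk_x i (hi : i \in Iirr B) (j j' : blk i) c v : j != j' -> (c < irr_mult j j')%N ->
  v \in Ublk hi -> idem i j' *m dx d i c *m idem i j *m v \in Ublk hi.
Proof.
move=> jj cm /mem_Ublk vU; apply/mem_Ublk => i2.
have [->|i2j] := eqVneq i2 j'; last by rewrite !mulmxA hproj0 // !mul0mx mem0v.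
rewrite -!mulmxA (mulmxA (proj i j')) hprojK mul1mx !mulmxA -(mulmxA _ (proj i j)).
have [lt|[lt|/val_inj eqj]] : (j < j')%N \/ (j' < j)%N \/ j = j' :> nat.
- by case: (ltngtP j j') => h; [left|right; left|right; right].
- have := xU (r := inl (Airr xi hi lt (Ordinal cm))) (vU j); rewrite /= => /(memvZ (hside j j')).
  by rewrite -scalemxAl scalerA hside_sqr // scale1r.
- have := cm; rewrite irr_multC => cm'.
  by have := xU (r := inr (Airr xi hi lt (Ordinal cm'))) (vU j).
by rewrite eqj eqxx in jj.
Qed.

Lemma Ublk_dim i (hi : i \in Iirr B) : i != ord0 -> \dim (Ublk hi) = \dim (Ublk (ord0_irr B)).
Proof.
move=> i0.
have /dep_choice[W WE] i' : exists w : nat, forall h : i' \in Iirr B, w = \dim (Ublk h).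
  have [h|h] := orP (orbN (i' \in Iirr B)); last by exists 0%N => h'; case/negP: h.
  by exists (\dim (Ublk h)) => h'; rewrite (bool_irrelevance h' h).
have mo : forall a, moment (data_rep d) a = (shifted_lambda a)%:M by apply/momentP.
have dimle (a : vert Q) : (\dim (U a) <= alpha a)%N.
  by have := dimvS (subvf (U a)); rewrite dimvf dim_matrix mulr1.
(* Genericity extracts from the trace identity the vanishing of the part paired with [lambda_shift],
   in which the legs do not occur. *)
have := zeta_avoids dimle (trace_subrep mo xU); rewrite big_hvert /=.
rewrite [X in _ + X]big1 ?addr0 => [|i' _]; last by do 2! [apply: big1 => ? _]; rewrite mul0r.
pose sh (i' : 'I_p.+1) : F := if i' == ord0 then - (#|Iirr B :\ ord0|%SET)%:R else 1.
have -> : \sum_i' \sum_(hi' : holds (i' \in Iirr B)) \sum_(j : blk i')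
    sh i' * (\dim (U (Vbase xi (proj2_sig hi') j)))%:R = \sum_(i' in Iirr B) sh i' * (W i')%:R.
  rewrite -[RHS]sum_filter; apply: eq_bigr => i' _; apply: eq_bigr => hi' _.
  by rewrite -mulr_sumr -natr_sum (WE _ (proj2_sig hi')) dim_Ublk.
rewrite (bigD1 ord0) ?ord0_irr //= {1}/sh eqxx mulNr -natrM => /eqP; rewrite addrC subr_eq0.
have -> : \sum_(i' in Iirr B | i' != ord0) sh i' * (W i')%:R = (\sum_(i' in Iirr B :\ ord0) W i')%N%:R.
  rewrite natr_sum; apply: eq_big => [i'|i' /andP[_ /negbTE e]]; first by rewrite !inE andbC.
  by rewrite /sh e mul1r.
move=> /eqP /natr_inj; rewrite -sum_nat_const => e.
have le i' : i' \in (Iirr B :\ ord0)%SET -> (W ord0 <= W i' ?= iff (W ord0 == W i'))%N.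
  rewrite in_setD1 => /andP[i'0 h]; apply/leqif_eq.
  rewrite (WE _ h) (WE _ (ord0_irr B)).
  have <- : \dim (linfun (mulmx (dX d i') : 'cV_n.+1 -> 'cV_n.+1) @: Ublk (ord0_irr B)) = \dim (Ublk (ord0_irr B)).
    apply: dim_img_mx => v Xv; have [_ uX] := gd; rewrite -[v](mulKmx (uX i')) Xv mulmx0.
    by [].
  by apply: dimvS; apply/subvP => v /img_mxP[u uU ->]; exact: Ublk_X.
(* Equality of the sums forces equality in each of the inequalities [le]. *)
have [_] := leqif_sum le; rewrite e eqxx => /esym /forall_inP /(_ i).
by rewrite in_setD1 i0 hi => /(_ isT) /eqP; rewrite (WE _ hi) (WE _ (ord0_irr B)) => ->.
Qed.

(** Equal dimensions make the embedding by [X] onto; this allows conjugating back to the frame of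
    pole 0. *)
Lemma Ublk_lift i (hi : i \in Iirr B) w : w \in Ublk hi -> exists2 v, v \in Ublk (ord0_irr B) & w = dX d i *m v.
Proof.
move=> wU; have [/eqP i0|i0] := orP (orbN (i == ord0)).
  case: _ / (esym i0) hi wU => hi wU; exists w; last by rewrite (framed_X0 gd) mul1mx.
  by rewrite (bool_irrelevance (ord0_irr B) hi).
move: wU; suff -> : Ublk hi = (linfun (mulmx (dX d i) : 'cV_n.+1 -> 'cV_n.+1) @: Ublk (ord0_irr B))%VS.
  by move=> /img_mxP[v vU ->]; exists v.
apply/esym/eqP; rewrite eqEdim; apply/andP; split.
  by apply/subvP => v /img_mxP[u uU ->]; exact: Ublk_X.
rewrite (Ublk_dim hi i0) dim_img_mx // => v Xv; have [_ uX] := gd.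
by rewrite -[v](mulKmx (uX i)) Xv mulmx0.
Qed.

Lemma Ublk_hY i (hi : i \in Iirr B) c v : v \in Ublk hi -> (hY i (dx d i))`_c *m v \in Ublk hi.
Proof. by apply: stab_bwd => [j w|j j' l jj lm w]; [exact: Ublk_E|exact: Ublk_x]. Qed.

Lemma Ublk_conj i (hi : i \in Iirr B) (Z : M) : (forall v, v \in Ublk hi -> Z *m v \in Ublk hi) ->
  forall v, v \in Ublk (ord0_irr B) -> invmx (dX d i) *m Z *m dX d i *m v \in Ublk (ord0_irr B).
Proof.
move=> ZU v vU; have [_ uX] := gd.
have XU : dX d i *m v \in Ublk hi.
  have [/eqP i0|i0] := orP (orbN (i == ord0)); last exact: Ublk_X.
  case: _ / (esym i0) hi ZU => hi _; rewrite (framed_X0 gd) mul1mx.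
  by rewrite (bool_irrelevance hi (ord0_irr B)).
have [w wU e] := Ublk_lift (ZU _ XU).
by rewrite -!mulmxA e mulKmx.
Qed.

Lemma Ublk_leg i (hi : i \notin Iirr B) (j : blk i) v : v \in Ublk (ord0_irr B) ->
  inc i j *m (da d j 0%N *m db d j 0%N) *m proj i j *m v \in Ublk (ord0_irr B).
Proof.
move=> /mem_Ublk vU; have [h|h] := leqP 1 (leg xi j); last first.
  rewrite (legdim0_eqr (lgd_big (h : (leg xi j < 1)%N)) (da d j 0%N) 0) mul0mx mulmx0 !mul0mx.
  exact: mem0v.
have bU : db d j 0%N *m proj i j *m v \in U (Vleg (Ordinal h)).
  rewrite -[v]mul1mx -[1%:M](bidem_sum (B ord0)) mulmx_suml mulmx_sumr; apply: rpred_sum => j0 _.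
  by have := xU (r := inr (Areg hi h j0)) (vU j0); rewrite /= !mulmxA.
apply/mem_Ublk => j0; have := xU (r := inl (Areg hi h j0)) bU.
by rewrite /= !mulmxA.
Qed.

Lemma Ublk_data_conn i l v : v \in Ublk (ord0_irr B) -> data_conn d i l *m v \in Ublk (ord0_irr B).
Proof.
have [_ uX] := gd; pose U0 := Ublk (ord0_irr B).
have C1U i' : i' != ord0 -> forall w, w \in U0 -> invmx (dX d i') *m frame_res1 d i' *m dX d i' *m w \in U0.
  move=> i'0; rewrite /frame_res1; have [hi|hi] := orP (orbN (i' \in Iirr B)).
    rewrite hi; apply: (Ublk_conj (hi := hi)) => w wU; rewrite mulmxBl mul_scalar_mx -mulmxA.
    by apply: rpredB; [exact: memvZ|exact/Ublk_X/Ublk_Y].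
  rewrite (negbTE hi) (framed_Xreg gd hi) invmx1 mul1mx mulmx1 => w wU.
  have j := Ordinal (nblk_gt0 i').
  rewrite /hR (big_pred1 j) => [|j']; last by apply/esym/eqP; exact: reg_nblk.
  rewrite mulmxDr mulmxDl mul_mx_scalar -scalemxAl reg_idem // mulmxDl -scalemxAl mul1mx.
  by apply: rpredD; [exact: memvZ|exact: Ublk_leg].
have CU i' : forall w, w \in U0 -> invmx (dX d i') *m frame_res d i' *m dX d i' *m w \in U0.
  rewrite /frame_res; have [->|i'0] := eqVneq i' ord0; last exact: C1U.
  move=> w wU; rewrite (framed_X0 gd) invmx1 mul1mx mulmx1 mulNmx rpredN mulmx_suml.
  by apply: rpred_sum => i'' i''0; exact: C1U.
rewrite /data_conn; case: ifP => _; first exact: CU.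
have [hi|hi] := orP (orbN (i \in Iirr B)).
  by apply: (Ublk_conj (hi := hi)) => w; exact: Ublk_hY.
rewrite (framed_Xreg gd hi) invmx1 mul1mx mulmx1; apply: stab_bwd => [j w wU|j j' l' jj].
  by rewrite /bidem reg_idem // mul1mx.
by rewrite (reg_nblk j j' hi) eqxx in jj.
Qed.

Lemma inc_Ublk i (hi : i \in Iirr B) j (v : 'cV_(bsize (B i) j)) : v \in Ub hi j -> inc i j *m v \in Ublk hi.
Proof.
move=> vU; apply/mem_Ublk => l; rewrite mulmxA.
have [->|lj] := eqVneq l j; first by rewrite hprojK mul1mx.
by rewrite hproj0 // mul0mx mem0v.
Qed.

(** The space over pole 0 is invariant under the connection and determines the others: injectivity
    of [da] spreads 0 along the legs, surjectivity of [db] spreads everything. *)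
Lemma Ublk_irr : hisleg d -> pparts_irr (data_conn d) -> (forall a, U a = 0%VS) \/ (forall a, U a = fullv).
Proof.
move=> ld irr; have [_ uX] := gd.
have [U0|U1] := irr (Ublk (ord0_irr B)) (fun i l v vU => Ublk_data_conn l vU); [left|right].
  have eq0 m (V : {vspace 'cV[F]_m}) : (forall v, v \in V -> v = 0) -> V = 0%VS.
    by move=> V0; apply/eqP; rewrite -subv0; apply/subvP => v /V0 ->; rewrite mem0v.
  have b0 i (hi : i \in Iirr B) j : U (Vbase xi hi j) = 0%VS.
    apply: eq0 => v /inc_Ublk /Ublk_lift [w]; rewrite U0 memv0 => /eqP ->; rewrite mulmx0 => e.
    by rewrite -[v]mul1mx -(hprojK j) -mulmxA e mulmx0.
  have l0 i (j : blk i) l (h : (l < leg xi j)%N) : U (Vleg (Ordinal h)) = 0%VS.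
    have [aj _ _] := ld i j.
    elim: l h => [|l IH] h; apply: eq0 => v vU.
      apply: (row_full_mul0 (aj 0%N)).
      have [hi|hi] := orP (orbN (i \in Iirr B)).
        by have := xU (r := inl (Aend hi h)) vU; rewrite /= b0 memv0 => /eqP.
      suff e : inc i j *m (da d j 0%N *m v) = 0.
        by rewrite -[LHS]mul1mx -(hprojK j) -mulmxA e mulmx0.
      apply: (rows_eq (i := ord0)) => j0; rewrite mulmx0.
      by have := xU (r := inl (Areg hi h j0)) vU; rewrite /= b0 memv0 !mulmxA => /eqP.
    apply: (row_full_mul0 (aj l.+1)).
    by have := xU (r := inl (Aleg (l := Ordinal (ltnW h)) h)) vU; rewrite /= IH memv0 => /eqP.
  by case=> [i hi j|i j [l h]].
have eq1 m (V : {vspace 'cV[F]_m}) : (forall v, v \in V) -> V = fullv.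
  by move=> V1; apply/vspaceP => v; rewrite memvf V1.
have b1 i (hi : i \in Iirr B) j : U (Vbase xi hi j) = fullv.
  apply: eq1 => v; suff /mem_Ublk /(_ j) : inc i j *m v \in Ublk hi by rewrite mulmxA hprojK mul1mx.
  have [/eqP i0|i0] := orP (orbN (i == ord0)).
    case: _ / (esym i0) hi j v => hi j v.
    by rewrite (bool_irrelevance hi (ord0_irr B)) U1 memvf.
  rewrite -[_ *m _](mulKVmx (uX i)); apply: Ublk_X => //.
  by rewrite U1 memvf.
have l1 i (j : blk i) l (h : (l < leg xi j)%N) : U (Vleg (Ordinal h)) = fullv.
  have [_ bj _] := ld i j.
  elim: l h => [|l IH] h; apply: eq1 => w; have [v ->] := row_free_lift w (bj _).
    have [hi|hi] := orP (orbN (i \in Iirr B)).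
      by apply: (xU (r := inr (Aend hi h))); rewrite /= b1 memvf.
    rewrite -[v]mul1mx -(hprojK j) -mulmxA -[inc i j *m v]mul1mx -[1%:M](bidem_sum (B ord0)).
    rewrite mulmx_suml !mulmx_sumr; apply: rpred_sum => j0 _.
    have := xU (r := inr (Areg hi h j0)) (v := proj ord0 j0 *m (inc i j *m v)).
    by rewrite /= b1 memvf !mulmxA; apply.
  by apply: (xU (r := inr (Aleg (l := Ordinal (ltnW h)) h))); rewrite /= IH memvf.
by case=> [i hi j|i j [l h]].
Qed.

End Subrep.

Lemma data_rep_irr (d : data) : framed d -> block_rel d -> hisleg d -> pparts_irr (data_conn d) -> rep_irr (data_rep d).
Proof.
move=> gd br ld irr U xU; apply: (Ublk_irr gd br _ xU ld irr).
by move=> i j l; have [_ _ ->] := ld i j.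
Qed.

(** * The correspondence of orbits *)

Lemma gl_orbit_refl (A : pparts F n.+1 k) : gl_orbit A A.
Proof.
exists 1%:M; first exact: unitmx1.
by apply/functional_extensionality_dep => i; apply/functional_extensionality_dep => l; rewrite invmx1 mul1mx mulmx1.
Qed.

Lemma gl_orbit_sym (A A' : pparts F n.+1 k) : gl_orbit A A' -> gl_orbit A' A.
Proof.
case=> g ug ->; exists (invmx g); first by rewrite unitmx_inv.
apply/functional_extensionality_dep => i; apply/functional_extensionality_dep => l.
by rewrite invmxK conjK.
Qed.

Lemma gl_orbit_trans (A A' A'' : pparts F n.+1 k) : gl_orbit A A' -> gl_orbit A' A'' -> gl_orbit A A''.
Proof.
case=> g ug ->; case=> h uh ->; exists (h *m g); first by rewrite unitmx_mul uh.
apply/functional_extensionality_dep => i; apply/functional_extensionality_dep => l.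
have -> : invmx (h *m g) = invmx g *m invmx h.
  have u : h *m g \in unitmx by rewrite unitmx_mul uh.
  by rewrite -[RHS](mulKmx u) -mulmxA mulKVmx // mulmxV // mulmx1.
by rewrite !mulmxA.
Qed.

Lemma gl_orbit_eq (A A' : pparts F n.+1 k) : gl_orbit A A' -> gl_orbit A = gl_orbit A'.
Proof.
move=> AA'; apply/seteqP; split=> Z; [exact/gl_orbit_trans/gl_orbit_sym|exact/gl_orbit_trans].
Qed.

Lemma rep_orbit_refl (x : drep F alpha) : rep_orbit x x.
Proof.
exists (fun=> 1%:M); first by move=> a; exact: unitmx1.
by apply/functional_extensionality_dep => r; rewrite invmx1 mul1mx mulmx1.
Qed.

Lemma pparts_irr_conj (A : pparts F n.+1 k) (g : M) : g \in unitmx -> pparts_irr A ->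
  pparts_irr (fun i l => g *m A i l *m invmx g).
Proof.
move=> ug irr U SU.
have ig v : g *m v = 0 -> v = 0 by move=> e; rewrite -[v](mulKmx ug) e mulmx0.
have [i l v|V0|V1] := irr (linfun (mulmx (invmx g) : 'cV_n.+1 -> 'cV_n.+1) @: U)%VS.
- move=> /img_mxP[u uU ->]; rewrite -[_ *m _](mulKmx ug); apply: mem_img_mx.
  by have := SU i l u uU; rewrite !mulmxA.
- left; apply/eqP; rewrite -subv0; apply/subvP => v /(mem_img_mx (invmx g)).
  by rewrite V0 !memv0 => /eqP e; rewrite -[v](mulKVmx ug) e mulmx0.
- right; apply/vspaceP => v; rewrite memvf.
  have : invmx g *m v \in (linfun (mulmx (invmx g) : 'cV_n.+1 -> 'cV_n.+1) @: U)%VS by rewrite V1 memvf.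
  by case/img_mxP => u uU /(congr1 (mulmx g)); rewrite !mulKVmx // => ->.
Qed.

Lemma cross_data_rep (d : data) i (hi : i \in Iirr B) (h0 : i != ord0) : cross_mx (data_rep d) hi h0 = dX d i.
Proof.
apply: (blocks_eq (i := i) (i' := ord0)) => j' j.
exact: (bproj_block (bsize_sum (B i)) (bsize_sum (B ord0))
  (fun j' j => data_rep d (inl (Across xi j hi h0 j')) : 'M[F]_(bsize (B i) j', bsize (B ord0) j)) j' j).
Qed.

Definition in_fiber (x : drep F alpha) := (forall a, moment x a = (shifted_lambda a)%:M) /\ rep_irr x.

Definition connection (A : pparts F n.+1 k) :=
  [/\ forall i, torbit (htl_ppart (B i)) (A i), pparts_irr A & \sum_(i < p.+1) residue A i = 0].

Lemma connection_data A : connection A ->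
  exists d : data, [/\ framed d, in_fiber (data_rep d) & gl_orbit A (data_conn d)].
Proof.
case=> oA iA sA; have [d [g [gd ug br ld e]]] := data_exists oA sA.
exists d; split=> //; last by exists g.
split; last by apply: (data_rep_irr gd br ld); rewrite e; exact: pparts_irr_conj.
by apply/(momentP gd); split=> // i j l; have [_ _ ->] := ld i j.
Qed.

Lemma in_fiber_rel (d : data) : framed d -> in_fiber (data_rep d) -> block_rel d /\ hisleg d.
Proof.
move=> gd [mo irr]; have [br lr] := (momentP gd).1 mo.
by split=> //; exact: irr_isleg.
Qed.

Lemma data_connection (d : data) : framed d -> in_fiber (data_rep d) -> connection (data_conn d).
Proof.
move=> gd [mo irr]; have [br lr] := (momentP gd).1 mo.
split; last exact: sum_residue.
- by move=> i; apply: data_conn_torbit => //; exact: irr_isleg.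
- exact: data_conn_irr.
Qed.

Lemma gl_rep_orbit (d d' : data) : framed d -> framed d' -> in_fiber (data_rep d) -> in_fiber (data_rep d') ->
  gl_orbit (data_conn d) (data_conn d') -> rep_orbit (data_rep d) (data_rep d').
Proof.
move=> gd gd' fd fd' [g ug e]; have [br ld] := in_fiber_rel gd fd; have [br' ld'] := in_fiber_rel gd' fd'.
have [H [G HG]] := dconj_of_data_conn gd gd' br br' ld ld' ug e.
exact: dconj_orbit HG.
Qed.

Lemma rep_gl_orbit (d d' : data) : framed d -> framed d' -> rep_orbit (data_rep d) (data_rep d') -> gl_orbit (data_conn d) (data_conn d').
Proof.
move=> gd gd' /(orbit_dconj) [H [G HG]]; exists (H ord0); first exact: (dc_uH HG).
exact: (data_conn_dconj gd gd' HG).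
Qed.

(** All admissible data over [O] are allowed, so no representative is chosen; [PhiE] shows that on
    an orbit they fill exactly one orbit. *)
Definition Phi (O : set (pparts F n.+1 k)) : set (drep F alpha) :=
  [set x | exists d : data, [/\ framed d, in_fiber (data_rep d), O (data_conn d) & rep_orbit (data_rep d) x]]%classic.

Lemma PhiE A (d : data) : framed d -> in_fiber (data_rep d) -> gl_orbit A (data_conn d) -> Phi (gl_orbit A) = rep_orbit (data_rep d).
Proof.
move=> gd fd Ad; apply/seteqP; split=> [x [d' [gd' fd' Ad' [h uh ->]]]|x dx]; last by exists d.
have [g ug ->] := gl_rep_orbit gd gd' fd fd' (gl_orbit_trans (gl_orbit_sym Ad) Ad').
exists (fun a => h a *m g a); first by move=> a; rewrite unitmx_mul uh ug.
apply/functional_extensionality_dep => r.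
have -> : invmx (h (@src (Defs.double Q) r) *m g (@src (Defs.double Q) r)) =
    invmx (g (@src (Defs.double Q) r)) *m invmx (h (@src (Defs.double Q) r)).
  have u : h (@src (Defs.double Q) r) *m g (@src (Defs.double Q) r) \in unitmx by rewrite unitmx_mul uh ug.
  by rewrite -[RHS](mulKmx u) -mulmxA mulKVmx // mulmxV // mulmx1.
by rewrite !mulmxA.
Qed.

Local Notation var := (quiver_variety alpha shifted_lambda).

Lemma Phi_fun : set_fun (moduli B) var Phi.
Proof.
move=> _ [A cA <-]; have [d [gd fd Ad]] := connection_data cA.
by rewrite (PhiE gd fd Ad); exists (data_rep d).
Qed.

Lemma Phi_inj : set_inj (moduli B) Phi.
Proof.
move=> O O' /set_mem [A cA <-] /set_mem [A' cA' <-].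
have [d [gd fd Ad]] := connection_data cA; have [d' [gd' fd' Ad']] := connection_data cA'.
rewrite (PhiE gd fd Ad) (PhiE gd' fd' Ad') => e.
have dd' : rep_orbit (data_rep d) (data_rep d') by rewrite e; exact: rep_orbit_refl.
apply: gl_orbit_eq; apply: gl_orbit_trans Ad _.
exact: gl_orbit_trans (rep_gl_orbit gd gd' dd') (gl_orbit_sym Ad').
Qed.

(** The block matrices of the cross arrows are the [dX], so the determinant condition says precisely
    that normal data are framed. *)
Lemma Phi_image : (Phi @` moduli B = [set O | var O /\ cross_det_neq0 O])%classic.
Proof.
apply/seteqP; split=> [_ [O mO <-]|O [[x [mo irr] <-] det]].
  split; first exact: Phi_fun.
  case: mO => A cA <-; have [d [gd fd Ad]] := connection_data cA.
  rewrite (PhiE gd fd Ad) => x dx i hi h0; have [d' nd' xd'] := data_rep_surj x.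
  move: dx; rewrite xd' => /(orbit_dconj) [H [G HG]]; rewrite cross_data_rep.
  rewrite -unitfE -unitmxE; have [_ uX] := gd.
  have : dX d' i *m H ord0 \in unitmx by rewrite (dc_X HG) // unitmx_mul (dc_uH HG) uX.
  by rewrite unitmx_mul => /andP[].
have [d nd xd] := data_rep_surj x; rewrite xd in mo irr det *.
have gd : framed d.
  split=> // i; have [/andP[hi h0]|/nd ->] := orP (orbN ((i \in Iirr B) && (i != ord0))); last exact: unitmx1.
  by rewrite -(cross_data_rep d hi h0) unitmxE unitfE; apply: det; exact: rep_orbit_refl.
exists (gl_orbit (data_conn d)); first by exists (data_conn d) => //; exact: data_connection.
by apply: PhiE => //; exact: gl_orbit_refl.
Qed.

(** At pole 0 the shift counts the other poles of [Iirr], and here there are none. *)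
Lemma shifted_lambda_regular : Iirr B = [set ord0]%SET -> shifted_lambda = hlambda xi.
Proof.
move=> I0; apply/funext => -[i hi j|i j l]; rewrite /shifted_lambda /= ?mulr0 ?addr0 //.
have -> : i == ord0 by move: (hi); rewrite I0 inE.
by rewrite I0 finset.setDv cards0 oppr0 mulr0 addr0.
Qed.

Lemma Phi_bij : Iirr B = [set ord0]%SET -> set_bij (moduli B) var Phi.
Proof.
move=> I0; split; [exact: Phi_fun|exact: Phi_inj|].
move=> O vO; suff : (Phi @` moduli B)%classic O by [].
rewrite Phi_image; split=> // x _ i hi h0; exfalso.
by have := hi; rewrite I0 inE (negbTE h0).
Qed.

End Shifted.

(** Each dimension vector with nonzero shift part rules out one value of [zeta]; the vectors are
    finitely many, the natural numbers in [F] infinitely many. *)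
Lemma avoids_exists : injective (fun m : nat => m%:R : F) -> exists zeta, avoids zeta.
Proof.
move=> natr_inj; pose S := (\max_(a : vert Q) alpha a).+1.
pose lin (c : vert Q -> F) (f : {ffun vert Q -> 'I_S}) : F := \sum_a c a * (f a)%:R.
(* Where the shift part vanishes, the quotient is 0 by convention and merely excludes one more
   value. *)
pose bad := [seq - lin (hlambda xi) f / lin lambda_shift f | f : {ffun vert Q -> 'I_S}].
have [m mb] : exists m : nat, m%:R \notin bad.
  apply: contrapT => all; pose s := [seq (m%:R : F) | m <- iota 0 (size bad).+1].
  have : (size s <= size bad)%N.
    apply: uniq_leq_size; first by rewrite map_inj_uniq ?iota_uniq //; exact: natr_inj.
    move=> c /mapP[m _ ->]; apply/negPn/negP => mb; apply: all; exists m.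
    exact: mb.
  by rewrite size_map size_iota ltnn.
exists m%:R => dv dvle; have dvS a : (dv a < S)%N.
  by rewrite ltnS; apply: leq_trans (dvle a) _; apply: (leq_bigmax a).
pose f : {ffun vert Q -> 'I_S} := [ffun a => Ordinal (dvS a)].
have linE c : \sum_a c a * (dv a)%:R = lin c f by apply: eq_bigr => a _; rewrite ffunE.
under eq_bigr => a _ do rewrite /shifted_lambda mulrDl -mulrA.
rewrite big_split /= -mulr_sumr !linE => /eqP; rewrite addrC addr_eq0 => /eqP e.
apply/eqP; apply: contraT => h0; case/negP: mb; apply/mapP; exists f; first by rewrite mem_enum.
by rewrite -e mulfK.
Qed.

End QuiverData.

Local Open Scope classical_set_scope.

Theorem theorem0p5 (R : realType) (n p : nat) (k : 'I_p.+1 -> nat)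
    (n_gt0 : (0 < n)%N) (k_gt0 : forall i, (0 < k i)%N)
    (B : forall i : 'I_p.+1, htl R[i] n (k i))
    (xi : forall i : 'I_p.+1, 'I_(nblk (B i)) -> seq R[i])
    (xi_res : xi_annihilates xi) :
  exists (lambda' : vert (hquiver xi) -> R[i])
         (Phi : set (pparts R[i] n k) -> set (drep R[i] (halpha xi))),
    [/\ set_fun (moduli B) (quiver_variety (halpha xi) lambda') Phi,
        set_inj (moduli B) Phi,
        Phi @` moduli B =
          [set O | quiver_variety (halpha xi) lambda' O
                   /\ cross_det_neq0 O]
      & Iirr B = [set ord0]%SET ->
          lambda' = hlambda xi /\
          set_bij (moduli B) (quiver_variety (halpha xi) lambda') Phi].
Proof.
(* Positive size, so that square matrices form a nontrivial ring and can be coefficients of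
   polynomials. *)
case: n n_gt0 B xi xi_res => // n _ B xi xi_res.
have natr_inj : injective (fun m : nat => m%:R : R[i]) by move=> m m' /eqP; rewrite Num.Theory.eqr_nat => /eqP.
have [zeta zetaP] := avoids_exists xi natr_inj.
exists (shifted_lambda zeta), (@Phi _ _ _ _ _ xi zeta); split.
- exact: Phi_fun.
- exact: Phi_inj.
- exact: Phi_image.
- by move=> I0; split; [exact: shifted_lambda_regular|exact: Phi_bij].
Qed.
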